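(* Let $d\ge3$, $2\le K\le d$, let $I\subset\mathbb{R}$ be a compact interval, let $\gamma:I\to\mathbb{R}^d$ be a $C^\infty$ curve and let $\chi\in C^\infty$ be supported in the interior of $I$. Suppose that for all $t\in I$ the vectors $\gamma'(t),\dots,\gamma^{(K)}(t)$ are linearly independent. Let $1\le q\le\infty$. Then for every $\sigma<\sigma_K(q)$ there is a constant $C_\sigma$ such that for all $R\ge2$ $$G_q(R)\le C_\sigma R^{-\sigma}.$$
   Context: For $\gamma$ and $\chi$ as in the claim, let $\widehat\mu(\xi)=\int e^{-i\langle\xi,\gamma(t)\rangle}\chi(t)\,dt$ for $\xi\in\mathbb{R}^d$, the Fourier transform of the measure $\mu$ given by $\langle\mu,f\rangle=\int f(\gamma(t))\chi(t)\,dt$. Put $$G_q(R)=\Big(\int_{S^{d-1}}|\widehat\mu(R\omega)|^q\,d\omega\Big)^{1/q},$$ where $d\omega$ is the rotation invariant measure on $S^{d-1}$ induced by Lebesgue measure in $\mathbb{R}^d$, and $G_\infty(R)=\max_{\omega\in S^{d-1}}|\widehat\mu(R\omega)|$. For $1\le q\le\infty$ define $$\sigma_K(q)\equiv\sigma_K^d(q)=\begin{cases}\displaystyle\min_{k=2,\dots,d}\Big\{\frac1k+\frac{k^2-k-2}{2kq}\Big\}, & K=d,\\[2mm] \displaystyle\min\Big\{\frac Kq,\ \min_{k=2,\dots,K}\Big(\frac1k+\frac{k^2-k-2}{2kq}\Big)\Big\}, & 2\le K<d,\end{cases}$$ with $1/q=0$ when $q=\infty$. The constant $C_\sigma$ is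 independent of $R$ (it may depend on $\gamma,\chi,q,\sigma$). *)

(* Defs.v *)
From HB Require Import structures.
From mathcomp Require Import all_boot all_order all_algebra.
From mathcomp Require Import all_classical all_reals all_analysis.
From mathcomp Require Import measurable_realfun complex.

Set Implicit Arguments.
Unset Strict Implicit.
Unset Printing Implicit Defensive.

Import Order.TTheory GRing.Theory Num.Theory.
Import numFieldNormedType.Exports.

Local Open Scope classical_set_scope.
Local Open Scope ring_scope.

Section within.
Context {R : realType} {V : normedModType R}.

Definition quotient_within (f : R -> V) (t s : R) : V :=
  (s - t)^-1 *: (f s - f t).

(* One-sided at the endpoints when [D] is an interval; only the values of [f]
   on [D] matter at points of [D]. *)
Definition derivable_within (D : set R) (f : R -> V) (t : R) : Prop :=
  cvg (quotient_within f t s @[s --> within D t^']).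

Definition derive_within (D : set R) (f : R -> V) (t : R) : V :=
  lim (quotient_within f t s @[s --> within D t^']).

Definition derive_within_n (D : set R) (n : nat) (f : R -> V) : R -> V :=
  iter n (derive_within D) f.

Definition smooth_within (D : set R) (f : R -> V) : Prop :=
  forall n t, D t -> derivable_within D (derive_within_n D n f) t.

Definition smooth (f : R -> V) : Prop :=
  forall n t, derivable (derive1n n f) t 1.

End within.

Section euclidean.
Context {R : realType} {n : nat}.
Implicit Types x y : 'rV[R]_n.

Definition dot x y : R := \sum_(i < n) x 0 i * y 0 i.

(* The library norm [`|x|] on matrices is the sup norm. *)
Definition enorm x : R := Num.sqrt (dot x x).

Definition sphere : set 'rV[R]_n := [set x | enorm x = 1].

Definition punctured_ball : set 'rV[R]_n := [set x | 0 < enorm x <= 1].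

Definition normalize x : 'rV[R]_n := (enorm x)^-1 *: x.

End euclidean.
Arguments sphere : clear implicits.
Arguments punctured_ball : clear implicits.

(* Product (Borel) sigma-algebra, generated by the coordinates. *)
Definition measure_rV_display : measure_display -> measure_display.
Proof. exact. Qed.

Section measurable_rV.
Context {R : realType} (n : nat).

Let coord (i : 'I_n) (x : 'rV[R]_n) : measurableTypeR R := x 0 i.

Let rV_set0 : g_sigma_preimage coord set0.
Proof. exact: sigma_algebra0. Qed.

Let rV_setC A : g_sigma_preimage coord A -> g_sigma_preimage coord (~` A).
Proof. exact: sigma_algebraC. Qed.

Let rV_bigcup (F : _^nat) : (forall i, g_sigma_preimage coord (F i)) ->
  g_sigma_preimage coord (\bigcup_i (F i)).
Proof. exact: sigma_algebra_bigcup. Qed.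

HB.instance Definition _ :=
  @isMeasurable.Build (measure_rV_display default_measure_display)
    'rV[R]_n (g_sigma_preimage coord) rV_set0 rV_setC rV_bigcup.

End measurable_rV.

Section measurability.
Context {R : realType}.

Lemma measurable_coord n (i : 'I_n) :
  measurable_fun [set: 'rV[R]_n] (fun x => x 0 i : measurableTypeR R).
Proof.
move=> _ Y mY; rewrite setTI; apply: sub_sigma_algebra => /=.
rewrite -bigcup_seq/=; exists i => /=; first by rewrite mem_index_enum.
by exists Y => //; rewrite setTI.
Qed.

Lemma measurable_fun_rV d (T : measurableType d) n (f : T -> 'rV[R]_n) :
  (forall i, measurable_fun [set: T] (fun t => f t 0 i : measurableTypeR R)) ->
  measurable_fun [set: T] f.
Proof.
move=> mf.
suff prefS : g_sigma_preimage
    (fun i t => f t 0 i : measurableTypeR R) `<=` measurable.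
  move=> _ A mA; apply: prefS.
  have := @g_sigma_preimage_comp _ (measurableTypeR R) n _
    (fun i (x : 'rV[R]_n) => x 0 i) _ f.
  by rewrite /comp => ->; exists A.
apply: smallest_sub; first exact: sigma_algebra_measurable.
case: n f mf => [|n] f mf; first by rewrite big_ord0.
rewrite -bigcup_mkord_ord; apply: bigcup_sub => i Ii.
by move=> A [B mB <-]; exact: mf.
Qed.

Definition cons_rV n (p : measurableTypeR R * 'rV[R]_n) : 'rV[R]_n.+1 :=
  \row_i oapp (p.2 0) p.1 (unlift ord0 i).

Lemma measurable_cons_rV n : measurable_fun setT (@cons_rV n).
Proof.
apply: measurable_fun_rV => i.
under eq_fun do rewrite mxE.
case: (unlift ord0 i) => [j|] /=.
  exact: (measurableT_comp (measurable_coord j) measurable_snd).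
exact: measurable_fst.
Qed.

Lemma measurable_enorm n :
  measurable_fun setT (enorm : 'rV[R]_n -> measurableTypeR R).
Proof.
apply: (@measurableT_comp _ _ _ _ _ _ (Num.sqrt : R -> R)).
  exact: (continuous_measurable_fun (@sqrt_continuous R)).
apply: measurable_sum => i.
by apply: measurable_funM; exact: measurable_coord.
Qed.

Lemma measurable_punctured_ball n : measurable (punctured_ball R n).
Proof.
have := @measurable_enorm n measurableT `]0, 1]%classic (measurable_itv _).
by rewrite setTI.
Qed.

Lemma measurable_normalize n : measurable_fun setT (@normalize R n).
Proof.
apply: measurable_fun_rV => i.
rewrite (_ : (fun _ => _) = (fun x => (enorm x `^ (-1)) * x 0 i)); last first.
  by apply/funext => x; rewrite mxE powR_inv1// sqrtr_ge0.
apply: measurable_funM; last exact: measurable_coord.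
apply: (measurableT_comp (measurable_powR _)).
exact: measurable_enorm.
Qed.

End measurability.

HB.instance Definition _ (R : realType) n := isMeasurableFun.Build _ _ _ _
  (@cons_rV R n) (@measurable_cons_rV R n).

HB.instance Definition _ (R : realType) n := isMeasurableFun.Build _ _ _ _
  (@normalize R n) (@measurable_normalize R n).

Section lebesgue_succ.
Context {R : realType} (n : nat).
Variable mu : {sigma_finite_measure set 'rV[R]_n -> \bar R}.
Local Open Scope ereal_scope.

Definition lebesgue_succ : set 'rV[R]_n.+1 -> \bar R :=
  pushforward (lebesgue_measure \x mu) (@cons_rV R n).

Let lebesgue_succ0 : lebesgue_succ set0 = 0.
Proof. exact: measure0. Qed.

Let lebesgue_succ_ge0 A : 0 <= lebesgue_succ A.
Proof. exact: measure_ge0. Qed.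

Let lebesgue_succ_sigma_additive : semi_sigma_additive lebesgue_succ.
Proof. exact: measure_semi_sigma_additive. Qed.

HB.instance Definition _ := isMeasure.Build _ _ _ lebesgue_succ
  lebesgue_succ0 lebesgue_succ_ge0 lebesgue_succ_sigma_additive.

Let lebesgue_succ_sigma_finite : sigma_finite setT lebesgue_succ.
Proof.
have /sigma_finiteP[F [FT ndF Foo]] :=
  @sigma_finiteT _ _ R (@lebesgue_measure R).
have /sigma_finiteP[G [GT ndG Goo]] := sigma_finiteT mu.
pose split (x : 'rV[R]_n.+1) : measurableTypeR R * 'rV[R]_n :=
  (x ord0 ord0, \row_j x ord0 (lift ord0 j)).
have consK : cancel (@cons_rV R n) split.
  move=> [t x]; rewrite /split mxE unlift_none/=; congr (_, _).
  by apply/rowP => j; rewrite !mxE liftK.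
have msplit : measurable_fun setT split.
  apply/measurable_fun_pair => /=; first exact: measurable_coord.
  apply: measurable_fun_rV => i; under eq_fun do rewrite mxE.
  exact: measurable_coord.
exists (fun k => split @^-1` (F k `*` G k)).
  apply/esym/seteqP; split=> // x _.
  have [k1 _ Fx] : (\bigcup_k F k) (split x).1 by rewrite -FT.
  have [k2 _ Gx] : (\bigcup_k G k) (split x).2 by rewrite -GT.
  exists (maxn k1 k2) => //; split => /=.
    by move: Fx; exact/subsetPset/ndF/leq_maxl.
  by move: Gx; exact/subsetPset/ndG/leq_maxr.
move=> k; have [mF Fk] := Foo k; have [mG Gk] := Goo k; split.
  by rewrite -[X in measurable X]setTI; apply: msplit => //; exact: measurableX.
rewrite /lebesgue_succ /pushforward -comp_preimage.
rewrite (_ : split \o _ = id) ?preimage_id; last exact/funext/consK.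
by rewrite product_measure1E// lte_mul_pinfty// ge0_fin_numE.
Qed.

HB.instance Definition _ := Measure_isSigmaFinite.Build _ _ _
  lebesgue_succ lebesgue_succ_sigma_finite.

End lebesgue_succ.

Fixpoint lebesgue_rV (R : realType) (n : nat) :
    {sigma_finite_measure set 'rV[R]_n -> \bar R} :=
  if n is m.+1 then lebesgue_succ (lebesgue_rV R m) else dirac (0 : 'rV[R]_0).

Section sphere_measure.
Context (R : realType) (n : nat).
Local Open Scope ereal_scope.

(* Surface measure on the unit sphere as cone measure: by polar coordinates,
   the Lebesgue measure of the cone [{r w | 0 < r <= 1, w in A}] over a Borel
   subset [A] of the sphere is [1/n] times the surface area of [A]. *)
Definition sphere_measure (A : set 'rV[R]_n) : \bar R :=
  n%:R%:E * lebesgue_rV R n (normalize @^-1` A `&` punctured_ball R n).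

Let sphere_measure0 : sphere_measure set0 = 0.
Proof. by rewrite /sphere_measure preimage_set0 set0I measure0 mule0. Qed.

Let sphere_measure_ge0 A : 0 <= sphere_measure A.
Proof. by rewrite mule_ge0. Qed.

Let sphere_measure_sigma_additive : semi_sigma_additive sphere_measure.
Proof.
move=> F mF tF mUF; rewrite /sphere_measure preimage_bigcup.
under eq_fun do rewrite -ge0_sume_distrr//.
apply: cvgeZl => //; rewrite setI_bigcupl.
have mN A : measurable A -> measurable (@normalize R n @^-1` A).
  by move=> mA; rewrite -[X in measurable X]setTI; exact: measurable_normalize.
have mB := @measurable_punctured_ball R n.
apply: measure_semi_sigma_additive.
- by move=> i; apply: measurableI => //; exact: mN.
- apply: trivIset_setIr; apply/trivIsetP => i j _ _ ij.
  by rewrite -preimage_setI; move/trivIsetP : tF => ->//; rewrite preimage_set0.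
- by rewrite -setI_bigcupl -preimage_bigcup; apply: measurableI => //; exact: mN.
Qed.

HB.instance Definition _ := isMeasure.Build _ _ _ sphere_measure
  sphere_measure0 sphere_measure_ge0 sphere_measure_sigma_additive.

End sphere_measure.
Arguments sphere_measure : clear implicits.

Section fourier.
Context {R : realType}.
Local Open Scope complex_scope.

Definition expi (x : R) : R[i] := cos x +i* sin x.

Definition cintegral d (T : measurableType d) (mu : {measure set T -> \bar R})
    (D : set T) (f : T -> R[i]) : R[i] :=
  (\int[mu]_(x in D) complex.Re (f x)) +i* (\int[mu]_(x in D) complex.Im (f x)).

Definition csmooth (f : R -> R[i]) : Prop :=
  smooth (fun t => complex.Re (f t)) /\ smooth (fun t => complex.Im (f t)).

Definition csupport (f : R -> R[i]) : set R := closure [set t | f t != 0].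

Definition fourier_curve n (I : set R) (gamma : R -> 'rV[R]_n) (chi : R -> R[i])
    (xi : 'rV[R]_n) : R[i] :=
  cintegral lebesgue_measure I (fun t => expi (- dot xi (gamma t)) * chi t).

Definition sphere_average n (I : set R) (gamma : R -> 'rV[R]_n)
    (chi : R -> R[i]) (q : \bar R) (r : R) : \bar R :=
  let g (w : 'rV[R]_n) := (Normc.normc (fourier_curve I gamma chi (r *: w)))%:E in
  match q with
  | p%:E => ((\int[sphere_measure R n]_(w in sphere R n) (g w `^ p)) `^ p^-1)%E
  | _ => ereal_sup [set g w | w in sphere R n]
  end.

End fourier.

Section exponent.
Context {R : realType}.

(* [1/q], equal to [0] for [q = +oo]. *)
Definition recip (q : \bar R) : R := if q is p%:E then p^-1 else 0.

Definition sigma_term (k : nat) (q : \bar R) : R :=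
  k%:R^-1 + (k%:R ^+ 2 - k%:R - 2) / (2 * k%:R) * recip q.

(* The initial value of the iterated minimum is its [k = 2] term, which changes
   nothing for [2 <= m]. *)
Definition sigma_min (m : nat) (q : \bar R) : R :=
  \big[Num.min/sigma_term 2 q]_(2 <= k < m.+1) sigma_term k q.

Definition sigma_crit (d K : nat) (q : \bar R) : R :=
  if K == d then sigma_min d q
  else Num.min (K%:R * recip q) (sigma_min K q).

End exponent.

(* Main.v *)
(* The curve is discretized on a [b]-adic grid, with [b] about [R^(1/A)] for a
   large [A], so that losses of fixed powers of [b] cost only [R^(O(1/A))].
   It suffices to bound the integral of [|mu^(R w)|^q] by [R^-k] at the corners
   [q = (k^2 + k + 2) / 2] of the exponent; pointwise interpolation does the
   rest, with van der Corput's estimate covering large [q] when [K = d].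

   At a corner, let the first [n] derivatives of the curve be nearly orthogonal
   to [w] on an interval of length [1/b], and the next one not. If [n < k], van
   der Corput bounds every sum over a piece of that interval by
   [R^(-1/(n + 1))]. The broad-narrow iteration of Bourgain and Guth bounds the
   sum over the interval by products of squared sums over [n] separated pieces,
   at all scales. Integrate such a product against a smooth cutoff to
   the directions nearly orthogonal to the first [n] derivatives at the left end
   of the interval: when the sum of the differences [gamma (x_j) - gamma (y_j)]
   is at least [b/R], it is nearly a combination of those derivatives, so the
   phase is nonstationary on the sphere and the contribution negligible.
   The pairs of tuples with a smaller difference have nearby power sums, and are
   counted coordinate by coordinate. *)
Require Import Defs.
From HB Require Import structures.
From mathcomp Require Import all_boot all_order all_algebra.
From mathcomp Require Import all_classical all_reals all_analysis.
From mathcomp Require Import measurable_realfun complex.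
From mathcomp Require polyrcf.
From mathcomp Require Import ring lra zify.

Set Implicit Arguments.
Unset Strict Implicit.
Unset Printing Implicit Defensive.

Import Order.TTheory GRing.Theory Num.Theory.
Import numFieldNormedType.Exports.

Local Open Scope classical_set_scope.
Local Open Scope ring_scope.

(** * Power sums of separated points *)

(** The corners come from a balance over the scales. At generation [m] put [l = b^-(m+1)]. There are
    about [1/l] intervals. A normalized product of [n] squared pieces integrates to about
    [l^n * l^-C(n,2) * r^-n], since coordinate [i] of a tuple has room [l^-i] in the count of near
    pairs, and each of the other [q - 2n] factors gains [l]. These powers of [l] cancel exactly for
    [q = C(n+1,2) + 1], so every scale costs the same. At a later corner the surplus factors are
    paid by van der Corput, and [q_k - q_n >= (n+1)(k-n)] is what turns [r^-n] into [r^-k]. Two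
    obstacles shape the tools. Power sums of higher order must be controlled by the first ones with
    a constant free of [l], because separated pieces occur at all scales; an interlacing polynomial
    does this. Oscillation on the sphere is exploited in Cartesian coordinates, because surface
    measure is a cone measure: one integrates by parts along a single coordinate line, with bounds
    that must stay uniform as the line approaches the origin. *)

Lemma card_triangular (T : finType) (c : nat -> T -> nat) (B : nat -> nat)
    (n : nat) (Y : {set T}) :
  (forall y y', y \in Y -> y' \in Y ->
     (forall i, (i < n)%N -> c i y = c i y') -> y = y') ->
  (forall i y y', (i < n)%N -> y \in Y -> y' \in Y ->
     (forall j, (i < j < n)%N -> c j y = c j y') -> (c i y <= c i y' + B i)%N) ->
  (#|Y| <= \prod_(i < n) (B i).+1)%N.
Proof.
elim: n Y => [|n IH] Y injc HB.
  rewrite big_ord0; apply/card_le1_eqP => y y' Yy Yy'.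
  by apply: injc.
have [->|/set0Pn[y0 Yy0]] := eqVneq Y finset.set0; first by rewrite cards0.
(* The last coordinate is constrained without any agreement, so it takes at most [B n + 1] values.
   Within one of its fibres the next coordinate down is constrained in the same way. *)
pose m := c n [arg min_(y < y0 | y \in Y) c n y].
have mP y : y \in Y -> (m <= c n y <= m + B n)%N.
  move=> Yy; rewrite /m; case: arg_minnP => //= z Yz zmin.
  rewrite zmin//=; apply: HB => // j /andP[nj].
  by rewrite ltnS leqNgt nj.
pose F (v : 'I_(B n).+1) := [set y in Y | c n y == (m + v)%N].
have YF : Y \subset (\bigcup_v F v)%SET.
  apply/fintype.subsetP => y Yy; have /andP[my yB] := mP _ Yy.
  have vB : (c n y - m < (B n).+1)%N by rewrite ltnS leq_subLR.
  apply/bigcupP; exists (Ordinal vB) => //.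
  by rewrite !inE Yy/= subnKC.
apply: (leq_trans (subset_leq_card YF)).
apply: (@leq_trans (\sum_(v < (B n).+1) #|F v|)%N).
  elim/big_rec2: _ => [|v s A _ h]; first by rewrite cards0.
  by apply: (leq_trans (leq_card_setU _ _)); rewrite leq_add2l.
rewrite [leqRHS]big_ord_recr/= mulnC -[X in (X * _)%N]card_ord -sum_nat_const.
apply: leq_sum => v _; apply: IH.
  move=> y y'; rewrite !inE => /andP[Yy /eqP yv] /andP[Yy' /eqP yv'] h.
  apply: injc => // i; rewrite ltnS leq_eqVlt => /predU1P[->|/h//].
  by rewrite yv yv'.
move=> i y y' ni; rewrite !inE => /andP[Yy /eqP yv] /andP[Yy' /eqP yv'] h.
apply: HB => //; first exact: ltnW.
move=> j /andP[ij]; rewrite ltnS leq_eqVlt => /predU1P[->|jn].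
  by rewrite yv yv'.
by apply: h; rewrite ij.
Qed.

Section power_sums.
Context {R : realType}.
Implicit Types (x y al : nat -> R) (l M : R).

Definition antideriv (p : {poly R}) : {poly R} :=
  \poly_(i < (size p).+1) (p`_i.-1 / i%:R).

Lemma deriv_antideriv (p : {poly R}) : (antideriv p)^`() = p.
Proof.
apply/polyP => i; rewrite coef_deriv coef_poly ltnS.
case: ltnP => [ip|pi]; last by rewrite mul0rn nth_default.
by rewrite -[LHS]mulr_natr divfK// pnatr_eq0.
Qed.

Lemma size_antideriv (p : {poly R}) : (size (antideriv p) <= (size p).+1)%N.
Proof. exact: size_poly. Qed.

Lemma coef_antideriv_le (p : {poly R}) c r : (forall i, `|p`_i| <= c) ->
  `|(antideriv p)`_r| <= c.
Proof.
move=> pc; have c0 : 0 <= c := le_trans (normr_ge0 _) (pc 0%N).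
rewrite coef_poly; case: ifP => _; last by rewrite normr0.
rewrite normrM normfV normr_nat; case: r => [|r]; first by rewrite invr0 mulr0.
rewrite -[leRHS]mulr1 ler_pM//.
by rewrite invf_le1 ?ler1n.
Qed.

Lemma poly_mean_value (p : {poly R}) (a b lo hi : R) :
  lo <= a <= hi -> lo <= b <= hi ->
  exists2 c, lo <= c <= hi & p.[a] - p.[b] = p^`().[c] * (a - b).
Proof.
wlog ba : a b / b <= a => [wl ha hb|].
  have [ba|/ltW ab] := leP b a; first exact: wl.
  have [c hc e] := wl b a ab hb ha; exists c => //.
  by rewrite -opprB e -mulrN opprB.
move=> /andP[la ha] /andP[lb hb]; move: ba.
rewrite le_eqVlt => /predU1P[->|ba].
  by exists a; rewrite ?la// !subrr mulr0.
have [c] := polyrcf.poly_mvt p ba; rewrite in_itv/= => /andP[bc ca] e.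
by exists c => //; rewrite (le_trans lb (ltW bc)) (le_trans (ltW ca) ha).
Qed.

Lemma coef_prod_XsubC_le n (z : nat -> R) r :
  (forall i, (i < n)%N -> `|z i| <= 1) ->
  `|(\prod_(i < n) ('X - (z i)%:P))`_r| <= 2 ^+ n.
Proof.
elim: n r => [|n IH] r z1; first by rewrite big_ord0 coef1 normr_nat expr0 lern1 leq_b1.
rewrite big_ord_recr/= mulrBr coefB coefMX coefMC exprSr mulr_natr mulr2n.
apply: (le_trans (ler_normB _ _)); apply: lerD.
  by case: eqP => _; [rewrite normr0 exprn_ge0|apply: IH => i /ltnW; exact: z1].
rewrite normrM -[leRHS]mulr1 ler_pM//; last exact: z1.
by apply: IH => i /ltnW; exact: z1.
Qed.

(** [x j] and [y j] share an interval of length [l], and neighbouring intervals leave a gap of at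
    least [l]: a root placed inside the gap stays at distance [l / 2] from both. *)
Definition separated n al l x y :=
  [/\ 0 < l, 0 <= al 0%N, al n + l <= 1,
      (forall i, (i < n)%N -> al i + 2 * l <= al i.+1) &
      (forall i, (i <= n)%N -> al i <= x i <= al i + l /\ al i <= y i <= al i + l)].

Definition power_diff n x y r := \sum_(j < n.+1) (x j ^+ r - y j ^+ r).

Lemma horner_diff n x y (p : {poly R}) k : (size p <= k)%N ->
  \sum_(j < n.+1) (p.[x j] - p.[y j]) = \sum_(r < k) p`_r * power_diff n x y r.
Proof.
move=> pk; rewrite /power_diff; under [RHS]eq_bigr do rewrite mulr_sumr.
rewrite exchange_big/=; apply: eq_bigr => j _.
rewrite !(horner_coef_wide _ pk) -sumrB.
by apply: eq_bigr => r _; rewrite mulrBr.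
Qed.

Lemma power_diff0 n x y : power_diff n x y 0 = 0.
Proof. by rewrite /power_diff big1// => i _; rewrite subrr. Qed.

Section interlacing.
Variables (n : nat) (al : nat -> R) (l : R) (x y : nat -> R).
Hypothesis sep : separated n al l x y.

Let s j := x j < y j.
(* [W] has a root between two neighbouring intervals exactly when the sign of
   [x - y] changes there, so that all the integrals of [W] from [y j] to [x j]
   have the same sign; the remaining factors are padded with the root [-1]. *)
Let z i := if s i == s i.+1 then -1 else al i + 3 / 2 * l.
Let W : {poly R} := \prod_(i < n) ('X - (z i)%:P).

Let al_lt i j : (i < j)%N -> (j <= n)%N -> al i + 2 * l <= al j.
Proof.
case: sep => l0 _ _ h _; elim: j => // j IH; rewrite ltnS leq_eqVlt.
move=> /predU1P[->|ij] jn; first exact: h.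
have := IH ij (ltnW jn); have := h j jn; lra.
Qed.

Let al_ge0 i : (i <= n)%N -> 0 <= al i.
Proof.
case: sep => l0 a0 _ _ _; case: i => // i /(al_lt (ltn0Sn _)); lra.
Qed.

Let al_le1 i : (i <= n)%N -> al i + l <= 1.
Proof.
case: sep => l0 _ a1 _ _; rewrite leq_eqVlt => /predU1P[->//|iln].
have := al_lt iln (leqnn _); lra.
Qed.

Let W_factor i j t : (i < n)%N -> (j <= n)%N -> al j <= t <= al j + l ->
  t - z i = (if (j <= i)%N then (-1) ^+ (s i (+) s i.+1) else 1) * `|t - z i| /\
  l / 2 <= `|t - z i|.
Proof.
case: sep => l0 _ _ _ _ iln jn /andP[t1 t2].
have aj := al_ge0 jn; have aj1 := al_le1 jn.
rewrite /z; case: eqVneq => [->|nes].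
  rewrite addbb expr0 if_same mul1r ger0_norm; last lra.
  by split=> //; lra.
have -> : s i (+) s i.+1 = true by move: nes; case: (s i); case: (s i.+1).
case: leqP => ij.
  have h : al j <= al i.
    move: ij; rewrite leq_eqVlt => /predU1P[->//|ij].
    have := al_lt ij (ltnW iln); lra.
  rewrite ler0_norm; last lra.
  split; [by rewrite expr1; ring|lra].
have := al_lt ij jn => h; rewrite ger0_norm; last lra.
by split; [rewrite mul1r|lra].
Qed.

Let hornerW t : W.[t] = \prod_(i < n) (t - z i).
Proof. by rewrite /W horner_prod; apply: eq_bigr => i _; rewrite hornerXsubC. Qed.

Let telescope j m : (j <= m)%N ->
  \prod_(i < m) (if (j <= i)%N then (-1) ^+ (s i (+) s i.+1) else 1)
   = (-1) ^+ (s j (+) s m) :> R.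
Proof.
elim: m => [|m IH]; first by rewrite leqn0 => /eqP ->; rewrite big_ord0 addbb.
rewrite leq_eqVlt => /predU1P[->|jm].
  rewrite addbb big1// => i _; rewrite leqNgt ltn_ord//.
rewrite big_ord_recr/= IH// -ltnS jm -signr_addb.
by rewrite -addbA [s m (+) _]addbA addbb addFb.
Qed.

Let W_sign j t : (j <= n)%N -> al j <= t <= al j + l ->
  (-1) ^+ (s j) * W.[t] = (-1) ^+ (s n) * `|W.[t]|.
Proof.
move=> jn tj; rewrite hornerW normr_prod.
rewrite (eq_bigr (fun i : 'I_n =>
  (if (j <= i)%N then (-1) ^+ (s i (+) s i.+1) else 1) * `|t - z i|)); last first.
  by move=> i _; have [] := W_factor (ltn_ord i) jn tj.
by rewrite big_split/= telescope// mulrA -signr_addb addbA addbb addFb.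
Qed.

Let W_ge j t : (j <= n)%N -> al j <= t <= al j + l -> (l / 2) ^+ n <= `|W.[t]|.
Proof.
move=> jn tj; rewrite hornerW normr_prod.
rewrite -[X in _ ^+ X]card_ord -prodr_const; apply: ler_prod => i _.
have [_ ->] := W_factor (ltn_ord i) jn tj.
by case: sep => l0 _ _ _ _; rewrite andbT; lra.
Qed.

(** Each factor is at least [l / 2] in size and two points of one interval differ by at most [l], so
    a factor changes by a ratio of at most 3. *)
Let W_comp j t t' : (j <= n)%N -> al j <= t <= al j + l ->
  al j <= t' <= al j + l -> `|W.[t']| <= 3 ^+ n * `|W.[t]|.
Proof.
move=> jn tj tj'; rewrite !hornerW !normr_prod.
rewrite -[X in _ ^+ X]card_ord -prodr_const -big_split/=.
apply: ler_prod => i _; rewrite normr_ge0/=.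
have [_ h] := W_factor (ltn_ord i) jn tj.
have : `|t' - t| <= l by rewrite ler_norml; lra.
have := ler_normD (t' - t) (t - z i); rewrite subrKA; lra.
Qed.

Let sign_diff j : x j - y j = (-1) ^+ (s j) * `|x j - y j|.
Proof.
rewrite /s; case: ltP => h; first by rewrite ltr0_norm ?subr_lt0// expr1; ring.
by rewrite ger0_norm ?subr_ge0// mul1r.
Qed.

Let coefW r : `|W`_r| <= 2 ^+ n.
Proof.
apply: coef_prod_XsubC_le => i iln; rewrite /z; case: eqP => _.
  by rewrite normrN1.
have := al_lt (ltnSn i) iln; have := al_le1 iln; have := al_ge0 (ltnW iln).
by case: sep => l0 _ _ _ _ *; rewrite ger0_norm; lra.
Qed.

Let sizeW : size W = n.+1.
Proof.
by rewrite /W -(big_mkord xpredT (fun i => 'X - (z i)%:P)) size_prod_XsubC size_iota subn0.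
Qed.

Let monicW : W \is monic.
Proof. by rewrite /W -(big_mkord xpredT (fun i => 'X - (z i)%:P)) monic_prod_XsubC. Qed.

Let ys j (jn : (j <= n)%N) : al j <= y j <= al j + l.
Proof. by case: sep => _ _ _ _ /(_ _ jn)[]. Qed.

Let xs j (jn : (j <= n)%N) : al j <= x j <= al j + l.
Proof. by case: sep => _ _ _ _ /(_ _ jn)[]. Qed.

(** Since all increments of the antiderivative of [W] have one sign, the sum of their absolute
    values is the absolute value of their sum, and the latter expands in power differences of orders
    1 to [n + 1]. The constant counts [n + 2] coefficients of size at most [2 ^ n]. *)
Let sumW M :
  (forall r, (1 <= r <= n.+1)%N -> `|power_diff n x y r| <= M) ->
  exists2 xi : nat -> R,
   (forall j, (j <= n)%N -> al j <= xi j <= al j + l) &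
   \sum_(j < n.+1) `|W.[xi j]| * `|x j - y j| <= n.+2%:R * 2 ^+ n * M.
Proof.
move=> PM; pose Q := antideriv W.
have /choice[xi xiP] : forall j, exists c, (j <= n)%N ->
    al j <= c <= al j + l /\ Q.[x j] - Q.[y j] = W.[c] * (x j - y j).
  move=> j; case: (leqP j n) => [jn|_]; last by exists 0.
  have [c hc e] := poly_mean_value Q (xs jn) (ys jn); exists c => _; split => //.
  by rewrite e deriv_antideriv.
exists xi => [j jn|]; first by have [] := xiP j jn.
have -> : \sum_(j < n.+1) `|W.[xi j]| * `|x j - y j| =
    (-1) ^+ s n * \sum_(j < n.+1) (Q.[x j] - Q.[y j]).
  rewrite mulr_sumr; apply: eq_bigr => j _; have jn : (j <= n)%N by rewrite -ltnS.
  have [xij ->] := xiP j jn.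
  rewrite [in RHS]sign_diff [W.[_] * (_ * _)]mulrCA (mulrA _ W.[xi j]).
  by rewrite (W_sign jn xij) !mulrA -signr_addb addbb mul1r.
apply: (le_trans (ler_norm _)); rewrite normrM normr_sign mul1r.
rewrite (@horner_diff n x y Q n.+2); last first.
  by rewrite (leq_trans (size_antideriv _))// sizeW.
apply: (le_trans (ler_norm_sum _ _ _)).
have M0 : 0 <= M by apply: (le_trans (normr_ge0 _) (PM 1%N _)).
rewrite -mulrA -[X in X%:R * _]card_ord mulr_natl -sumr_const; apply: ler_sum => r _.
rewrite normrM ler_pM//; first exact: coef_antideriv_le.
case: (posnP r) => [->|r0]; first by rewrite power_diff0 normr0.
by apply: PM; rewrite r0 -ltnS ltn_ord.
Qed.

Lemma separated_dist_le M j : (j <= n)%N ->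
  (forall r, (1 <= r <= n.+1)%N -> `|power_diff n x y r| <= M) ->
  `|x j - y j| * (l / 2) ^+ n <= n.+2%:R * 2 ^+ n * M.
Proof.
move=> jn /sumW[xi xiP]; apply: le_trans.
rewrite (bigD1 (Ordinal (jn : (j < n.+1)%N)))//= -[leLHS]addr0.
apply: lerD; last by apply: sumr_ge0 => i _; rewrite mulr_ge0.
by rewrite mulrC ler_wpM2r// (W_ge jn)// xiP.
Qed.

(** The points lie in [[0, 1]], so multiplying [W] by [X^e] only shrinks the increments, up to the
    factor [3 ^ n] for comparing two mean-value points. The antiderivative of [X^e * W] has leading
    coefficient [1 / (n + e + 1)], which isolates the new power difference. *)
Lemma power_diff_step M e C :
  (forall r, (1 <= r <= n.+1)%N -> `|power_diff n x y r| <= M) -> 1 <= C ->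
  (forall r, (1 <= r <= n + e)%N -> `|power_diff n x y r| <= C * M) ->
  `|power_diff n x y (n + e).+1| <=
     (n + e).+1%:R * (n + e).+1%:R * 2 ^+ n * C * M +
     (n + e).+1%:R * 3 ^+ n * (n.+2%:R * 2 ^+ n * M).
Proof.
move=> PM C1 PC; have [xi xiP sM] := sumW PM.
have M0 : 0 <= M by apply: (le_trans (normr_ge0 _) (PM 1%N _)).
pose Q := antideriv ('X^e * W).
have sizeXW : size ('X^e * W) = (n + e).+1.
  by rewrite mulrC size_mulXn ?monic_neq0// sizeW addnS addnC.
have sQ : (size Q <= (n + e).+2)%N.
  by rewrite (leq_trans (size_antideriv _))// sizeXW.
have Qtop : Q`_(n + e).+1 = (n + e).+1%:R^-1.
  rewrite coef_poly sizeXW ltnSn/= coefXnM leqNgt ltnS leq_addl/= addnK.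
  by move: monicW => /monicP; rewrite lead_coefE sizeW/= => ->; rewrite mul1r.
have sumQ : `|\sum_(j < n.+1) (Q.[x j] - Q.[y j])| <= 3 ^+ n * (n.+2%:R * 2 ^+ n * M).
  apply: (le_trans (ler_norm_sum _ _ _)); apply: le_trans (ler_wpM2l _ sM) => //.
  rewrite mulr_sumr; apply: ler_sum => j _; have jn : (j <= n)%N by rewrite -ltnS.
  have [c hc ->] := poly_mean_value Q (xs jn) (ys jn).
  rewrite deriv_antideriv hornerM hornerXn !normrM mulrA ler_wpM2r// -[leRHS]mul1r.
  apply: ler_pM => //; last exact: (W_comp jn (xiP _ jn)).
  rewrite normrX exprn_ile1// ger0_norm.
    by have := al_le1 jn; lra.
  by have := al_ge0 jn; lra.
rewrite (horner_diff _ _ _ sQ) big_ord_recr/= Qtop in sumQ.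
set S := \sum_(_ < _) _ in sumQ.
have SM : `|S| <= (n + e).+1%:R * 2 ^+ n * C * M.
  apply: (le_trans (ler_norm_sum _ _ _)).
  rewrite -!mulrA -[X in X%:R * _]card_ord mulr_natl -sumr_const; apply: ler_sum => r _.
  rewrite normrM ler_pM//.
    apply: coef_antideriv_le => i; rewrite coefXnM; case: ifP => _ //.
    by rewrite normr0 exprn_ge0.
  case: (posnP r) => [->|r0].
    by rewrite power_diff0 normr0 mulr_ge0// (le_trans ler01).
  by apply: PC; rewrite r0 -ltnS ltn_ord.
have n0 : (n + e).+1%:R != 0 :> R by rewrite pnatr_eq0.
rewrite -[X in `|X|](mulVKf n0) normrM normr_nat -!mulrA -mulrDr ler_wpM2l//.
rewrite -[X in `|X|](addKr S) addrC; apply: (le_trans (ler_normB _ _)).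
by rewrite [leRHS]addrC lerD//; [move: sumQ|move: SM]; rewrite -!mulrA.
Qed.

End interlacing.

(** The constant depends on neither [l] nor the position of the intervals, so one Taylor argument
    serves tuples of every generation. *)
Lemma power_diff_bound n e : exists2 C : R, 1 <= C &
  forall al l x y M, separated n al l x y ->
  (forall r, (1 <= r <= n.+1)%N -> `|power_diff n x y r| <= M) ->
  forall r, (1 <= r <= n + e)%N -> `|power_diff n x y r| <= C * M.
Proof.
elim: e => [|e [C C1 IH]].
  exists 1 => // al l x y M _ PM r /andP[r1]; rewrite addn0 => rn.
  by rewrite mul1r PM// r1 ltnW.
pose D : R := (n + e).+1%:R * (n + e).+1%:R * 2 ^+ n * C +
     (n + e).+1%:R * 3 ^+ n * (n.+2%:R * 2 ^+ n).
have C0 : 0 <= C by rewrite (le_trans _ C1).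
have D0 : 0 <= D by rewrite addr_ge0// !mulr_ge0// exprn_ge0.
exists (C + D) => [|al l x y M sep PM r]; first by rewrite ler_wpDr.
have M0 : 0 <= M by apply: (le_trans (normr_ge0 _) (PM 1%N _)).
rewrite addnS mulrDl => /andP[r1]; rewrite leq_eqVlt ltnS => /predU1P[->|rn].
  apply: ler_wpDl; first exact: mulr_ge0.
  apply: (le_trans (power_diff_step sep PM C1 _)).
    by move=> r' r'1; exact: (IH _ _ _ _ _ sep).
  by rewrite le_eqVlt /D; apply/orP; left; apply/eqP; ring.
apply: ler_wpDr; first exact: mulr_ge0.
by apply: (IH _ _ _ _ _ sep) => //; rewrite r1.
Qed.

End power_sums.

(** * Discrete van der Corput estimates *)

Section mean_value.
Context {R : realType}.
Implicit Types (f df : R -> R) (a b : R).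

Lemma mean_value f df a b : a <= b ->
  (forall t, a <= t <= b -> is_derive t 1 f (df t)) ->
  exists2 c, a <= c <= b & f b - f a = df c * (b - a).
Proof.
move=> ab fd.
have [c|c|] := @MVT_segment R f df a b ab.
- by rewrite in_itv/= => /andP[ac cb]; apply: fd; rewrite !ltW.
- apply: derivable_within_continuous => t; rewrite in_itv/= => tab.
  by have := fd t tab; case.
by move=> c; rewrite in_itv/= => ? ?; exists c.
Qed.

Lemma mean_value_le f df a b D : a <= b ->
  (forall t, a <= t <= b -> is_derive t 1 f (df t)) ->
  (forall t, a <= t <= b -> `|df t| <= D) -> `|f b - f a| <= D * (b - a).
Proof.
move=> ab fd dD; have [c cab ->] := mean_value ab fd.
by rewrite normrM (ger0_norm (_ : 0 <= b - a)) ?subr_ge0// ler_wpM2r ?subr_ge0// dD.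
Qed.

Lemma taylor1_le f df ddf a b D : a <= b ->
  (forall t, a <= t <= b -> is_derive t 1 f (df t)) ->
  (forall t, a <= t <= b -> is_derive t 1 df (ddf t)) ->
  (forall t, a <= t <= b -> `|ddf t| <= D) ->
  `|f b - f a - df a * (b - a)| <= D * (b - a) ^+ 2.
Proof.
move=> ab fd dfd dD; have [c /andP[ac cb] ->] := mean_value ab fd.
rewrite -mulrBl normrM (ger0_norm (_ : 0 <= b - a)) ?subr_ge0// exprS mulrA expr1.
rewrite ler_wpM2r ?subr_ge0//.
have D0 : 0 <= D by apply: (le_trans (normr_ge0 _) (dD a _)); rewrite lexx ab.
have : `|df c - df a| <= D * (c - a).
  by apply: mean_value_le => // t /andP[at_ tc]; [apply: dfd|apply: dD];
    rewrite at_ (le_trans tc).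
by move=> /le_trans; apply; rewrite ler_wpM2l// lerD2r.
Qed.

End mean_value.

Section van_der_corput.
Context {R : realType}.
Implicit Types (F : nat -> R -> R) (c : nat -> R) (h D X r V : R).

Lemma summation_by_parts (b s : nat -> R) p q : (p < q)%N ->
  \sum_(p <= m < q) b m * (s m.+1 - s m) =
  b q.-1 * s q - b p * s p - \sum_(p <= m < q.-1) (b m.+1 - b m) * s m.+1.
Proof.
elim: q => // q IH; rewrite ltnS leq_eqVlt => /predU1P[->|pq].
  by rewrite big_nat1 big_geq// subr0 mulrBr.
rewrite big_nat_recr ?IH//=; last exact: ltnW.
rewrite -[in X in _ = _ - X](prednK (leq_ltn_trans (leq0n p) pq)).
rewrite [in RHS]big_nat_recr/=; last by rewrite -ltnS prednK ?(leq_ltn_trans _ pq).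
rewrite (prednK (leq_ltn_trans (leq0n p) pq)); ring.
Qed.

(** [F l] is the [l]-th derivative of the phase. The condition [h * D <= 1] makes the grid so fine
    that over one step [sin (F 0)] follows its linear approximation up to an error [h]; the sum then
    behaves like an integral. *)
Definition phase F h D :=
  [/\ forall l (t : R), 0 <= t <= 1 -> is_derive t 1 (F l) (F l.+1 t),
      forall t : R, 0 <= t <= 1 -> `|F 1%N t| ^+ 2 + `|F 2%N t| <= D,
      0 < h & h * D <= 1].

Definition amplitude c h X :=
  forall m, `|c m| <= X /\ `|c m.+1 - c m| <= X * h.

Definition osc F c h p q : R := h * \sum_(p <= m < q) c m * cos (F 0%N (m%:R * h)).

Lemma cos_phase_increment F h D m : phase F h D -> m.+1%:R * h <= 1 ->
  `|sin (F 0%N (m.+1%:R * h)) - sin (F 0%N (m%:R * h))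
    - h * F 1%N (m%:R * h) * cos (F 0%N (m%:R * h))| <= h.
Proof.
move=> [Fd FD h0 hD] mh.
have mh0 : 0 <= m%:R * h by rewrite mulr_ge0// ltW.
have mS : m.+1%:R * h - m%:R * h = h by rewrite -mulrBl -natrB// subSnn mul1r.
have tin t : m%:R * h <= t <= m.+1%:R * h -> 0 <= t <= 1.
  by move=> /andP[t1 t2]; rewrite (le_trans mh0 t1) (le_trans t2 mh).
have := @taylor1_le R (fun t => sin (F 0%N t)) (fun t => F 1%N t * cos (F 0%N t))
  (fun t => F 2%N t * cos (F 0%N t) - F 1%N t ^+ 2 * sin (F 0%N t))
  (m%:R * h) (m.+1%:R * h) D.
rewrite mS => H; rewrite (mulrC h) mulrAC; apply: le_trans (H _ _ _ _) _.
- by rewrite ler_pM2r// ler_nat.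
- move=> t /tin /(Fd 0%N) h1; apply: is_derive_eq; by rewrite mulrC.
- move=> t tt; have h1 := Fd 0%N t (tin _ tt); have h2 := Fd 1%N t (tin _ tt).
  apply: is_derive_eq; rewrite /GRing.scale/=; ring.
- move=> t tt; apply: le_trans (FD t (tin _ tt)).
  apply: (le_trans (ler_normB _ _)); rewrite [leRHS]addrC.
  apply: lerD; rewrite normrM -[leRHS]mulr1 ler_pM//.
  + by rewrite ler_norml cos_geN1 cos_le1.
  + by rewrite normrX.
  + by rewrite ler_norml sin_geN1 sin_le1.
rewrite expr2 mulrA -[leRHS]mul1r ler_pM2r// mulrC//.
Qed.

(** Summation by parts, after writing [h * cos (F 0)] as an increment of [sin (F 0)] divided by
    [F 1]. Of the [4 / r], one unit is the discretization error, two are boundary terms and one is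
    the variation of [c]. *)
Lemma osc_first_derivative F c h D X r V p q : phase F h D -> amplitude c h X ->
  q%:R * h <= 1 -> 0 < r ->
  (forall m, (p <= m < q)%N -> r <= `|F 1%N (m%:R * h)|) ->
  \sum_(p <= m < q.-1) `|(F 1%N (m.+1%:R * h))^-1 - (F 1%N (m%:R * h))^-1| <= V ->
  `|osc F c h p q| <= X * (4 / r + V).
Proof.
move=> Fph cX qh r0 Fr FV.
have [Fd FD h0 hD] := Fph.
have X0 : 0 <= X by apply: le_trans (normr_ge0 _) (cX 0%N).1.
have V0 : 0 <= V by apply: le_trans FV; exact: sumr_ge0.
have [qp|pq] := leqP q p.
  rewrite /osc big_geq// mulr0 normr0 mulr_ge0// addr_ge0// divr_ge0// ltW//.
pose b m := c m / F 1%N (m%:R * h).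
pose s m := sin (F 0%N (m%:R * h)).
have bX m : (p <= m < q)%N -> `|b m| <= X / r.
  move=> /Fr Frm; rewrite normrM normfV ler_pM ?invr_ge0//; first exact: (cX m).1.
  by rewrite lef_pV2 ?posrE// (lt_le_trans r0).
have s1 m : `|s m| <= 1 by rewrite ler_norml sin_geN1 sin_le1.
have db m : (p <= m < q.-1)%N -> `|b m.+1 - b m| <=
    X * h / r + X * `|(F 1%N (m.+1%:R * h))^-1 - (F 1%N (m%:R * h))^-1|.
  move=> /andP[pm mq].
  have Sm : (p <= m.+1 < q)%N by rewrite (leq_trans pm)//= -(prednK (leq_ltn_trans (leq0n p) pq)).
  rewrite (_ : _ - _ = (c m.+1 - c m) / F 1%N (m.+1%:R * h) +
     c m * ((F 1%N (m.+1%:R * h))^-1 - (F 1%N (m%:R * h))^-1)); last by rewrite /b; ring.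
  apply: (le_trans (ler_normD _ _)); rewrite !normrM normfV; apply: lerD.
    rewrite ler_pM ?invr_ge0//; first exact: (cX m).2.
    by rewrite lef_pV2 ?posrE ?Fr// (lt_le_trans r0)// Fr.
  by rewrite ler_wpM2r//; exact: (cX m).1.
have qph : (q - p)%:R * h <= 1.
  by apply: le_trans qh; rewrite ler_pM2r// ler_nat leq_subr.
have e1 : osc F c h p q = \sum_(p <= m < q) b m * (s m.+1 - s m)
   - \sum_(p <= m < q) b m * (s m.+1 - s m - h * F 1%N (m%:R * h) * cos (F 0%N (m%:R * h))).
  rewrite -sumrB /osc mulr_sumr; apply: eq_big_nat => m /Fr Frm.
  have F0 : F 1%N (m%:R * h) != 0 by rewrite -normr_gt0 (lt_le_trans r0).
  by rewrite /b; field.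
rewrite e1 (le_trans (ler_normB _ _))//.
have E2 : `|\sum_(p <= m < q) b m * (s m.+1 - s m - h * F 1%N (m%:R * h) * cos (F 0%N (m%:R * h)))| <= X / r.
  apply: (le_trans (ler_norm_sum _ _ _)).
  apply: (@le_trans _ _ (\sum_(p <= m < q) X / r * h)).
    apply: ler_sum_nat => m mpq; rewrite normrM ler_pM ?bX//.
    apply: (cos_phase_increment Fph); apply: le_trans qh.
    by rewrite ler_pM2r// ler_nat; case/andP: mpq.
  rewrite sumr_const_nat -mulr_natr -mulrA -[leRHS]mulr1 ler_wpM2l//.
    by rewrite divr_ge0// ltW.
  by rewrite mulrC.
rewrite summation_by_parts//.
have E1 : `|b q.-1 * s q - b p * s p| <= X / r + X / r.
  have bs m m' : (p <= m < q)%N -> `|b m * s m'| <= X / r.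
    by move=> /bX bm; rewrite (normrM (b m)) -[leRHS]mulr1 ler_pM.
  rewrite (le_trans (ler_normB _ _))// lerD// bs// ?leqnn//.
  by case: q pq {qh Fr FV db bX qph e1 E2 bs} => //= q; rewrite !ltnS leqnn andbT.
have E3 : `|\sum_(p <= m < q.-1) (b m.+1 - b m) * s m.+1| <= X / r + X * V.
  apply: (le_trans (ler_norm_sum _ _ _)).
  apply: (@le_trans _ _ (\sum_(p <= m < q.-1) (X * h / r + X * `|(F 1%N (m.+1%:R * h))^-1 - (F 1%N (m%:R * h))^-1|))).
    apply: ler_sum_nat => m mpq; rewrite (normrM (_ - _)) -[leRHS]mulr1 ler_pM ?db//.
  rewrite big_split/= lerD//; last by rewrite -mulr_sumr ler_wpM2l.
  rewrite sumr_const_nat -[leLHS]mulr_natr -!mulrA ler_wpM2l// mulrCA -[leRHS]mulr1.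
  rewrite ler_pM2l ?invr_gt0//; apply: le_trans qph; rewrite mulrC ler_pM2r// ler_nat.
  by rewrite leq_sub2r// leq_pred.
apply: (@le_trans _ _ (X / r + X / r + (X / r + X * V) + X / r)).
  by rewrite lerD// (le_trans (ler_normB _ _))// lerD.
by rewrite le_eqVlt; apply/orP; left; apply/eqP; ring.
Qed.

Lemma oscN F c h p q :
  osc (fun l t => - F l t) c h p q = osc F c h p q.
Proof. by rewrite /osc; under eq_bigr do rewrite cosN. Qed.

Lemma phaseN F h D : phase F h D -> phase (fun l t => - F l t) h D.
Proof.
move=> [Fd FD h0 hD]; split=> // [l t t01|t t01].
  by have h1 := Fd l t t01; exact: is_deriveN.
by rewrite !normrN FD.
Qed.

Lemma osc_cat F c h p (r : nat) q : (p <= r <= q)%N ->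
  osc F c h p q = osc F c h p r + osc F c h r q.
Proof. by move=> /andP[pr rq]; rewrite /osc -mulrDr -big_cat_nat. Qed.

Lemma osc_trivial F c h X p q : 0 <= h -> amplitude c h X ->
  `|osc F c h p q| <= (q - p)%:R * h * X.
Proof.
move=> h0 cX; rewrite normrM ger0_norm// -mulrA mulrCA ler_wpM2l//.
apply: (le_trans (ler_norm_sum _ _ _)).
apply: (@le_trans _ _ (\sum_(p <= m < q) X)); last by rewrite sumr_const_nat mulr_natl.
apply: ler_sum => m _; rewrite normrM -[leRHS]mulr1 ler_pM//; first exact: (cX m).1.
by rewrite ler_norml cos_geN1 cos_le1.
Qed.

(* Where [|G|] is small, the growth of [G] leaves only a short range of indices. *)
Lemma monotone_split (G : nat -> R) (e s : R) p q : (p <= q)%N -> 0 < e -> 0 < s ->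
  (forall m m', (p <= m <= m')%N -> (m' < q)%N -> s * (m' - m)%:R <= G m' - G m) ->
  exists p1 p2, [/\ (p <= p1 <= p2)%N, (p2 <= q)%N,
    forall m, (p <= m < p1)%N -> G m <= - e,
    forall m, (p2 <= m < q)%N -> e <= G m &
    (p2 - p1)%:R <= 2 * e / s + 1].
Proof.
move=> pq e0 s0 Gs.
have Gle m m' : (p <= m <= m')%N -> (m' < q)%N -> G m <= G m'.
  move=> pm mq; rewrite -subr_ge0; apply: le_trans (Gs _ _ pm mq).
  by rewrite mulr_ge0// ltW.
have ex1 : exists m, (p <= m)%N && ((q <= m)%N || (- e < G m)).
  by exists q; rewrite pq leqnn.
case: (ex_minnP ex1) => p1 /andP[pp1 h1] min1.
have p1q : (p1 <= q)%N by apply: min1; rewrite pq leqnn.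
have ex2 : exists m, (p1 <= m)%N && ((q <= m)%N || (e <= G m)).
  by exists q; rewrite p1q leqnn.
case: (ex_minnP ex2) => p2 /andP[p12 h2] min2.
have p2q : (p2 <= q)%N by apply: min2; rewrite p1q leqnn.
exists p1, p2; split => //; first by rewrite pp1.
- move=> m /andP[pm mp1]; rewrite leNgt; apply/negP => Gm.
  by have := min1 m; rewrite pm Gm orbT leqNgt mp1 => /(_ isT).
- move=> m /andP[pm mq].
  have Gp2 : e <= G p2.
    by move: h2 => /orP[qp2|//]; move: (leq_trans qp2 pm); rewrite leqNgt mq.
  by apply: (le_trans Gp2); apply: Gle => //; rewrite pm (leq_trans pp1).
have [->|p1p2] := eqVneq p1 p2.
  by rewrite subnn addr_ge0// divr_ge0 ?mulr_ge0 ?ltW.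
have {}p1p2 : (p1 < p2)%N by rewrite ltn_neqAle p1p2.
have [p2' e2] : exists p2', p2 = p2'.+1 by exists p2.-1; rewrite prednK// (leq_ltn_trans _ p1p2).
rewrite e2 in p1p2 p2q min2 *; rewrite subSn// -natr1 lerD2r ler_pdivlMr// mulrC.
apply: (le_trans (Gs _ _ _ p2q)); first by rewrite pp1.
have Gp1 : - e < G p1.
  by move: h1 => /orP[qp1|//]; move: (leq_trans p1p2 p2q); rewrite ltnNge qp1.
have Gp2' : G p2' < e.
  rewrite ltNge; apply/negP => Gp2.
  by have := min2 p2'; rewrite (p1p2 : (p1 <= p2')%N) Gp2 orbT ltnn => /(_ isT).
lra.
Qed.

(** When [F 1] is monotone and keeps its sign, the variation of its reciprocal telescopes and is at
    most [1 / r]. *)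
Lemma osc_second_derivative F c h D X r p q : phase F h D -> amplitude c h X ->
  q%:R * h <= 1 -> 0 < r ->
  (forall m, (p <= m < q)%N -> r <= `|F 1%N (m%:R * h)|) ->
  (forall m m', (p <= m <= m')%N -> (m' < q)%N ->
     F 1%N (m%:R * h) <= F 1%N (m'%:R * h)) ->
  ((forall m, (p <= m < q)%N -> 0 <= F 1%N (m%:R * h)) \/
   (forall m, (p <= m < q)%N -> F 1%N (m%:R * h) <= 0)) ->
  `|osc F c h p q| <= 5 * X / r.
Proof.
move=> Fph cX qh r0 Fr Fmono Fsgn.
have X0 : 0 <= X by apply: le_trans (normr_ge0 _) (cX 0%N).1.
rewrite (_ : 5 * X / r = X * (4 / r + 1 / r)); last by ring.
apply: (osc_first_derivative Fph) => //.
have [qp|pq] := leqP q p.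
  by rewrite big_geq ?divr_ge0 ?ltW// (leq_trans _ qp)// leq_pred.
have Q m : (p <= m < q.-1)%N -> (p <= m < q)%N /\ (p <= m.+1 < q)%N.
  move=> /andP[pm mq]; rewrite pm (leq_trans pm)//=.
  have mq1 : (m.+1 < q)%N by rewrite -(prednK (leq_ltn_trans (leq0n p) pq)) ltnS.
  by rewrite mq1 (ltn_trans _ mq1).
pose i m := (F 1%N (m%:R * h))^-1.
have iV m : (p <= m < q)%N -> `|i m| <= 1 / r.
  move=> /Fr Fm; rewrite normfV mul1r lef_pV2// posrE (lt_le_trans r0)//.
have step m : (p <= m < q.-1)%N -> `|i m.+1 - i m| = i m - i m.+1.
  move=> /Q[pm pm1]; rewrite ler0_norm ?opprB// subr_le0 /i.
  have F12 : F 1%N (m%:R * h) <= F 1%N (m.+1%:R * h).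
    by apply: Fmono; case/andP: pm1 => // _ _; case/andP: pm => ->; rewrite leqnSn.
  have := Fr _ pm; have := Fr _ pm1.
  case: Fsgn => sg; have := sg _ pm; have := sg _ pm1 => s1 s2.
    rewrite !ger0_norm// => r1 r2; rewrite lef_pV2// posrE (lt_le_trans r0)//.
  rewrite !ler0_norm// => r1 r2; rewrite lef_nV2// negrE; lra.
have p1 : (p <= q.-1)%N by rewrite -ltnS (prednK (leq_ltn_trans (leq0n p) pq)).
rewrite (@telescope_sumr_eq _ p q.-1 (fun m => - i m))//; last first.
  by move=> m /step ->; rewrite opprK addrC.
have pin : (p <= p < q)%N by rewrite leqnn.
have qin : (p <= q.-1 < q)%N by rewrite p1 ltn_predL (leq_ltn_trans _ pq).
have := iV _ pin; have := iV _ qin; rewrite !ler_norml /i.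
case: Fsgn => sg; have := sg _ pin; have := sg _ qin.
  by rewrite -invr_ge0 => h1; rewrite -invr_ge0 => h2; lra.
by rewrite -invr_le0 => h1; rewrite -invr_le0 => h2; lra.
Qed.

Lemma phase_growth F h D s j (a b : R) : phase F h D -> 0 <= a -> b <= 1 ->
  (forall t, a <= t <= b -> s <= F j.+1 t) ->
  forall t t', a <= t <= t' -> t' <= b -> s * (t' - t) <= F j t' - F j t.
Proof.
move=> [Fd _ _ _] a0 b1 Fs t t' /andP[at_ tt'] t'b.
have [|c /andP[tc ct'] ->] := @mean_value R (F j) (F j.+1) t t' tt'.
  move=> u /andP[tu ut]; apply: Fd.
  by rewrite (le_trans a0)/= ?(le_trans at_)// (le_trans ut)// (le_trans t'b).
by rewrite ler_wpM2r ?subr_ge0// Fs// (le_trans at_ tc) (le_trans ct' t'b).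
Qed.

(** The indices with [|F j| < r^j] occupy a length of at most [2 / r + h <= 3 / r], since [F j]
    grows at rate [r^(j+1)]; there the trivial bound is used. On the two outer ranges [F j] is large
    with a definite sign. *)
Lemma osc_split F c h D X r (B : R) j p q : 0 <= B -> phase F h D -> amplitude c h X ->
  q%:R * h <= 1 -> 0 < r -> r * h <= 1 ->
  (forall t, p%:R * h <= t <= q.-1%:R * h -> r ^+ j.+1 <= F j.+1 t) ->
  (forall p' q', (p <= p')%N -> (q' <= q)%N ->
     (forall m, (p' <= m < q')%N -> r ^+ j <= F j (m%:R * h)) \/
     (forall m, (p' <= m < q')%N -> F j (m%:R * h) <= - r ^+ j) ->
     `|osc F c h p' q'| <= B * X / r) ->
  `|osc F c h p q| <= (2 * B + 3) * X / r.
Proof.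
move=> B0 Fph cX qh r0 rh Fs HB; have [_ _ h0 _] := Fph.
have X0 : 0 <= X by apply: le_trans (normr_ge0 _) (cX 0%N).1.
have [qp|pq] := leqP q p.
  by rewrite /osc big_geq// mulr0 normr0 divr_ge0 ?mulr_ge0 ?addr_ge0 ?mulr_ge0// ltW.
have q1h : q.-1%:R * h <= 1 by apply: le_trans qh; rewrite ler_pM2r// ler_nat leq_pred.
have ph : 0 <= p%:R * h by rewrite mulr_ge0// ltW.
have growth := phase_growth Fph ph q1h Fs.
have [p1 [p2 [/andP[pp1 p12] p2q lo hi gap]]] :=
  @monotone_split (fun m => F j (m%:R * h)) (r ^+ j) (r ^+ j.+1 * h) p q (ltnW pq)
    (exprn_gt0 _ r0) (mulr_gt0 (exprn_gt0 _ r0) h0)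
    (fun m m' pm mq => ltac:(
      rewrite -mulrA (mulrC h) natrB ?(andP pm).2// mulrBl;
      apply: growth; rewrite ?ler_pM2r ?ler_nat// -ltnS (prednK (leq_ltn_trans (leq0n p) pq))//)).
rewrite (@osc_cat _ _ _ _ p1); last by rewrite pp1 (leq_trans p12).
rewrite (@osc_cat _ _ _ p1 p2); last by rewrite p12.
rewrite (_ : _ * X / r = B * X / r + (3 / r * X + B * X / r)); last by ring.
apply: (le_trans (ler_normD _ _)); apply: lerD.
  by apply: HB => //; [exact: leq_trans p2q|right].
apply: (le_trans (ler_normD _ _)); apply: lerD; last first.
  by apply: HB => //; [exact: leq_trans p12|left].
apply: (le_trans (osc_trivial _ _ _ (ltW h0) cX)); rewrite ler_wpM2r//.
apply: (@le_trans _ _ ((2 * r ^+ j / (r ^+ j.+1 * h) + 1) * h)); first by rewrite ler_pM2r.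
rewrite mulrDl mul1r (_ : _ * h = 2 / r); last first.
  rewrite exprS; field; by rewrite !gt_eqF// exprn_gt0.
rewrite (_ : 3 / r = 2 / r + 1 / r); last by ring.
by rewrite lerD2l ler_pdivlMr// mulrC.
Qed.

(** The constants follow [c -> 2 c + 3] from [c = 13], and 13 is [2 * 5 + 3] with the 5 of the
    monotone case. *)
Lemma osc_van_der_corput j F c h D X r p q : phase F h D -> amplitude c h X ->
  q%:R * h <= 1 -> 0 < r -> r * h <= 1 ->
  (forall t, p%:R * h <= t <= q.-1%:R * h -> r ^+ j.+2 <= F j.+2 t) ->
  `|osc F c h p q| <= (16 * 2 ^+ j - 3) * X / r.
Proof.
elim: j F p q => [|j IH] F p q Fph cX qh r0 rh HF; have [_ _ h0 _] := Fph.
  rewrite (_ : 16 * _ - 3 = 2 * 5 + 3); last by rewrite expr0; ring.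
  apply: (osc_split _ Fph cX qh r0 rh HF) => // p' q' pp' qq' Fsgn.
  have q'h : q'%:R * h <= 1 by apply: le_trans qh; rewrite ler_pM2r// ler_nat.
  apply: (osc_second_derivative Fph cX q'h r0).
  - move=> m pmq; case: Fsgn => /(_ m pmq); rewrite expr1.
      by move=> h1; rewrite ger0_norm ?(le_trans (ltW r0)).
    by move=> h1; rewrite ler0_norm; [rewrite lerNr|rewrite (le_trans h1)// oppr_le0 ltW].
  - move=> m m' /andP[pm mm'] m'q; rewrite -subr_ge0.
    have p0 : 0 <= p%:R * h by rewrite mulr_ge0// ltW.
    have q1 : q.-1%:R * h <= 1 by apply: le_trans qh; rewrite ler_pM2r// ler_nat leq_pred.
    have qpos : (0 < q)%N by apply: leq_trans qq'; apply: leq_ltn_trans m'q.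
    apply: le_trans (phase_growth Fph p0 q1 HF _ _).
    + by apply: mulr_ge0; [exact/exprn_ge0/ltW|rewrite subr_ge0 ler_pM2r// ler_nat].
    + by rewrite !ler_pM2r// !ler_nat mm' (leq_trans pp').
    + by rewrite ler_pM2r// ler_nat -ltnS prednK// (leq_trans m'q).
  - case: Fsgn => Fsgn; [left|right] => m /Fsgn; rewrite expr1.
      exact/le_trans/ltW.
    by move=> h1; rewrite (le_trans h1)// oppr_le0 ltW.
rewrite (_ : 16 * _ - 3 = 2 * (16 * 2 ^+ j - 3) + 3); last by rewrite exprS; ring.
have C0 : 0 <= 16 * 2 ^+ j - 3 :> R.
  by have : 1 <= 2 ^+ j :> R by [rewrite exprn_ege1// ler1n]; lra.
apply: (osc_split C0 Fph cX qh r0 rh HF) => p' q' pp' qq' Fsgn.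
have q'h : q'%:R * h <= 1 by apply: le_trans qh; rewrite ler_pM2r// ler_nat.
have [qp'|pq'] := leqP q' p'.
  have X0 : 0 <= X by apply: le_trans (normr_ge0 _) (cX 0%N).1.
  by rewrite /osc big_geq// mulr0 normr0 !mulr_ge0// ?invr_ge0 ?ltW.
have qpos : (0 < q)%N by apply: leq_trans qq'; apply: leq_ltn_trans pq'.
have q'pos : (0 < q')%N by apply: leq_ltn_trans pq'.
have p0 : 0 <= p%:R * h by rewrite mulr_ge0// ltW.
have q1 : q.-1%:R * h <= 1 by apply: le_trans qh; rewrite ler_pM2r// ler_nat leq_pred.
(* The sign information concerns grid points, the induction hypothesis real times; monotonicity of
   [F j.+2] carries the bound from one end of the range to the times in between. *)
have mono t t' : p%:R * h <= t <= t' -> t' <= q.-1%:R * h -> F j.+2 t <= F j.+2 t'.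
  move=> tt' t'q; rewrite -subr_ge0; apply: le_trans (phase_growth Fph p0 q1 HF tt' t'q).
  by apply: mulr_ge0; [exact/exprn_ge0/ltW|rewrite subr_ge0; case/andP: tt'].
have pp'h : p%:R * h <= p'%:R * h by rewrite ler_pM2r// ler_nat.
have qq'h : q'.-1%:R * h <= q.-1%:R * h.
  by rewrite ler_pM2r// ler_nat -ltnS !prednK.
case: Fsgn => Fsgn.
  apply: IH => // t /andP[pt tq]; apply: (le_trans (Fsgn p' _)); first by rewrite leqnn.
  by apply: mono; rewrite ?pp'h// (le_trans tq).
rewrite -oscN; apply: (IH _ _ _ (phaseN Fph)) => // t /andP[pt tq]; rewrite lerNr.
apply: (le_trans _ (Fsgn q'.-1 _)); last by rewrite ltn_predL q'pos andbT -ltnS prednK.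
by apply: mono => //; rewrite tq (le_trans pp'h).
Qed.

End van_der_corput.

(** * Broad-narrow iteration *)

Section broad_narrow.
Context {R : realType}.
Implicit Types (e : nat -> R) (S : R).

(** If no term reaches [S / (4 k)], the terms below [S / (2 b)] add up to at most [S / 2], and
    [2 k - 2] remaining ones could not supply the rest. So at least [2 k - 1] terms are large, and
    every second of them gives [k] indices at distance at least 2. *)
Lemma broad_or_narrow (b k : nat) e S : (0 < b)%N -> (0 < k)%N ->
  (forall c, 0 <= e c) -> S <= \sum_(c < b) e c ->
  (exists2 c, (c < b)%N & S <= (4 * k)%:R * e c) \/
  (exists f : nat -> nat, [/\ forall i, (i < k)%N -> (f i < b)%N,
     forall i, (i.+1 < k)%N -> (f i + 2 <= f i.+1)%N &
     forall i, (i < k)%N -> S <= (2 * b)%:R * e (f i)]).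
Proof.
move=> b0 k0 e0 Se.
have [[c cb Sc]|/forall2NP nex] := pselect (exists2 c, (c < b)%N & S <= (4 * k)%:R * e c).
  by left; exists c.
right.
have {}nex c : (c < b)%N -> (4 * k)%:R * e c < S.
  by move=> cb; have [//|/negP] := nex c; rewrite -ltNge.
have S0 : 0 < S by apply: le_lt_trans (nex _ b0); rewrite mulr_ge0.
pose P c := S <= (2 * b)%:R * e c.
pose g := [seq c <- iota 0 b | P c].
have gs : sorted ltn g by apply: sorted_filter; [exact: ltn_trans|exact: iota_ltn_sorted].
have [gk|kg] := leqP (2 * k - 1) (size g).
  have nthg i : (i < size g)%N -> (nth 0%N g i < b)%N /\ P (nth 0%N g i).
    by move=> ig; have := mem_nth 0%N ig; rewrite mem_filter mem_iota add0n => /andP[-> /andP[]].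
  have lt2 i : (i < k)%N -> (2 * i < size g)%N by move=> ik; lia.
  have gmono i j : (i < j)%N -> (j < size g)%N -> (nth 0%N g i < nth 0%N g j)%N.
    by move=> ij jg; apply: (sorted_ltn_nth ltn_trans 0%N gs) => //; rewrite inE (ltn_trans ij).
  exists (fun i => nth 0%N g (2 * i)); split => i ik.
  - exact: (nthg _ (lt2 _ ik)).1.
  - have h1 : (2 * i.+1 < size g)%N by apply: lt2.
    have := gmono (2 * i)%N (2 * i).+1 (ltnSn _); have := gmono (2 * i).+1 (2 * i.+1)%N.
    by lia.
  - exact: (nthg _ (lt2 _ ik)).2.
exfalso; move: Se; apply/negP; rewrite -ltNge.
pose k4 : R := (4 * k)%:R; pose b2 : R := (2 * b)%:R.
have k40 : 0 < k4 by rewrite ltr0n muln_gt0.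
have b20 : 0 < b2 by rewrite ltr0n muln_gt0.
rewrite -(big_mkord xpredT e) (bigID P)/=.
have h1 : \sum_(0 <= c < b | P c) e c <= (2 * k - 2)%:R * (S / k4).
  apply: (@le_trans _ _ (\sum_(0 <= c < b | P c) S / k4)).
    rewrite big_nat_cond [leRHS]big_nat_cond; apply: ler_sum => c /andP[/andP[_ cb] _].
    by rewrite ler_pdivlMr// mulrC ltW// nex.
  rewrite big_const_seq iter_addr addr0 -[leLHS]mulr_natl ler_pM2r ?divr_gt0//.
  by rewrite ler_nat -size_filter/= /index_iota subn0 -/g; lia.
have h2 : \sum_(0 <= c < b | ~~ P c) e c <= b%:R * (S / b2).
  apply: (@le_trans _ _ (\sum_(0 <= c < b | ~~ P c) S / b2)).
    apply: ler_sum => c; rewrite -ltNge => Sc.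
    by rewrite ler_pdivlMr// mulrC ltW.
  rewrite big_const_seq iter_addr addr0 -[leLHS]mulr_natl ler_pM2r ?divr_gt0//.
  by rewrite ler_nat (leq_trans (count_size _ _))// size_iota subn0.
apply: (le_lt_trans (lerD h1 h2)).
have k1 : (2 * k - 2)%:R = 2 * k%:R - 2 :> R by rewrite natrB ?natrM//; lia.
have kn : 1 <= k%:R :> R by rewrite ler1n.
have bn : 1 <= b%:R :> R by rewrite ler1n.
rewrite k1 /k4 /b2 !natrM -subr_gt0.
rewrite (_ : _ - _ = S / (2 * k%:R)); first by rewrite divr_gt0// mulr_gt0// (lt_le_trans ltr01).
by field; rewrite !gt_eqF// (lt_le_trans ltr01).
Qed.

(** A difference of 2 between indices leaves a whole interval between the pieces, as [separated]
    demands. *)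
Definition spread (k b : nat) (f : {ffun 'I_k -> 'I_b}) :=
  [forall i : 'I_k, [forall j : 'I_k, (i < j)%N ==> (f i + 2 <= f j)%N]].

Lemma broad_narrow_step (b k q : nat) e S (B : R) : (0 < b)%N -> (0 < k)%N ->
  (2 * k <= q)%N -> (forall c, 0 <= e c) -> (forall c, (c < b)%N -> e c <= B) ->
  0 <= S -> S <= \sum_(c < b) e c ->
  S ^+ q <= (4 * k)%:R ^+ q * \sum_(c < b) e c ^+ q +
    (2 * b)%:R ^+ q * B ^+ (q - 2 * k) *
      \sum_(f : {ffun 'I_k -> 'I_b} | spread f) \prod_(i < k) e (f i) ^+ 2.
Proof.
move=> b0 k0 kq e0 eB S0 Se.
have B0 : 0 <= B by apply: (le_trans (e0 0%N)); exact: eB.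
have s1 : 0 <= \sum_(f : {ffun 'I_k -> 'I_b} | spread f) \prod_(i < k) e (f i) ^+ 2.
  by apply: sumr_ge0 => f _; apply: prodr_ge0 => i _; rewrite exprn_ge0.
have [[c cb Sc]|[f [fb fsep fS]]] := broad_or_narrow b0 k0 e0 Se.
  apply: ler_wpDr; first by rewrite !mulr_ge0// exprn_ge0.
  rewrite (bigD1 (Ordinal cb))//= mulrDr; apply: ler_wpDr.
    by rewrite mulr_ge0 ?exprn_ge0// sumr_ge0// => i _; rewrite exprn_ge0.
  by rewrite -exprMn lerXn2r// nnegrE mulr_ge0.
apply: ler_wpDl; first by rewrite mulr_ge0 ?exprn_ge0// sumr_ge0// => i _; rewrite exprn_ge0.
pose F : {ffun 'I_k -> 'I_b} := [ffun i => Ordinal (fb _ (ltn_ord i))].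
have Fsp : spread F.
  apply/forallP => i; apply/forallP => j; apply/implyP => ij; rewrite !ffunE/=.
  have H m : (i + m.+1 < k)%N -> (f i + 2 <= f (i + m.+1))%N.
    elim: m => [|m IH]; first by rewrite addn1; exact: fsep.
    rewrite addnS => h; apply: leq_trans (fsep _ h).
    by rewrite (leq_trans (IH (ltnW h)))// leq_addr.
  by rewrite -(subnKC ij) addSnnS; apply: H; rewrite addnS -addSn subnKC.
have h : S ^+ (2 * k) <= (2 * b)%:R ^+ (2 * k) * \prod_(i < k) e (F i) ^+ 2.
  have powk (x : R) : x ^+ (2 * k) = \prod_(i < k) x ^+ 2.
    by rewrite exprM prodr_const card_ord.
  rewrite !powk -big_split/=; apply: ler_prod => i _.
  rewrite exprn_ge0//= -exprMn lerXn2r// ?nnegrE ?mulr_ge0//.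
  by rewrite ffunE/= fS.
have splitq (x : R) : x ^+ q = x ^+ (q - 2 * k) * x ^+ (2 * k).
  by rewrite -exprD subnK.
rewrite splitq (splitq (2 * b)%:R).
have h2 : S ^+ (q - 2 * k) <= (2 * b)%:R ^+ (q - 2 * k) * B ^+ (q - 2 * k).
  rewrite -exprMn lerXn2r// ?nnegrE ?mulr_ge0// (le_trans (fS 0%N k0))// ler_wpM2l//.
  by rewrite eB// fb.
apply: (le_trans (ler_pM _ _ h2 h)); rewrite ?exprn_ge0//.
rewrite [leLHS](_ : _ = (2 * b)%:R ^+ (q - 2 * k) * (2 * b)%:R ^+ (2 * k) *
  B ^+ (q - 2 * k) * \prod_(i < k) e (F i) ^+ 2); last by ring.
rewrite ler_wpM2l ?mulr_ge0 ?exprn_ge0// (bigD1 F)//=.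
rewrite lerDl; apply: sumr_ge0 => g _; apply: prodr_ge0 => i _; exact: exprn_ge0.
Qed.

(** The narrow term is a sum of [q]-th powers over the children, so the step can be applied again to
    each of them. A factor [(4 k)^q] is lost per generation, which is harmless because the number
    [N] of generations is fixed. *)
Lemma multiscale (b k q N : nat) (e : nat -> nat -> R) (B : nat -> R) :
  (0 < b)%N -> (0 < k)%N -> (2 * k <= q)%N -> (forall m v, 0 <= e m v) ->
  (forall m v, (m < N)%N -> (v < b ^ m)%N -> e m v <= \sum_(c < b) e m.+1 (v * b + c)%N) ->
  (forall m v, (m <= N)%N -> (v < b ^ m)%N -> e m v <= B m) ->
  e 0%N 0%N ^+ q <=
    \sum_(m < N) ((4 * k)%:R ^+ q) ^+ m * ((2 * b)%:R ^+ q * B m.+1 ^+ (q - 2 * k)) *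
      \sum_(v < b ^ m) \sum_(f : {ffun 'I_k -> 'I_b} | spread f)
         \prod_(i < k) e m.+1 (v * b + f i)%N ^+ 2
    + ((4 * k)%:R ^+ q) ^+ N * \sum_(v < b ^ N) e N v ^+ q.
Proof.
move=> b0 k0 kq e0 esub eB.
pose A m := ((4 * k)%:R ^+ q) ^+ m * \sum_(v < b ^ m) e m v ^+ q.
pose Z m := ((4 * k)%:R ^+ q) ^+ m * ((2 * b)%:R ^+ q * B m.+1 ^+ (q - 2 * k)) *
      \sum_(v < b ^ m) \sum_(f : {ffun 'I_k -> 'I_b} | spread f)
         \prod_(i < k) e m.+1 (v * b + f i)%N ^+ 2.
have vb m v c : (v < b ^ m)%N -> (c < b)%N -> (v * b + c < b ^ m.+1)%N.
  move=> vm cb; rewrite expnSr; apply: (@leq_trans (v.+1 * b)).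
    by rewrite mulSn addnC ltn_add2r.
  by rewrite leq_mul2r vm orbT.
have step m : (m < N)%N -> A m <= Z m + A m.+1.
  move=> mN; rewrite /A /Z exprSr -!mulrA -mulrDr ler_wpM2l ?exprn_ge0//.
  have -> : \sum_(v < b ^ m.+1) e m.+1 v ^+ q =
      \sum_(v < b ^ m) \sum_(c < b) e m.+1 (v * b + c)%N ^+ q.
    rewrite -(big_mkord xpredT (fun v => e m.+1 v ^+ q)).
    rewrite -(big_mkord xpredT (fun v => \sum_(c < b) e m.+1 (v * b + c)%N ^+ q)).
    rewrite expnSr; elim: (b ^ m)%N => [|M IH]; first by rewrite !big_geq.
    rewrite [RHS]big_nat_recr//= -IH mulSn addnC (@big_cat_nat _ _ _ (M * b))//=; last first.
      by rewrite leq_addr.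
    congr (_ + _); rewrite -{1}[(M * b)%N]add0n big_addn addKn big_mkord.
    by apply: eq_bigr => c _; rewrite addnC.
  rewrite mulrA !mulr_sumr -big_split/=; apply: ler_sum => v _.
  apply: (le_trans (@broad_narrow_step b k q (fun c => e m.+1 (v * b + c)%N) _
     (B m.+1) b0 k0 kq _ _ (e0 _ _) (esub _ _ mN (ltn_ord v)))) => //.
    by move=> c cb; apply: eB => //; exact: vb.
  by rewrite addrC.
have : forall m, (m <= N)%N -> A 0%N <= \sum_(i < m) Z i + A m.
  elim=> [_|m IH mN]; first by rewrite big_ord0 add0r.
  apply: (le_trans (IH (ltnW mN))); rewrite big_ord_recr/= -addrA lerD2l.
  exact: step.
move=> /(_ N (leqnn _)); rewrite /A /Z expr0 mul1r expn0 big_ord1.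
by apply.
Qed.

End broad_narrow.

(** * Oscillatory integrals on the sphere *)

Section local_derivatives.
Context {R : realType}.
Implicit Types (f g : R -> R) (z : R).

Lemma is_derive_continuous f z df : is_derive z 1 f df -> {for z, continuous f}.
Proof. by move=> fd; apply/differentiable_continuous/derivable1_diffP; case: fd. Qed.

(** Powers of the positive part serve as cutoffs: their finite smoothness suffices for the finitely
    many integrations by parts that follow. *)
Lemma is_derive_pos_part_exp m z :
  is_derive z 1 (fun x : R => Num.max 0 x ^+ m.+2) (m.+2%:R * Num.max 0 z ^+ m.+1).
Proof.
have [z0|z0|->] := ltgtP z 0.
- rewrite expr0n mulr0.
  apply: (@near_eq_is_derive _ _ _ (cst 0)).
  near=> x; rewrite max_l ?expr0n// ltW//.
  by near: x; exact: lt_nbhsl.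
- have h : is_derive z 1 (fun x : R => x ^+ m.+2) (m.+2%:R * z ^+ m.+1).
    by have := @is_deriveX _ _ (fun x : R => x) m.+2 z 1 1 (is_derive_id _ _);
      rewrite exprfctE /GRing.scale/= mulr1.
  apply: near_eq_is_derive h; near=> x.
  by rewrite max_r// ltW//; near: x; exact: lt_nbhsr.
- rewrite expr0n mulr0; apply/is_derive1_caratheodory.
  exists (fun x => Num.max 0 x ^+ m.+1); split; last by rewrite max_l// expr0n.
  + move=> x; rewrite [Num.max 0 0]max_l// expr0n !subr0 exprSr.
    by have [x0|x0] := leP 0 x; [|rewrite !mulr0 expr0n mul0r].
  + apply: (@continuous_comp R R R (fun x => Num.max 0 x) (fun x => x ^+ m.+1) 0);
      last exact: exprn_continuous.
    by apply: continuous_max; [exact: cvg_cst|exact: cvg_id].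
Unshelve. all: by end_near. Qed.

End local_derivatives.

Section tame_families.
Context {R : realType} (I : Type) (r : I -> R -> R).
Implicit Types (u w : I -> R -> R) (n m : nat).

(* Families bounded on [-2, 2], uniformly in the parameter, together with their
   first [n] iterates under the scale-invariant derivation [r d/dz]. *)
Fixpoint tame n u : Prop :=
  (exists C : R, forall i (z : R), `|z| <= 2 -> `|u i z| <= C) /\
  (if n is n'.+1 then exists2 u' : I -> R -> R,
      (forall i (z : R), is_derive z 1 (u i) (u' i z / r i z)) & tame n' u'
   else True).

Lemma tame_bounded n u : tame n u ->
  exists C : R, forall i (z : R), `|z| <= 2 -> `|u i z| <= C.
Proof. by case: n => [|n] []. Qed.

Lemma tameW n u : tame n.+1 u -> tame n u.
Proof.
elim: n u => [|n IH] u /= [uC [u' du tu']]; first by split.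
by split => //; exists u' => //; exact: IH.
Qed.

Lemma tame_le m n u : (m <= n)%N -> tame n u -> tame m u.
Proof.
elim: n => [|n IH]; first by rewrite leqn0 => /eqP ->.
by rewrite leq_eqVlt => /predU1P[->//|mn] /tameW; exact: IH.
Qed.

Lemma tame_param n (c : I -> R) C : (forall i, `|c i| <= C) -> tame n (fun i _ => c i).
Proof.
elim: n c C => [|n IH] c C cC; split=> //; try by exists C => i z _.
exists (fun _ _ => 0).
  by move=> i z; rewrite mul0r; exact: is_derive_cst.
by apply: (IH (fun=> 0) 0) => i; rewrite normr0.
Qed.

Lemma tameD n u w : tame n u -> tame n w -> tame n (fun i z => u i z + w i z).
Proof.
elim: n u w => [|n IH] u w tu tw; have [Cu uC] := tame_bounded tu;
  have [Cw wC] := tame_bounded tw; split => //;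
  try by exists (Cu + Cw) => i z z2; rewrite (le_trans (ler_normD _ _))// lerD ?uC ?wC.
case: tu tw => _ [u' du tu'] [_ [w' dw tw']].
exists (fun i z => u' i z + w' i z); last exact: IH.
by move=> i z; rewrite mulrDl; have h1 := du i z; have h2 := dw i z; exact: is_deriveD.
Qed.

Lemma tameM n u w : tame n u -> tame n w -> tame n (fun i z => u i z * w i z).
Proof.
elim: n u w => [|n IH] u w tu tw; have [Cu uC] := tame_bounded tu;
  have [Cw wC] := tame_bounded tw; split => //;
  try by exists (Cu * Cw) => i z z2; rewrite normrM ler_pM ?uC ?wC.
have [_ [u' du tu']] := tu; have [_ [w' dw tw']] := tw.
exists (fun i z => u i z * w' i z + w i z * u' i z).
  move=> i z; have h1 := du i z; have h2 := dw i z.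
  by apply: is_derive_eq; rewrite /GRing.scale/=; ring.
by apply: tameD; apply: IH => //; exact: tameW.
Qed.

Lemma tameZ n (c : R) u : tame n u -> tame n (fun i z => c * u i z).
Proof. by move=> tu; apply: tameM => //; exact: (@tame_param _ (fun=> c) `|c|). Qed.

Lemma tameN n u : tame n u -> tame n (fun i z => - u i z).
Proof.
by move=> tu; under eq_fun do under eq_fun do rewrite -mulN1r; exact: tameZ.
Qed.

Lemma tame_sum n (J : Type) (s : seq J) (u : J -> I -> R -> R) :
  (forall j, tame n (u j)) -> tame n (fun i z => \sum_(j <- s) u j i z).
Proof.
move=> tu; elim: s => [|j s IH].
  under eq_fun do under eq_fun do rewrite big_nil.
  by apply: (@tame_param _ (fun=> 0) 0) => i; rewrite normr0.
under eq_fun do under eq_fun do rewrite big_cons.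
exact: tameD.
Qed.

Lemma tame_exp n m u : tame n u -> tame n (fun i z => u i z ^+ m).
Proof.
move=> tu; elim: m => [|m IH].
  under eq_fun do under eq_fun do rewrite expr0.
  by apply: (@tame_param _ (fun=> 1) 1) => i; rewrite normr1.
under eq_fun do under eq_fun do rewrite exprS.
exact: tameM.
Qed.

Lemma tame_pos_part_exp n m u : (n < m)%N -> tame n u ->
  tame n (fun i z => Num.max 0 (u i z) ^+ m).
Proof.
elim: n m u => [|n IH] m u nm tu; have [C uC] := tame_bounded tu.
- split => //; exists (C ^+ m) => i z z2; have := uC i z z2 => uC'.
  rewrite normrX lerXn2r ?nnegrE//; first exact: le_trans uC'.
  by rewrite ger0_norm ?le_max ?lexx// ge_max (le_trans (normr_ge0 _) uC')/= (le_trans (ler_norm _)).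
- split => //.
    exists (C ^+ m) => i z z2; have := uC i z z2 => uC'.
    rewrite normrX lerXn2r ?nnegrE//; first exact: le_trans uC'.
    by rewrite ger0_norm ?le_max ?lexx// ge_max (le_trans (normr_ge0 _) uC')/= (le_trans (ler_norm _)).
case: m nm => [//|[//|m]] nm; have [_ [u' du tu']] := tu.
exists (fun i z => m.+2%:R * Num.max 0 (u i z) ^+ m.+1 * u' i z).
  move=> i z; rewrite -(mulrA _ (u' i z)); have h1 := du i z.
  exact: (@is_derive1_comp _ (fun x => Num.max 0 x ^+ m.+2) (u i) z _ _
    (is_derive_pos_part_exp m (u i z)) h1).
by apply: tameM => //; apply: tameZ; apply: IH => //; exact: tameW.
Qed.

Lemma tameV n d u : 0 < d -> (forall i z, d <= u i z) -> tame n u ->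
  tame n (fun i z => (u i z)^-1).
Proof.
move=> d0 ud; have u0 i z : 0 < u i z by exact: lt_le_trans (ud i z).
have uV i z : `|(u i z)^-1| <= d^-1.
  by rewrite normfV gtr0_norm// lef_pV2 ?posrE.
elim: n => [|n IH] tu; split => //; try by exists d^-1.
have [_ [u' du tu']] := tu.
exists (fun i z => - ((u i z)^-1 ^+ 2) * u' i z).
  move=> i z; have h1 := du i z.
  apply: is_derive_eq; first by apply: (is_deriveV _ h1); rewrite gt_eqF.
  by rewrite /GRing.scale/= exprVn; ring.
apply: tameM => //; apply: tameN; apply: tame_exp; apply: IH; exact: tameW.
Qed.

End tame_families.

(** * Nonstationary phase along a coordinate line *)

Section sphere_kernel.
Context {R : realType} (d n : nat) (V : R).

Definition update (x : 'rV[R]_d) (j : 'I_d) (z : R) : 'rV[R]_d :=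
  \row_i (if i == j then z else x 0 i).

(* A line [z |-> update kx kj z] missing the origin, a frequency [kD] of sup norm 1
   attained at the coordinate [kj], and vectors [kv] cutting out a region of the
   sphere where [kD] is almost tangent. *)
Record kernel_datum := KernelDatum {
  kj : 'I_d;
  kx : 'rV[R]_d;
  kD : 'rV[R]_d;
  kv : 'I_n -> 'rV[R]_d;
  kx_neq0 : exists2 i, i != kj & kx 0 i != 0;
  kx_le : forall i, i != kj -> `|kx 0 i| <= 2;
  kD_le : forall i, `|kD 0 i| <= 1;
  kD_j : `|kD 0 kj| = 1;
  kv_le : forall k i, `|kv k 0 i| <= V;
  kD_small : forall w : 'rV[R]_d, enorm w = 1 ->
    \sum_(k < n) dot w (kv k) ^+ 2 < 5 / 2 -> `|dot w kD| <= 1 / 2 }.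

Implicit Types (p : kernel_datum) (z : R).

Let pt p z := update (kx p) (kj p) z.
Let rad p z := enorm (pt p z).
Let om (k : 'I_d) p z := pt p z 0 k / rad p z.
Let rest p := \sum_(i < d | i != kj p) kx p 0 i ^+ 2.

Let rest_gt0 p : 0 < rest p.
Proof.
have [i ij xi] := kx_neq0 p; rewrite /rest (bigD1 i)//=.
rewrite ltr_pwDl// ?exprn_even_gt0 ?xi//.
by apply: sumr_ge0 => k _; rewrite sqr_ge0.
Qed.

Let dot_pt p z : dot (pt p z) (pt p z) = z ^+ 2 + rest p.
Proof.
rewrite /dot (bigD1 (kj p))//= mxE eqxx expr2; congr (_ + _).
by apply: eq_bigr => i ij; rewrite mxE (negbTE ij) expr2.
Qed.

Let radE p z : rad p z = Num.sqrt (z ^+ 2 + rest p).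
Proof. by rewrite /rad /enorm dot_pt. Qed.

Let sq_gt0 p z : 0 < z ^+ 2 + rest p.
Proof. by rewrite ltr_wpDl ?sqr_ge0. Qed.

Let rad_gt0 p z : 0 < rad p z.
Proof. by rewrite radE sqrtr_gt0. Qed.

Let rad_ge0 p z : 0 <= rad p z.
Proof. exact: ltW. Qed.

Let rad_neq0 p z : rad p z != 0.
Proof. by rewrite gt_eqF. Qed.

Let rad_sqr p z : rad p z ^+ 2 = z ^+ 2 + rest p.
Proof. by rewrite radE sqr_sqrtr// ltW. Qed.

Let om_le k p z : `|om k p z| <= 1.
Proof.
rewrite normrM normfV (gtr0_norm (rad_gt0 p z)) ler_pdivrMr// mul1r.
rewrite -ler_sqr ?nnegrE// rad_sqr -dot_pt real_normK ?num_real//.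
rewrite /dot (bigD1 k)//= expr2 lerDl.
by apply: sumr_ge0 => i _; rewrite -expr2 sqr_ge0.
Qed.

Let sum_om2 p z : \sum_k om k p z ^+ 2 = 1.
Proof.
rewrite (eq_bigr (fun k => pt p z 0 k ^+ 2 / rad p z ^+ 2)).
  rewrite -mulr_suml (_ : \sum_(i < d) _ = rad p z ^+ 2) ?divff ?expf_neq0//.
  by rewrite rad_sqr -dot_pt /dot; apply: eq_bigr => i _; rewrite expr2.
by move=> k _; rewrite /om exprMn exprVn.
Qed.

Let omj p z : om (kj p) p z = z / rad p z.
Proof. by rewrite /om mxE eqxx. Qed.

Let is_derive_rad p z : is_derive z 1 (rad p) (om (kj p) p z).
Proof.
rewrite (_ : rad p = Num.sqrt \o (fun x => x ^+ 2 + rest p)); last first.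
  by apply/funext => x; rewrite radE.
have h1 := @is_derive1_sqrt _ _ (sq_gt0 p z).
have h2 : is_derive z 1 (fun x : R => x ^+ 2 + rest p) (2 * z).
  have h3 := @is_deriveX _ _ (fun x : R => x) 2 z 1 1 (is_derive_id _ _).
  rewrite exprfctE /GRing.scale/= expr1 mulr1 in h3.
  by apply: is_derive_eq; rewrite addr0.
have h3 := @is_derive1_comp _ _ (fun x => x ^+ 2 + rest p) z _ _ h1 h2.
apply: (is_derive_eq h3); rewrite omj -radE; field; exact: rad_neq0.
Qed.

Let is_derive_om k p z :
  is_derive z 1 (om k p) (((k == kj p)%:R - om k p z * om (kj p) p z) / rad p z).
Proof.
have h1 : is_derive z 1 (fun x => pt p x 0 k) (k == kj p)%:R.
  rewrite (_ : (fun x => _) = if k == kj p then id else cst (kx p 0 k)).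
    by case: (k == kj p); [exact: is_derive_id|exact: is_derive_cst].
  by apply/funext => x; rewrite mxE; case: eqP.
have h2 := is_derive_rad p z.
have h3 := is_deriveV (rad_neq0 p z) h2.
by apply: is_derive_eq; rewrite /GRing.scale/= /om; field.
Qed.

(** The derivation [rad * d/dz] sends a coordinate of the unit vector to a polynomial in such
    coordinates, so the bounds do not deteriorate as the line approaches the origin. *)
Let tame_om m k : tame rad m (om k).
Proof.
elim: m k => [|m IH] k; split => //; try by exists 1.
exists (fun p z => (k == kj p)%:R - om k p z * om (kj p) p z) => //.
apply: tameD.
  by apply: (@tame_param _ _ _ _ _ 1) => p; case: eqP; rewrite ?normr1 ?normr0.
apply: tameN; apply: tameM => //.
(* The index [kj p] varies with the parameter, while the induction hypothesis concerns a fixed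
   coordinate; a sum with indicators bridges the two. *)
rewrite (_ : (fun p z => _) = fun p z => \sum_(i < d) (i == kj p)%:R * om i p z).
  apply: tame_sum => i; apply: tameM => //.
  by apply: (@tame_param _ _ _ _ _ 1) => p; case: eqP; rewrite ?normr1 ?normr0.
apply/funext => p; apply/funext => z; rewrite (bigD1 (kj p))//= eqxx mul1r.
by rewrite big1 ?addr0// => i /negbTE ->; rewrite mul0r.
Qed.

Let tame_omj m : tame rad m (fun p z => om (kj p) p z).
Proof.
rewrite (_ : (fun p z => _) = fun p z => \sum_(i < d) (i == kj p)%:R * om i p z).
  apply: tame_sum => i; apply: tameM => //.
  by apply: (@tame_param _ _ _ _ _ 1) => p; case: eqP; rewrite ?normr1 ?normr0.
apply/funext => p; apply/funext => z; rewrite (bigD1 (kj p))//= eqxx mul1r.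
by rewrite big1 ?addr0// => i /negbTE ->; rewrite mul0r.
Qed.

Let tame_rad m : tame rad m rad.
Proof.
have rad_le : exists C : R, forall p z, `|z| <= 2 -> `|rad p z| <= C.
  exists (1 + d%:R * 4) => p z z2; rewrite gtr0_norm//.
  have : rad p z ^+ 2 <= d%:R * 4.
    rewrite rad_sqr -dot_pt /dot -[X in X%:R]card_ord mulr_natl -sumr_const.
    apply: ler_sum => i _; rewrite -expr2 (_ : 4 = 2 ^+ 2); last by ring.
    rewrite -[X in X ^+ 2 <= _]/(pt p z 0 i) -(real_normK (num_real _)) ler_sqr ?nnegrE//.
    by rewrite mxE; case: eqVneq => [//|ij]; exact: kx_le.
  have := sqr_ge0 (rad p z - 1); nra.
elim: m => [|m IH]; split => //.
exists (fun p z => om (kj p) p z * rad p z); last by apply: tameM => //; exact: tame_omj.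
by move=> p z; rewrite mulfK//; exact: is_derive_rad.
Qed.

Let tame_dot m (w : kernel_datum -> 'rV[R]_d) (C : R) : (forall p i, `|w p 0 i| <= C) ->
  tame rad m (fun p z => \sum_(i < d) om i p z * w p 0 i).
Proof.
move=> wC; apply: tame_sum => i; apply: tameM => //.
by apply: (@tame_param _ _ _ _ (fun p => w p 0 i) C) => p; exact: wC.
Qed.

Let ph p z := \sum_(i < d) om i p z * kD p 0 i.
(** [Ph] is [rad] times the derivative of the phase [ph] along the line. *)
Let Ph p z := kD p 0 (kj p) - om (kj p) p z * ph p z.
Let U p z : R := 2 - \sum_(k < n) (\sum_(i < d) om i p z * kv p k 0 i) ^+ 2 - rad p z ^+ 2.

Let normalize_om p z : normalize (pt p z) = \row_k om k p z.
Proof. by apply/rowP => k; rewrite [RHS]mxE /om /normalize mxE mulrC. Qed.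

Lemma kernel_phaseE p z : ph p z = dot (normalize (update (kx p) (kj p) z)) (kD p).
Proof. by rewrite /dot normalize_om; apply: eq_bigr => i _; rewrite mxE. Qed.

Lemma kernel_cutoffE p z : U p z =
  2 - \sum_(k < n) dot (normalize (update (kx p) (kj p) z)) (kv p k) ^+ 2
    - enorm (update (kx p) (kj p) z) ^+ 2.
Proof.
congr (_ - _ - _); apply: eq_bigr => k _; rewrite /dot normalize_om.
by congr (_ ^+ _); apply: eq_bigr => i _; rewrite mxE.
Qed.

Let enorm_om p z : enorm (\row_k om k p z) = 1.
Proof.
rewrite /enorm /dot; under eq_bigr do rewrite !mxE -expr2.
by rewrite sum_om2 sqrtr1.
Qed.

Let tame_U m : tame rad m U.
Proof.
apply: tameD; last by apply: tameN; apply: tame_exp; exact: tame_rad.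
apply: tameD; first by apply: (@tame_param _ _ _ _ (fun=> 2) 2) => p; rewrite ger0_norm.
apply: tameN; apply: tame_sum => k; apply: tame_exp.
by apply: (@tame_dot _ (fun p => kv p k) V) => p i; exact: kv_le.
Qed.

Let tame_ph m : tame rad m ph.
Proof. by apply: (@tame_dot _ kD 1) => p i; exact: kD_le. Qed.

Let tame_Ph m : tame rad m Ph.
Proof.
apply: tameD.
  by apply: (@tame_param _ _ _ _ (fun p => kD p 0 (kj p)) 1) => p; rewrite kD_le.
by apply: tameN; apply: tameM; [exact: tame_omj|exact: tame_ph].
Qed.

(** [Ph] is [kD_j - om_j * ph] with [|kD_j| = 1], [|om_j| <= 1] and [|ph| <= 1/2]. The bound holds
    down to [U > -1/2], beyond the support of the cutoff; this margin is what keeps [den] away from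
    zero. *)
Let Ph_ge p z : - (1 / 2) < U p z -> 1 / 2 <= `|Ph p z|.
Proof.
move=> Uz; have phz : `|ph p z| <= 1 / 2.
  rewrite kernel_phaseE normalize_om; apply: kD_small; first exact: enorm_om.
  move: Uz; rewrite kernel_cutoffE normalize_om => Uz.
  have := sqr_ge0 (enorm (update (kx p) (kj p) z)); lra.
have := lerB_dist (kD p 0 (kj p)) (om (kj p) p z * ph p z); rewrite kD_j normrM.
have := ler_pM (normr_ge0 _) (normr_ge0 _) (om_le (kj p) p z) phz.
rewrite /Ph; lra.
Qed.

(* The amplitude is divided by [Ph], which is bounded away from zero only where
   the cutoff lives; [Psi] below is [Ph^-1] there and finitely smooth everywhere. *)
Let den m p z := Ph p z ^+ 2 + Num.max 0 (- U p z) ^+ m.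

Let den_ge m p z : (1 / 2) ^+ m.+2 <= den m p z.
Proof.
have h1 k : 0 <= (1 / 2 : R) ^+ k by rewrite exprn_ge0// divr_ge0.
have h2 k : (1 / 2 : R) ^+ k <= 1 by rewrite exprn_ile1//; lra.
have h0 : 0 <= 1 / 2 :> R by lra.
have e : (1 / 2 : R) ^+ m.+2 = (1 / 2) ^+ m * (1 / 2) ^+ 2 by rewrite -exprD addn2.
rewrite /den e; have [Uz|Uz] := ltP (- (1 / 2)) (U p z).
  apply: ler_wpDr; first by rewrite exprn_ge0// le_max lexx.
  apply: (le_trans (ler_piMl (h1 2%N) (h2 m))).
  by rewrite -(real_normK (num_real (Ph p z))) ler_sqr ?nnegrE// Ph_ge.
apply: ler_wpDl; first exact: sqr_ge0.
apply: (le_trans (ler_piMr (h1 m) (h2 2%N))).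
have h3 : 1 / 2 <= Num.max 0 (- U p z) by rewrite le_max; apply/orP; right; lra.
by rewrite lerXn2r ?nnegrE// (le_trans h0).
Qed.

Let Psi m p z := Ph p z / den m p z.

Let tame_Psi m k : (k < m)%N -> tame rad k (Psi m).
Proof.
move=> km; apply: tameM; first exact: tame_Ph.
apply: (@tameV _ _ _ _ ((1 / 2) ^+ m.+2) (den m)) => //.
apply: tameD; first by apply: tame_exp; exact: tame_Ph.
by apply: tame_pos_part_exp => //; apply: tameN; exact: tame_U.
Qed.

Let Psi_Ph m p z : (0 < m)%N -> 0 <= U p z -> Psi m p z * Ph p z = 1.
Proof.
move=> m0 Uz; rewrite /Psi /den max_l ?oppr_le0// expr0n gtn_eqF// addr0.
have : 1 / 2 <= `|Ph p z| by rewrite Ph_ge//; lra.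
move=> h; have Ph0 : Ph p z != 0 by rewrite -normr_gt0; lra.
by field.
Qed.

Let is_derive_ph p z : is_derive z 1 (ph p) (Ph p z / rad p z).
Proof.
have h (i : 'I_d) : is_derive z 1 (fun z => om i p z * kD p 0 i)
    (((i == kj p)%:R - om i p z * om (kj p) p z) / rad p z * kD p 0 i).
  have h1 := is_derive_om i p z; apply: is_derive_eq.
  by rewrite /GRing.scale/= mulr0 add0r mulrC.
have := @is_derive_sum _ _ _ d (fun i z => om i p z * kD p 0 i) z 1 _ h.
rewrite (_ : \sum_(i < d) _ = ph p); last first.
  by apply/funext => y; rewrite fct_sumE.
move=> /is_derive_eq; apply; rewrite /Ph mulrBl /ph mulr_sumr mulr_suml.
rewrite (eq_bigr (fun i : 'I_d => (i == kj p)%:R * kD p 0 i / rad p z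
    - om (kj p) p z * (om i p z * kD p 0 i) / rad p z)); last by move=> i _; ring.
rewrite sumrB (bigD1 (kj p))//= eqxx mul1r big1 ?addr0// => i /negbTE ->.
by rewrite !mul0r.
Qed.

Implicit Types (lam th : R).

Let sin_shift x : sin x = cos (x - pi / 2) :> R.
Proof. by rewrite cosB cos_pihalf sin_pihalf mulr0 mulr1 add0r. Qed.

Let continuous_tame k u p : tame rad k.+1 u -> continuous (u p).
Proof. by move=> [_ [u' du _]] z; have := du p z; exact: is_derive_continuous. Qed.

Let continuous_cos_ph p lam th : continuous (fun z => cos (lam * ph p z + th)).
Proof.
move=> z; apply: (@continuous_comp R R R (fun z => lam * ph p z + th) cos); last exact: continuous_cos.
apply: cvgD; last exact: cvg_cst.
by apply: cvgM; [exact: cvg_cst|exact: (continuous_tame (tame_ph 1))].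
Qed.

Let osc_int (A : kernel_datum -> R -> R) p lam th :=
  \int[lebesgue_measure]_(z in `[-2, 2]) (A p z * cos (lam * ph p z + th)).

Let integrable_seg (f : R -> R) : continuous f ->
  lebesgue_measure.-integrable `[-2, 2] (EFin \o f).
Proof.
move=> cf; apply: continuous_compact_integrable; first exact: segment_compact.
exact: continuous_subspaceT.
Qed.

Let continuous_osc (A : kernel_datum -> R -> R) p lam th : continuous (A p) ->
  continuous (fun z => A p z * cos (lam * ph p z + th)).
Proof. by move=> cA z; apply: cvgM; [exact: cA|exact: continuous_cos_ph]. Qed.

Let U_end p z : z ^+ 2 = 4 -> U p z < 0.
Proof.
move=> z2; rewrite /U rad_sqr z2.
have h : 0 <= \sum_(k < n) (\sum_(i < d) om i p z * kv p k 0 i) ^+ 2.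
  by apply: sumr_ge0 => k _; exact: sqr_ge0.
have := rest_gt0 p; lra.
Qed.

(** The phase has derivative [Ph / rad], so dividing by it produces a factor [rad], which cancels
    the [1 / rad] of the next differentiation. The new amplitude is therefore tame again. Boundary
    terms vanish because the cutoff is negative at both ends of [[-2, 2]]. *)
Let osc_int_by_parts m (A W : kernel_datum -> R -> R) p lam th : (0 < m)%N ->
  lam != 0 -> tame rad 1 A -> tame rad 1 W -> tame rad 1 (Psi m) ->
  (forall p z, U p z < 0 -> A p z = 0) ->
  (forall p (z : R), is_derive z 1 (fun z => A p z * Psi m p z) (W p z / rad p z)) ->
  osc_int A p lam th =
  - lam^-1 * osc_int (fun p z => om (kj p) p z * (A p z * Psi m p z) + W p z)
     p lam (th - pi / 2).
Proof.
move=> m0 lam0 tA tW tPsi A0 dAP.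
pose B p z := om (kj p) p z * (A p z * Psi m p z) + W p z.
have cA : continuous (A p) := @continuous_tame 0 A p tA.
have cB : continuous (B p).
  have tB : tame rad 1 B by apply: tameD => //; apply: tameM; [exact: tame_omj|exact: tameM].
  exact: (continuous_tame tB).
have Aprod z : A p z * Psi m p z * Ph p z = A p z.
  have [Uz|Uz] := ltP (U p z) 0; first by rewrite A0// !mul0r.
  by rewrite -mulrA Psi_Ph// mulr1.
pose g z := B p z * cos (lam * ph p z + (th - pi / 2)) + lam * (A p z * cos (lam * ph p z + th)).
pose G z := (A p z * Psi m p z) * rad p z * sin (lam * ph p z + th).
have dG z : is_derive z 1 G (g z).
  have h1 := dAP p z; have h2 := is_derive_rad p z; have h3 := is_derive_ph p z.
  have h4 : is_derive z 1 (fun z => lam * ph p z + th) (lam * (Ph p z / rad p z)).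
    by apply: is_derive_eq; rewrite /GRing.scale/= ?mulr0 !addr0.
  have h5 : is_derive z 1 (fun z => sin (lam * ph p z + th))
      (cos (lam * ph p z + th) * (lam * (Ph p z / rad p z))).
    exact: (@is_derive1_comp _ sin (fun z => lam * ph p z + th)).
  have h6 : is_derive z 1 (fun z => (A p z * Psi m p z) * rad p z)
      (W p z + (A p z * Psi m p z) * om (kj p) p z).
    apply: is_derive_eq; rewrite /GRing.scale/= addrC; congr (_ + _).
    by rewrite mulrC divfK.
  have h7 := @is_deriveM _ _ _ _ z 1 _ _ h6 h5.
  apply: (is_derive_eq h7); rewrite /GRing.scale/= /g /B addrA -sin_shift.
  by rewrite -[X in _ = _ + lam * (X * _)](Aprod z); field.
have Gend z : z ^+ 2 = 4 -> G z = 0 by move=> z2; rewrite /G A0 ?mul0r// U_end.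
have FTC : (\int[lebesgue_measure]_(z in `[(-2)%R, 2%R]) (g z)%:E = (G 2)%:E - (G (-2))%:E)%E.
  apply: continuous_FTC2; first lra.
  - apply: continuous_subspaceT => z; apply: cvgD; first exact: continuous_osc.
    by apply: cvgM; [exact: cvg_cst|exact: continuous_osc].
  - split.
    + by move=> z _; have := dG z; case.
    + by apply: cvg_at_right_filter; have := dG (-2); exact: is_derive_continuous.
    + by apply: cvg_at_left_filter; have := dG 2; exact: is_derive_continuous.
  - by move=> z _; rewrite derive1E; have := dG z; case.
have I0 : \int[lebesgue_measure]_(z in `[-2, 2]) g z = 0.
  have G2 : G 2 = 0 by apply: Gend; ring.
  have GN2 : G (-2) = 0 by apply: Gend; ring.
  by rewrite /Rintegral FTC G2 GN2 /= subrr.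
have := I0; rewrite /g RintegralD//; last 2 first.
- exact/integrable_seg/continuous_osc.
- apply: integrable_seg => z; by apply: cvgM; [exact: cvg_cst|exact: continuous_osc].
rewrite RintegralZl//; last exact/integrable_seg/continuous_osc.
move=> /eqP; rewrite addr_eq0 => /eqP e.
by rewrite /osc_int -/(B p _) e mulrN mulNr opprK mulKf.
Qed.

Let osc_int_trivial (A : kernel_datum -> R -> R) (C : R) p lam th : continuous (A p) ->
  (forall z, `|z| <= 2 -> `|A p z| <= C) -> `|osc_int A p lam th| <= C * 4.
Proof.
move=> cA AC; have cosc := @continuous_osc A p lam th cA.
apply: (le_trans (le_normr_Rintegral _ _)) => //; first exact: integrable_seg.
rewrite (_ : C * 4 = \int[lebesgue_measure]_(z in `[-2, 2]) C); last first.
  rewrite Rintegral_cst//; congr (_ * _).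
  have := @lebesgue_measure_itv R `[-2, 2]; rewrite /= lte_fin ifT; last lra.
  by move=> ->; rewrite /= opprK; ring.
apply: le_Rintegral => //.
- apply: (@integrable_seg (fun z => `|A p z * cos (lam * ph p z + th)|)) => z.
  exact: (cvg_norm (cosc z)).
- by apply: (@integrable_seg (fun=> C)) => z; exact: cvg_cst.
- move=> z; rewrite /= in_itv/= => z2; rewrite normrM -[leRHS]mulr1 ler_pM//.
    by apply: AC; rewrite ler_norml.
  by rewrite ler_norml cos_geN1 cos_le1.
Qed.

Let osc_int_bound m k A : (k.+1 < m)%N -> tame rad k.+1 A ->
  (forall p z, U p z < 0 -> A p z = 0) ->
  exists C : R, forall p lam th, 0 < lam -> `|osc_int A p lam th| <= C / lam ^+ k.
Proof.
elim: k A => [|k IH] A km tA A0.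
  have [C AC] := tame_bounded tA; exists (C * 4) => p lam th lam0.
  rewrite expr0 divr1; by apply: osc_int_trivial; [exact: (continuous_tame tA)|exact: AC].
have tPsi := tame_Psi km.
have [_ [W dW tW0]] := tameM tA tPsi.
have {tW0} tW : tame rad k.+1 W by exact: tW0.
pose B p z := om (kj p) p z * (A p z * Psi m p z) + W p z.
have tB : tame rad k.+1 B.
  apply: tameD => //; apply: tameM; first exact: tame_omj.
  by apply: tameM; exact: tameW.
(* The condition [U < 0] is open, so the product is locally zero there and its derivative vanishes
   too; the new amplitude meets the requirement of the induction. *)
have B0 p z : U p z < 0 -> B p z = 0.
  move=> Uz; rewrite /B A0// mul0r mulr0 add0r.
  have near0 : \near z, A p z * Psi m p z = 0.
    have cU : {for z, continuous (U p)} by exact: (continuous_tame (tame_U 1)).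
    near=> y; rewrite A0 ?mul0r//; near: y.
    exact: (cvgr_lt (U p z)).
  have h1 : is_derive z 1 (fun z => A p z * Psi m p z) 0.
    apply: (@near_eq_is_derive _ _ _ (cst 0)).
    by near do apply/esym.
  have h2 := dW p z; have := @derive_val _ _ _ _ _ _ _ h2.
  rewrite (@derive_val _ _ _ _ _ _ _ h1) => /esym/eqP.
  by rewrite mulf_eq0 invr_eq0 (negbTE (rad_neq0 p z)) orbF => /eqP.
have [C BC] := IH B (ltnW km) tB B0.
exists C => p lam th lam0.
rewrite (@osc_int_by_parts m A W)// ?gt_eqF//.
- rewrite exprS normrM normrN normfV (gtr0_norm lam0) invfM mulrCA.
  by rewrite ler_pM2l ?invr_gt0//; exact: BC.
- exact: leq_ltn_trans km.
- exact: tame_le tA.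
- exact: tame_le tW.
- exact: tame_le tPsi.
Unshelve. all: by end_near. Qed.

Lemma sphere_kernel_le N : exists C : R, forall p lam th, 0 < lam ->
  `|\int[lebesgue_measure]_(z in `[-2, 2])
     (let x := update (kx p) (kj p) z in
      Num.max 0 (2 - \sum_(k < n) dot (normalize x) (kv p k) ^+ 2 - enorm x ^+ 2) ^+ N.+3
        * cos (lam * dot (normalize x) (kD p) + th))| <= C / lam ^+ N.
Proof.
have [||p z Uz|C HC] := @osc_int_bound N.+3 N (fun p z => Num.max 0 (U p z) ^+ N.+3).
- by [].
- apply: tame_pos_part_exp => //; exact: tame_U.
- by rewrite max_l ?ltW// expr0n.
exists C => p lam th lam0; apply: le_trans (HC p lam th lam0).
rewrite le_eqVlt; apply/orP; left; apply/eqP; congr `|_|.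
by apply: eq_Rintegral => z _ /=; rewrite kernel_cutoffE kernel_phaseE.
Qed.

End sphere_kernel.

(** * Integrals over boxes, one coordinate at a time *)

Section box_integrals.
Context {R : realType}.
Local Notation mu := (@lebesgue_measure R).
Local Notation I2 := (`[(-2)%R, 2%R]%classic : set R).
Implicit Types (n : nat) (B C z : R).

Definition box n : set 'rV[R]_n := [set x | forall i, `|x 0 i| <= 2].

Lemma box_cons n z (x : 'rV[R]_n) :
  box (cons_rV (z, x)) <-> `|z| <= 2 /\ box x.
Proof.
split => [h|[z2 xb] i]; rewrite /cons_rV.
  split => [|i]; first by have := h ord0; rewrite mxE unlift_none.
  by have := h (lift ord0 i); rewrite mxE liftK.
by rewrite mxE; case: unliftP => [j|] _ /=.
Qed.

Lemma measurable_box n : measurable (@box n).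
Proof.
rewrite (_ : @box n = \bigcap_(i in [set: 'I_n]) [set x | `|x 0 i| <= 2]); last first.
  by apply/seteqP; split => x h i; [move=> _|]; exact: h.
apply: fin_bigcap_measurable; first exact: finite_finset.
move=> i _; have := @measurable_coord R n i measurableT I2 (measurable_itv _).
by rewrite setTI; congr (measurable _); apply/seteqP; split => x /=; rewrite in_itv/= ler_norml.
Qed.

Lemma itv_measure : mu I2 = 4%:E.
Proof.
have := @lebesgue_measure_itv R `[-2, 2]; rewrite /= lte_fin ifT; last lra.
by move=> ->; congr (_%:E); ring.
Qed.

Lemma lebesgue_box n : lebesgue_rV R n (@box n) = (4 ^+ n)%:E.
Proof.
elim: n => [|n IH].
  rewrite /= diracE expr0; congr (_%:E).
  by rewrite mem_set// => -[].
rewrite /= /lebesgue_succ /pushforward.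
rewrite (_ : _ @^-1` _ = I2 `*` @box n); last first.
  by apply/seteqP; split => -[z x] /=; rewrite in_itv/= -ler_norml; [move/box_cons|move=> ?; apply/box_cons].
transitivity (mu I2 * lebesgue_rV R n (@box n))%E.
  by apply: product_measure1E => //; exact: measurable_box.
by rewrite IH itv_measure -EFinM -exprS.
Qed.

(** Boundedness and support in a box give integrability, and both pass to slices, so Fubini applies
    at every stage of an induction on the dimension. *)
Definition boxed n (f : 'rV[R]_n -> measurableTypeR R) (C : R) :=
  [/\ measurable_fun setT f, forall x, `|f x| <= C & forall x, ~ box x -> f x = 0].

Lemma boxed_integrable n f C : @boxed n f C ->
  (lebesgue_rV R n).-integrable setT (EFin \o f).
Proof.
move=> [mf fC f0].
rewrite (_ : EFin \o f = (EFin \o f) \_ (@box n)); last first.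
  apply/funext => x; rewrite patchE; case: ifPn => //.
  by rewrite notin_setE => /f0 /= ->.
apply/integrable_restrict => //; first exact: measurable_box.
rewrite setTI; apply: measurable_bounded_integrable.
- exact: measurable_box.
- by apply: (@le_lt_trans _ _ (4 ^+ n)%:E); [rewrite -lebesgue_box; exact: lexx|exact: ltry].
- exact: measurable_funTS.
- by exists C; split => [|M CM x _]; [rewrite num_real|exact: le_trans (fC x) (ltW CM)].
Qed.

Lemma boxed_slice n f C z : @boxed n.+1 f C ->
  @boxed n (fun x => f (cons_rV (z, x))) C.
Proof.
move=> [mf fC f0]; split => // [|x xb]; last by apply: f0 => /box_cons[].
apply: (measurableT_comp mf); apply: (measurableT_comp (@measurable_cons_rV R n)).
exact: pair1_measurable.
Qed.

Lemma boxed_prod_integrable n f C : @boxed n.+1 f C ->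
  (mu \x lebesgue_rV R n)%E.-integrable setT (fun p => (f (cons_rV p))%:E).
Proof.
move=> fb; have [mf fC f0] := fb; have /integrableP[_ fin] := boxed_integrable fb.
have mc : measurable_fun setT (fun p => (f (@cons_rV R n p))%:E).
  by apply/measurable_EFinP; apply: (measurableT_comp mf); exact: measurable_cons_rV.
apply/integrableP; split => //; apply: le_lt_trans fin.
rewrite (@eq_measure_integral _ _ _ _ (pushforward (mu \x lebesgue_rV R n)%E (@cons_rV R n)))//.
rewrite ge0_integral_pushforward ?preimage_setT//.
by do 2 apply: measurableT_comp => //.
Qed.

Lemma integral_succ n f C : @boxed n.+1 f C ->
  (\int[lebesgue_rV R n.+1]_x (f x)%:E =
   \int[mu \x lebesgue_rV R n]_p (f (cons_rV p))%:E)%E.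
Proof.
move=> fb; have [mf fC f0] := fb.
rewrite (@eq_measure_integral _ _ _ _ (pushforward (mu \x lebesgue_rV R n)%E (@cons_rV R n)))//.
rewrite integral_pushforward ?preimage_setT//.
- exact/measurable_EFinP.
- exact: boxed_prod_integrable fb.
Qed.

Lemma norm_integral_line_le (h : measurableTypeR R -> \bar R) B : measurable_fun setT h -> 0 <= B ->
  (forall z, z != 0 -> (`|h z| <= B%:E)%E) -> (forall z, 2 < `|z| -> h z = 0%E) ->
  (`|\int[mu]_z h z| <= (B * 4)%:E)%E.
Proof.
move=> mh B0 hB h0; have -> : (\int[mu]_z h z = \int[mu]_(z in I2) h z)%E.
  rewrite [RHS]integral_mkcond; apply: eq_integral => z _; rewrite patchE.
  case: ifPn => //; rewrite notin_setE /= in_itv/= -ler_norml => /negP.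
  by rewrite -ltNge => /h0.
have mh2 := measurable_funTS (D := I2) mh.
have mI2 : measurable (I2 : set (measurableTypeR R)) by exact: measurable_itv.
apply: (le_trans (@le_abse_integral _ _ _ mu I2 h mI2 mh2)).
rewrite EFinM -itv_measure; apply: integral_le_bound => //.
exists [set 0]; split => //; first exact: lebesgue_measure_set1.
move=> z /= /not_implyP[_ hz]; apply: contrapT => /eqP z0; apply: hz.
exact: hB.
Qed.

Lemma norm_integral_box_le n f C B : @boxed n f C -> 0 <= B ->
  (forall x : 'rV[R]_n, (forall i, x 0 i != 0) -> `|f x| <= B) ->
  (`|\int[lebesgue_rV R n]_x (f x)%:E| <= (B * 4 ^+ n)%:E)%E.
Proof.
elim: n f => [|n IH] f fb B0 fB.
  rewrite /= integral_dirac//; last by have [mf _ _] := fb; exact/measurable_EFinP.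
  rewrite diracE mem_set// mul1e /= lee_fin expr0 mulr1.
  by apply: fB => -[].
rewrite (integral_succ fb) -integral12_prod_meas1//; last first.
  exact: boxed_prod_integrable fb.
rewrite exprSr mulrA; apply: norm_integral_line_le.
- by apply: measurable_fubini_F; exact: boxed_prod_integrable fb.
- by rewrite mulr_ge0// exprn_ge0.
- move=> z z0; apply: IH => //; first exact: boxed_slice.
  move=> x x0; apply: fB => i; rewrite mxE; by case: unliftP => [j|] _ /=.
- move=> z z2; rewrite /fubini_F integral0_eq// => x _.
  by have [_ _ ->] := fb => // /box_cons[]; rewrite leNgt z2.
Qed.

Lemma update_lift n z (x : 'rV[R]_n) j t :
  update (cons_rV (z, x)) (lift ord0 j) t = cons_rV (z, update x j t).
Proof.
apply/rowP => i; rewrite !mxE /=; case: unliftP => [k|] -> /=.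
  by rewrite mxE (inj_eq lift_inj).
by [].
Qed.

Lemma update_ord0 n z (x : 'rV[R]_n) t :
  update (cons_rV (z, x)) ord0 t = cons_rV (t, x).
Proof.
apply/rowP => i; rewrite !mxE /=; by case: unliftP => [k|] ->.
Qed.

Lemma integral_line_itv (h : measurableTypeR R -> \bar R) :
  (forall z, 2 < `|z| -> h z = 0%E) -> (\int[mu]_z h z = \int[mu]_(z in I2) h z)%E.
Proof.
move=> h0; rewrite [RHS]integral_mkcond; apply: eq_integral => z _; rewrite patchE.
case: ifPn => //; rewrite notin_setE /= in_itv/= -ler_norml => /negP.
by rewrite -ltNge => /h0.
Qed.

(** Coordinates before [j] are peeled off; then the other order of Fubini integrates along [j]
    innermost. Lines on which another coordinate vanishes are discarded as a null set, which keeps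
    the remaining lines off the origin when [n >= 2]. *)
Lemma norm_integral_update_le n (j : 'I_n) f C B : @boxed n f C -> 0 <= B ->
  (forall x : 'rV[R]_n, (forall i, i != j -> x 0 i != 0 /\ `|x 0 i| <= 2) ->
     (`|\int[mu]_(z in I2) (f (update x j z))%:E| <= B%:E)%E) ->
  (`|\int[lebesgue_rV R n]_x (f x)%:E| <= (B * 4 ^+ n)%:E)%E.
Proof.
elim: n j f => [[]//|n IH] j f fb B0 fB.
have C0 : 0 <= C by have [_ fC _] := fb; exact: le_trans (fC 0).
have out z x : 2 < `|z| -> f (cons_rV (z, x)) = 0.
  by move=> z2; have [_ _ ->] := fb => // /box_cons[]; rewrite leNgt z2.
case: (unliftP ord0 j) => [j'|] ej; rewrite {}ej in fB; last first.
  pose G := fubini_G mu (fun p => (f (@cons_rV R n p))%:E).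
  have GE x : G x = (\int[mu]_(z in I2) (f (cons_rV (z, x)))%:E)%E.
    by rewrite /G /fubini_G integral_line_itv// => z /out ->.
  have mG : measurable_fun setT G.
    by apply: measurable_fubini_G; exact: boxed_prod_integrable fb.
  have GC x : (`|G x| <= (C * 4)%:E)%E.
    apply: norm_integral_line_le => //.
    - apply/measurable_EFinP; have [mf _ _] := fb.
      apply: (measurableT_comp mf); apply: (measurableT_comp (@measurable_cons_rV R n)).
      exact: pair2_measurable.
    - by move=> z _; rewrite lee_fin; have [_ fC _] := fb.
    - by move=> z /out ->.
  have Gfin x : G x \is a fin_num.
    by rewrite fin_num_abs; apply: le_lt_trans (GC x) _; exact: ltry.
  have gb : boxed (fun x => fine (G x)) (C * 4).
    split; first exact: measurableT_comp.
    - by move=> x; have := GC x; rewrite -(fineK (Gfin x)) lee_fin.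
    - move=> x xb; rewrite /G /fubini_G integral0_eq// => z _.
      by have [_ _ ->] := fb => // /box_cons[].
  rewrite (integral_succ fb) -integral21_prod_meas1//; last exact: boxed_prod_integrable fb.
  rewrite (eq_integral (fun x => (fine (G x))%:E)); last first.
    by move=> x _; rewrite fineK.
  apply: le_trans (norm_integral_box_le gb B0 _) _; last first.
    by rewrite lee_fin ler_wpM2l// ler_weXn2l ?ler1n.
  move=> x x0; rewrite -lee_fin; have -> : (`|fine (G x)|%:E = `|G x|)%E.
    by rewrite -{2}(fineK (Gfin x)).
  have [xb|xb] := pselect (box x); last first.
    by have [_ _ /(_ _ xb) g0] := gb; rewrite -(fineK (Gfin x)) g0 abse0 lee_fin.
  rewrite GE; under eq_integral do rewrite -(update_ord0 0).
  apply: fB => i; case: (unliftP ord0 i) => [k|] -> // _.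
  by rewrite mxE liftK /=; split; [exact: x0|exact: xb].
rewrite (integral_succ fb) -integral12_prod_meas1//; last first.
  exact: boxed_prod_integrable fb.
rewrite exprSr mulrA; apply: norm_integral_line_le.
- by apply: measurable_fubini_F; exact: boxed_prod_integrable fb.
- by rewrite mulr_ge0// exprn_ge0.
- move=> z z0; have [z2|z2] := leP `|z| 2; last first.
    rewrite /fubini_F integral0_eq ?abse0 ?lee_fin ?mulr_ge0 ?exprn_ge0// => x _.
    by rewrite out.
  apply: (IH j') => //; first exact: boxed_slice.
  move=> x x0; under eq_integral do rewrite -update_lift.
  apply: fB => i; case: (unliftP ord0 i) => [k|] ->; last first.
    by rewrite mxE unlift_none.
  by rewrite (inj_eq lift_inj) mxE liftK /=; exact: x0.
- by move=> z z2; rewrite /fubini_F integral0_eq// => x _; rewrite out.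
Qed.

End box_integrals.

Section ball_projection.
Context {R : realType}.
Implicit Types (n : nat).

Lemma dot0r n (x : 'rV[R]_n) : dot x 0 = 0.
Proof. by rewrite /dot big1// => i _; rewrite mxE mulr0. Qed.

Lemma dot_ge0 n (x : 'rV[R]_n) : 0 <= dot x x.
Proof. by apply: sumr_ge0 => i _; rewrite -expr2 sqr_ge0. Qed.

Lemma enorm_sqr n (x : 'rV[R]_n) : enorm x ^+ 2 = dot x x.
Proof. by rewrite /enorm sqr_sqrtr// dot_ge0. Qed.

Lemma coord_le_enorm n (x : 'rV[R]_n) i : `|x 0 i| <= enorm x.
Proof.
rewrite -ler_sqr ?nnegrE ?sqrtr_ge0// enorm_sqr real_normK ?num_real//.
rewrite /dot (bigD1 i)//= expr2 lerDl.
by apply: sumr_ge0 => j _; rewrite -expr2 sqr_ge0.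
Qed.

Lemma enorm_normalize n (x : 'rV[R]_n) : enorm x != 0 -> enorm (normalize x) = 1.
Proof.
move=> x0; rewrite {1}/enorm (_ : dot _ _ = 1) ?sqrtr1// /dot.
under eq_bigr do rewrite !mxE.
rewrite (eq_bigr (fun i => (enorm x)^-1 ^+ 2 * (x 0 i * x 0 i))); last by move=> i _; ring.
by rewrite -mulr_sumr -/(dot x x) -enorm_sqr -exprMn mulVf// expr1n.
Qed.

Lemma measurable_sphere n : measurable (sphere R n).
Proof.
by have := @measurable_enorm R n measurableT [set 1] (measurable_set1 _); rewrite setTI.
Qed.

(** Everything outside the punctured ball goes to 0, which is not on the sphere. Preimages of
    subsets of the sphere are then exactly the cones that define the surface measure. *)
Definition ball_projection n (x : 'rV[R]_n) : 'rV[R]_n := \1_(punctured_ball R n) x *: normalize x.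

Lemma measurable_ball_projection n : measurable_fun setT (@ball_projection n).
Proof.
apply: measurable_fun_rV => i; under eq_fun do rewrite mxE.
apply: measurable_funM; first exact: measurable_indic (@measurable_punctured_ball R n).
exact: (measurableT_comp (@measurable_coord R n i) (@measurable_normalize R n)).
Qed.

End ball_projection.

HB.instance Definition _ (R : realType) n := isMeasurableFun.Build _ _ _ _
  (@ball_projection R n) (@measurable_ball_projection R n).

Section sphere_integrals.
Context {R : realType}.
Local Notation mu := (@lebesgue_measure R).
Local Notation I2 := (`[(-2)%R, 2%R]%classic : set R).
Implicit Types (n d : nat).

(** On the sphere the surface measure is [n] times the push-forward of Lebesgue measure by
    [ball_projection], so the left side is an integral over the ball. The majorant [G] may extend
    beyond the ball, which leaves room for a cutoff that is not sharp. *)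
Lemma sphere_integral_le n (F G : 'rV[R]_n -> measurableTypeR R) :
  measurable_fun setT F -> measurable_fun setT G ->
  (forall x, 0 <= F x) -> (forall x, 0 <= G x) ->
  (forall x, punctured_ball R n x -> F (normalize x) <= G x) ->
  (\int[sphere_measure R n]_(w in sphere R n) (F w)%:E <=
   n%:R%:E * \int[lebesgue_rV R n]_x (G x)%:E)%E.
Proof.
move=> mF mG F0 G0 FG.
have n0 : 0 <= n%:R :> R by [].
have mS := @measurable_sphere R n.
have preS A : A `<=` sphere R n ->
    @ball_projection R n @^-1` A = normalize @^-1` A `&` punctured_ball R n.
  move=> AS; apply/seteqP; split => x /=; rewrite /ball_projection indicE.
    case: (boolP (x \in punctured_ball R n)) => xb; rewrite ?scale1r ?scale0r.
      by move=> ?; split => //; rewrite inE in xb.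
    by move=> /AS; rewrite /sphere /= /enorm dot0r sqrtr0 => /esym/eqP; rewrite oner_eq0.
  by move=> [Ax xb]; rewrite mem_set// scale1r.
pose m1 := pushforward (lebesgue_rV R n) (@ball_projection R n).
rewrite (@eq_measure_integral _ _ _ _ (mscale (NngNum n0) m1)); last first.
  by move=> A mA AS; rewrite /= /sphere_measure /mscale /= /m1 /pushforward preS.
rewrite ge0_integral_mscale//; last 2 first.
- by apply/measurable_EFinP; exact: measurable_funTS.
- by move=> x _; rewrite lee_fin.
apply: lee_wpmul2l; first by rewrite lee_fin.
rewrite ge0_integral_pushforward//; last 2 first.
- by apply/measurable_EFinP; exact: measurable_funTS.
- by move=> x _; rewrite lee_fin.
have mP : measurable (@ball_projection R n @^-1` sphere R n).
  by rewrite -[X in measurable X]setTI; exact: measurable_ball_projection.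
apply: (@le_trans _ _ (\int[lebesgue_rV R n]_(x in @ball_projection R n @^-1` sphere R n) (G x)%:E)%E).
  apply: ge0_le_integral => //.
  - by move=> x _; rewrite lee_fin.
  - apply: measurable_funTS; apply/measurable_EFinP.
    exact: (measurableT_comp mF (@measurable_ball_projection R n)).
  - by apply: measurable_funTS; apply/measurable_EFinP.
  - move=> x; rewrite preS// => -[_ xb].
    by rewrite lee_fin /ball_projection indicE mem_set// scale1r FG.
apply: ge0_subset_integral => //.
- exact/measurable_EFinP.
- by move=> x _; rewrite lee_fin.
Qed.

Lemma measurable_dot n (v : 'rV[R]_n) :
  measurable_fun setT (fun x : 'rV[R]_n => dot x v : measurableTypeR R).
Proof.
apply: measurable_sum => i.
by apply: measurable_funM => //; exact: measurable_coord.
Qed.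

Lemma measurable_dot_normalize n (v : 'rV[R]_n) :
  measurable_fun setT (fun x : 'rV[R]_n => dot (normalize x) v : measurableTypeR R).
Proof. exact: (measurableT_comp (measurable_dot v) (@measurable_normalize R n)). Qed.

(** The sum localizes the direction, the last term the radius: the positive part is supported in the
    box, and the 2 leaves it bounded below on the unit ball for directions almost orthogonal to all
    [v k]. *)
Definition cutoff d n (v : 'I_n -> 'rV[R]_d) (x : 'rV[R]_d) : R :=
  2 - \sum_(k < n) dot (normalize x) (v k) ^+ 2 - enorm x ^+ 2.

Lemma measurable_cutoff d n (v : 'I_n -> 'rV[R]_d) :
  measurable_fun setT (cutoff v : 'rV[R]_d -> measurableTypeR R).
Proof.
apply: measurable_funB; last by apply: measurable_funX; exact: measurable_enorm.
apply: measurable_funB => //; apply: measurable_sum => k.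
by apply: measurable_funX; exact: measurable_dot_normalize.
Qed.

Lemma boxed_cutoff d n m (v : 'I_n -> 'rV[R]_d) (g : 'rV[R]_d -> measurableTypeR R) (C : R) :
  measurable_fun setT g -> (forall x, `|g x| <= C) ->
  boxed (fun x => Num.max 0 (cutoff v x) ^+ m.+1 * g x : measurableTypeR R) (2 ^+ m.+1 * C).
Proof.
move=> mg gC.
have cut2 x : cutoff v x <= 2 - enorm x ^+ 2.
  rewrite /cutoff -addrA lerD2l -[leRHS]add0r lerD2r oppr_le0.
  by apply: sumr_ge0 => k _; exact: sqr_ge0.
split.
- apply: measurable_funM => //; apply: measurable_funX.
  by apply: measurable_maxr => //; exact: measurable_cutoff.
- move=> x; rewrite normrM ler_pM// normrX lerXn2r ?nnegrE//.
  rewrite ger0_norm ?le_max ?lexx// ge_max ler0n/= (le_trans (cut2 x))//.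
  by rewrite gerBl sqr_ge0.
- move=> x xb; have [i /negP] : exists i, ~ `|x 0 i| <= 2 by apply/existsNP.
  rewrite -ltNge => xi.
  have cut0 : cutoff v x <= 0.
    apply: (le_trans (cut2 x)); have := coord_le_enorm x i; nra.
  by rewrite max_l// expr0n mul0r.
Qed.

Lemma norm_cos_le1 (x : R) : `|cos x| <= 1.
Proof. by rewrite ler_norml cos_geN1 cos_le1. Qed.

Lemma sphere_oscillatory_le d n (V : R) N : (1 < d)%N -> exists2 C : R, 0 <= C &
  forall (v : 'I_n -> 'rV[R]_d) (D : 'rV[R]_d) (j : 'I_d) (lam th : R), 0 < lam ->
  (forall k i, `|v k 0 i| <= V) -> (forall i, `|D 0 i| <= 1) -> `|D 0 j| = 1 ->
  (forall w : 'rV[R]_d, enorm w = 1 ->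
     \sum_(k < n) dot w (v k) ^+ 2 < 5 / 2 -> `|dot w D| <= 1 / 2) ->
  (`|\int[lebesgue_rV R d]_x (Num.max 0 (cutoff v x) ^+ N.+3 *
       cos (lam * dot (normalize x) D + th))%:E| <= (C / lam ^+ N)%:E)%E.
Proof.
move=> d1; have [C CP] := @sphere_kernel_le R d n V N.
exists (`|C| * 4 ^+ d); first by rewrite mulr_ge0// exprn_ge0.
move=> v D j lam th lam0 vV D1 Dj Dsmall.
have lamN0 : 0 < lam ^+ N by rewrite exprn_gt0.
have mcos : measurable_fun setT
    (fun x : 'rV[R]_d => cos (lam * dot (normalize x) D + th) : measurableTypeR R).
  apply: (@measurableT_comp _ _ _ _ _ _ (@cos R : R -> R)).
    exact: (continuous_measurable_fun (@continuous_cos R)).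
  apply: measurable_funD => //; apply: measurable_funM => //.
  exact: measurable_dot_normalize.
have fb := @boxed_cutoff d n N.+2 v _ 1 mcos (fun x => norm_cos_le1 _).
rewrite mulrAC; apply: (norm_integral_update_le (j := j) fb); first by rewrite divr_ge0// ltW.
move=> x xj.
(* A second coordinate, nonzero on almost every line in direction [j], makes the line miss the
   origin. *)
have [i0 i0j] : exists i : 'I_d, i != j.
  have [->|j0] := eqVneq j (Ordinal (ltn_trans (ltnSn 0) d1)); last by exists (Ordinal (ltn_trans (ltnSn 0) d1)); rewrite eq_sym.
  by exists (Ordinal d1).
pose p := @KernelDatum R d n V j x D v (ex_intro2 _ _ i0 i0j (xj i0 i0j).1)
  (fun i ij => (xj i ij).2) D1 Dj vV Dsmall.
have [mf fC _] := fb.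
have mup : measurable_fun setT (fun z : measurableTypeR R => update x j z).
  apply: measurable_fun_rV => i; under eq_fun do rewrite mxE.
  by case: (i == j); [exact: measurable_id|exact: measurable_cst].
rewrite -EFin_normr_Rintegral//; last first.
  apply: measurable_bounded_integrable => //.
  - by apply: (@le_lt_trans _ _ 4%:E); [rewrite -(@itv_measure R); exact: lexx|exact: ltry].
  - by apply: measurable_funTS; exact: (measurableT_comp mf mup).
  - by exists (2 ^+ N.+3 * 1); split => [|M CM z _]; [rewrite num_real|exact: le_trans (fC _) (ltW CM)].
rewrite lee_fin; apply: (le_trans (CP p lam th lam0)).
by rewrite ler_pM2r ?invr_gt0// ler_norm.
Qed.

End sphere_integrals.

(** * Differences of points on the curve *)

Section taylor.
Context {R : realType}.

Lemma taylor_le (L : nat) (f : nat -> R -> R) (B t0 t : R) :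
  (forall l (s : R), 0 <= s <= 1 -> is_derive s 1 (f l) (f l.+1 s)) ->
  (forall s : R, 0 <= s <= 1 -> `|f L.+1 s| <= B) -> 0 <= t0 <= t -> t <= 1 ->
  `|f 0%N t - \sum_(l < L.+1) f l t0 * (t - t0) ^+ l / l`!%:R| <= B * (t - t0) ^+ L.+1.
Proof.
elim: L f t => [|L IH] f t fd fB /andP[t00 t0t] t1.
  rewrite big_ord1 expr0 fact0 mulr1 divr1 expr1.
  by apply: (mean_value_le t0t) => s /andP[s1 s2]; [apply: (fd 0%N)|apply: fB];
    rewrite (le_trans t00)//= (le_trans s2).
pose P (s : R) : R := \sum_(l < L.+2) f l t0 * (s - t0) ^+ l / l`!%:R.
pose P' (s : R) : R := \sum_(l < L.+1) f l.+1 t0 * (s - t0) ^+ l / l`!%:R.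
have dP (s : R) : is_derive s 1 P (P' s).
  have h (l : 'I_L.+2) : is_derive s 1 (fun s => f l t0 * (s - t0) ^+ l / l`!%:R)
      (if (l : nat) is l'.+1 then f l'.+1 t0 * (s - t0) ^+ l' / l'`!%:R else 0).
    case: l => -[|l] l2 /=; first by rewrite (_ : (fun _ => _) = cst (f 0%N t0 * 1 / 1)) //; exact: is_derive_cst.
    have h1 : is_derive s 1 (fun s => s - t0) 1.
      by apply: is_derive_eq; rewrite subr0.
    have h2 := @is_deriveX _ _ (fun s => s - t0) l.+1 s 1 1 h1.
    rewrite exprfctE /GRing.scale/= mulr1 in h2.
    have h3 : is_derive s 1 (fun s => f l.+1 t0 / l.+1`!%:R * (s - t0) ^+ l.+1)
       (f l.+1 t0 / l.+1`!%:R * (l.+1%:R * (s - t0) ^+ l)).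
      exact: is_deriveZ.
    rewrite (_ : (fun _ => _) = (fun s => f l.+1 t0 / l.+1`!%:R * (s - t0) ^+ l.+1)); last first.
      by apply/funext => y; rewrite mulrAC.
    apply: (is_derive_eq h3); rewrite factS natrM; field.
    by rewrite addrC natr1 !pnatr_eq0 -lt0n fact_gt0.
  have := @is_derive_sum _ _ _ L.+2 (fun l s => f l t0 * (s - t0) ^+ l / l`!%:R) s 1 _ h.
  rewrite (_ : \sum_(l < L.+2) _ = P); last by apply/funext => y; rewrite fct_sumE.
  by rewrite big_ord_recl/= add0r.
have Pt0 : P t0 = f 0%N t0.
  rewrite /P big_ord_recl/= subrr expr0 fact0 mulr1 divr1 big1 ?addr0// => i _.
  by rewrite expr0n/= mulr0 mul0r.
have B0 : 0 <= B by apply: le_trans (normr_ge0 _) (fB t0 _); rewrite t00 (le_trans t0t).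
have := @mean_value_le R (fun s => f 0%N s - P s) (fun s => f 1%N s - P' s) t0 t
  (B * (t - t0) ^+ L.+1) t0t.
rewrite Pt0 subrr subr0 -mulrA -exprSr; apply.
- move=> s /andP[s1 s2]; have h1 := fd 0%N s; have h2 := dP s.
  have /h1 h3 : 0 <= s <= 1 by rewrite (le_trans t00)//= (le_trans s2).
  exact: is_deriveB.
- move=> s /andP[s1 s2].
  apply: (le_trans (IH (fun l => f l.+1) s _ _ _ _)) => //.
  + by rewrite t00.
  + exact: le_trans t1.
  + by rewrite ler_wpM2l// lerXn2r ?nnegrE ?subr_ge0 ?(le_trans s1)// lerD2r.
Qed.

End taylor.

Lemma separated_unit_itv (R : realType) n (al : nat -> R) l x y : separated n al l x y ->
  forall j, (j <= n)%N -> 0 <= x j <= 1 /\ 0 <= y j <= 1.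
Proof.
move=> [l0 a0 a1 aS xyj] j jn.
have al0 k : (k <= n)%N -> 0 <= al k.
  by elim: k => // k IH kn; have := aS _ kn; have := IH (ltnW kn); lra.
have al1 k : (k <= n)%N -> al (n - k)%N + l <= 1.
  elim: k => [|k IH] kn; first by rewrite subn0.
  have nk : (n - k.+1 < n)%N by rewrite ltn_subrL (leq_ltn_trans (leq0n k) kn).
  by have := aS _ nk; rewrite -subSn// subSS => h; have := IH (ltnW kn); lra.
have := al0 _ jn; have := al1 (n - j)%N (leq_subr _ _); rewrite subKn//.
by have [/andP[x1 x2] /andP[y1 y2]] := xyj _ jn => h1 h2; split; lra.
Qed.

Section curve_differences.
Context {R : realType} (d : nat).
(** [G l] stands for the [l]-th derivative of the curve rescaled to [[0, 1]], and [kappa] measures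
    the independence of the first [K] derivatives, uniformly in [t]. *)
Variables (G : nat -> R -> 'rV[R]_d) (K : nat) (kappa : R) (Bd : nat -> R).
Hypothesis G_derive : forall l i (t : R), 0 <= t <= 1 ->
  is_derive t 1 (fun s => G l s 0 i) (G l.+1 t 0 i).
Hypothesis G_bounded : forall l i (t : R), 0 <= t <= 1 -> `|G l t 0 i| <= Bd l.
Hypothesis kappa_gt0 : 0 < kappa.
Hypothesis G_free : forall (t : R) (c : nat -> R) j, 0 <= t <= 1 -> (j < K)%N ->
  exists i, kappa * `|c j| <= `|\sum_(l < K) c l * G l.+1 t 0 i|.

Lemma norm_dot_le (w v : 'rV[R]_d) (B : R) : (forall i, `|w 0 i| <= 1) ->
  (forall i, `|v 0 i| <= B) -> `|dot w v| <= d%:R * B.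
Proof.
move=> w1 vB; apply: (le_trans (ler_norm_sum _ _ _)).
rewrite -[X in X%:R]card_ord mulr_natl -sumr_const; apply: ler_sum => i _.
by rewrite normrM -[leRHS]mul1r ler_pM.
Qed.

Lemma Bd_ge0 (t : R) l : (0 < d)%N -> 0 <= t <= 1 -> 0 <= Bd l.
Proof. by move=> d0 t01; exact: le_trans (normr_ge0 _) (G_bounded l (Ordinal d0) t01). Qed.

Lemma difference_expansion n L t0 beta (x y : nat -> R) i :
  0 < beta -> 0 <= t0 -> t0 + beta <= 1 ->
  (forall j, (j <= n)%N -> 0 <= x j <= 1 /\ 0 <= y j <= 1) ->
  `|(\sum_(j < n.+1) (G 0 (t0 + beta * x j) - G 0 (t0 + beta * y j))) 0 i
    - \sum_(l < L.+1) G l t0 0 i * (beta ^+ l * power_diff n x y l / l`!%:R)|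
  <= 2 * n.+1%:R * Bd L.+1 * beta ^+ L.+1.
Proof.
move=> b0 t00 tb xy.
have T z : 0 <= z <= 1 -> `|G 0%N (t0 + beta * z) 0 i
    - \sum_(l < L.+1) G l t0 0 i * (beta * z) ^+ l / l`!%:R| <= Bd L.+1 * beta ^+ L.+1.
  move=> /andP[z0 z1]; have bz : 0 <= beta * z by rewrite mulr_ge0// ltW.
  have bz1 : beta * z <= beta by rewrite -[leRHS]mulr1 ler_pM2l.
  have := @taylor_le R L (fun l s => G l s 0 i) (Bd L.+1) t0 (t0 + beta * z).
  rewrite addrAC subrr add0r => /(_ _ _ _ _)/le_trans; apply.
  - by move=> s; exact: G_bounded.
  - by rewrite t00 lerDl.
  - by rewrite (le_trans _ tb)// lerD2l.
  - rewrite ler_wpM2l ?lerXn2r ?nnegrE ?(ltW b0)//.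
    by apply: (@le_trans _ _ `|G L.+1 0 0 i|) => //; apply: G_bounded; rewrite lexx ler01.
rewrite summxE.
have -> : \sum_(l < L.+1) G l t0 0 i * (beta ^+ l * power_diff n x y l / l`!%:R) =
    \sum_(j < n.+1) (\sum_(l < L.+1) G l t0 0 i * (beta * x j) ^+ l / l`!%:R -
                     \sum_(l < L.+1) G l t0 0 i * (beta * y j) ^+ l / l`!%:R).
  under [RHS]eq_bigr do rewrite -sumrB.
  rewrite exchange_big/=; apply: eq_bigr => l _.
  rewrite /power_diff mulr_sumr mulr_suml mulr_sumr; apply: eq_bigr => j _.
  by rewrite !exprMn; ring.
rewrite -sumrB; apply: (le_trans (ler_norm_sum _ _ _)).
rewrite (_ : 2 * _ * _ * _ = \sum_(j < n.+1) (2 * (Bd L.+1 * beta ^+ L.+1))); last first.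
  by rewrite sumr_const card_ord -[RHS]mulr_natl; ring.
apply: ler_sum => j _; have [xj yj] := xy j (ltn_ord j).
rewrite !mxE (_ : _ - _ - _ = (G 0%N (t0 + beta * x j) 0 i -
  \sum_(l < L.+1) G l t0 0 i * (beta * x j) ^+ l / l`!%:R) -
  (G 0%N (t0 + beta * y j) 0 i -
  \sum_(l < L.+1) G l t0 0 i * (beta * y j) ^+ l / l`!%:R)); last by ring.
rewrite mulr_natl mulr2n; apply: (le_trans (ler_normB _ _)).
by apply: lerD; exact: T.
Qed.

(** [M] is the largest [beta^l |P_l|] over orders [l <= n + 1], where [P_l] are the power
    differences. Those of higher order are controlled by these, so their Taylor terms carry an extra
    factor [beta]. Hence [Delta] is a combination of the first [n + 1] derivatives up to
    [O(beta * M)], and independence bounds [M] by the size of [Delta]. The [e] further orders make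
    the remainder as small as desired. *)
Lemma difference_bounds n e : (0 < d)%N -> (n < K)%N ->
  exists C beta0 : R, [/\ 1 <= C, 0 < beta0 &
  forall (beta t0 : R) (al : nat -> R) (l : R) (x y : nat -> R) (D : R), 0 < beta <= beta0 -> 0 <= t0 -> t0 + beta <= 1 ->
  separated n al l x y ->
  let Delta := \sum_(j < n.+1) (G 0 (t0 + beta * x j) - G 0 (t0 + beta * y j)) in
  (forall i, `|Delta 0 i| <= D) ->
  exists M : R, [/\ 0 <= M,
    forall l, (1 <= l <= n.+1)%N -> beta ^+ l * `|power_diff n x y l| <= M,
    M <= C * (D + beta ^+ (n.+1 + e).+1) &
    forall w : 'rV[R]_d, (forall i, `|w 0 i| <= 1) ->
      `|dot w Delta| <= (\sum_(k < n.+1) `|dot w (G k.+1 t0)| + C * beta) * M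
                        + C * beta ^+ (n.+1 + e).+1]].
Proof.
move=> d0 nK; set L := (n.+1 + e)%N.
have t01 : 0 <= (0 : R) <= 1 by rewrite lexx ler01.
have B0 l : 0 <= Bd l by exact: (Bd_ge0 l d0 t01).
have [CP CP1 PC] := @power_diff_bound R n e.+1.
pose C2 : R := (\sum_(k < e) Bd (n.+1 + k).+1) * CP.
pose C3 : R := 2 * n.+1%:R * Bd L.+1.
have CP0 : 0 <= CP := le_trans ler01 CP1.
have C20 : 0 <= C2 by rewrite mulr_ge0// sumr_ge0.
have C30 : 0 <= C3 by rewrite !mulr_ge0.
pose f : R := n.+1`!%:R; have f0 : 0 < f by rewrite ltr0n fact_gt0.
pose Q := 2 * f / kappa; have Q0 : 0 <= Q by rewrite divr_ge0 ?mulr_ge0 ?ltW.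
exists (1 + Q * (1 + C3) + d%:R * C2 + d%:R * C3), (Num.min 1 (kappa / (2 * f * (C2 + 1)))).
have C21 : 0 < C2 + 1 by rewrite ltr_wpDl.
have QC : 0 <= Q * (1 + C3) by rewrite mulr_ge0// addr_ge0.
have dC2 : 0 <= d%:R * C2 by rewrite mulr_ge0.
have dC3 : 0 <= d%:R * C3 by rewrite mulr_ge0.
split.
- by move: QC dC2 dC3; lra.
- by rewrite lt_min ltr01 divr_gt0// !mulr_gt0.
move=> beta t0 al l x y D /andP[b0]; rewrite le_min => /andP[b1 bk] t00 tb sep Delta DD.
have D0 : 0 <= D by exact: le_trans (normr_ge0 _) (DD (Ordinal d0)).
have t0in : 0 <= t0 <= 1 by rewrite t00 (le_trans _ tb)// lerDl ltW.
pose c k : R := if (k < n.+1)%N then beta ^+ k.+1 * power_diff n x y k.+1 / k.+1`!%:R else 0.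
pose M := \big[Num.max/0]_(k < n.+1) (beta ^+ k.+1 * `|power_diff n x y k.+1|).
have M0 : 0 <= M by exact: bigmax_ge_id.
have PM k : (1 <= k <= n.+1)%N -> beta ^+ k * `|power_diff n x y k| <= M.
  case: k => // k /= kn; exact: (le_bigmax _ _ (Ordinal (kn : (k < n.+1)%N))).
have fact1 k : 1 <= (k`!)%:R :> R by rewrite ler1n fact_gt0.
have cM k : (k < n.+1)%N -> `|c k| <= M.
  move=> kn; rewrite /c kn 2!normrM normfV normr_nat ger0_norm ?exprn_ge0 ?(ltW b0)//.
  apply: (@le_trans _ _ (beta ^+ k.+1 * `|power_diff n x y k.+1|)); last by rewrite PM.
  rewrite ler_pdivrMr ?(lt_le_trans ltr01)// -[leLHS]mulr1 ler_wpM2l//.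
  by rewrite mulr_ge0// exprn_ge0// ltW.
have bn k : 0 < beta ^+ k by rewrite exprn_gt0.
have PMn k : (1 <= k <= n.+1)%N -> `|power_diff n x y k| <= M / beta ^+ n.+1.
  move=> kn; rewrite ler_pdivlMr// mulrC (le_trans _ (PM _ kn))// ler_wpM2r//.
  by case/andP: kn => _ kn; rewrite ler_wiXn2l// ltW.
have tailP k : (k < e)%N ->
    beta ^+ (n.+1 + k).+1 * `|power_diff n x y (n.+1 + k).+1| <= CP * (beta * M).
  move=> ke; have /(_ (n.+1 + k).+1) H := PC _ _ _ _ _ sep PMn.
  apply: (@le_trans _ _ (beta ^+ (n.+1 + k).+1 * (CP * (M / beta ^+ n.+1)))).
    by rewrite ler_pM2l//; apply: H; rewrite /= addnS ltnS addSn ltn_add2l.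
  rewrite exprS exprD.
  rewrite (_ : _ * _ = CP * (beta * M) * beta ^+ k); last by field; rewrite gt_eqF.
  rewrite -[leRHS]mulr1 ler_wpM2l//; last by rewrite exprn_ile1// ltW.
  by apply: mulr_ge0 => //; apply: mulr_ge0 => //; exact: ltW.
pose main i := \sum_(k < n.+1) c k * G k.+1 t0 0 i.
pose tail i := \sum_(k < e) G (n.+1 + k).+1 t0 0 i *
  (beta ^+ (n.+1 + k).+1 * power_diff n x y (n.+1 + k).+1 / (n.+1 + k).+1`!%:R).
have xy01 := separated_unit_itv sep.
have err i : `|Delta 0 i - (main i + tail i)| <= C3 * beta ^+ L.+1.
  have := difference_expansion L i b0 t00 tb xy01.
  rewrite -/Delta big_ord_recl/= power_diff0 mulr0 mul0r mulr0 add0r.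
  rewrite /L big_split_ord/= /main /tail.
  rewrite (eq_bigr (fun k : 'I_n.+1 => c k * G k.+1 t0 0 i))//.
  by move=> k _; rewrite /c ltn_ord mulrC.
have tailM i : `|tail i| <= C2 * (beta * M).
  apply: (le_trans (ler_norm_sum _ _ _)); rewrite /C2 -mulrA mulr_suml.
  apply: ler_sum => k _; rewrite normrM ler_pM//; first exact: G_bounded.
  rewrite 2!normrM normfV normr_nat ger0_norm ?(ltW (bn _))//.
  apply: (@le_trans _ _ (beta ^+ (n.+1 + k).+1 * `|power_diff n x y (n.+1 + k).+1|)).
    rewrite ler_pdivrMr ?(lt_le_trans ltr01)// -[leLHS]mulr1 ler_wpM2l//.
    by rewrite mulr_ge0// ltW.
  exact: tailP.
exists M; split => //.
- have [k0 kM kc] : exists2 k, (k < n.+1)%N & M <= f * `|c k|.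
    pose F (k : 'I_n.+1) := beta ^+ k.+1 * `|power_diff n x y k.+1|.
    have [k _ kmax] := @Order.TotalTheory.arg_maxP _ _ _ ord0 predT F isT.
    exists (k : nat) => //; apply: (@le_trans _ _ (F k)).
      by apply: bigmax_le => [|j _]; [rewrite mulr_ge0// ltW|exact: kmax].
    rewrite /c ltn_ord 2!normrM normfV normr_nat (ger0_norm (ltW (bn _))).
    rewrite mulrCA -[leLHS]mulr1 -/(F k) ler_wpM2l//; first by rewrite mulr_ge0// ltW.
    rewrite ler_pdivlMr ?(lt_le_trans ltr01)// mul1r ler_nat.
    by apply: leq_fact; exact: ltn_ord.
  have [i ci] := G_free c t0in (leq_trans kM nK).
  have mainE : \sum_(l < K) c l * G l.+1 t0 0 i = main i.
    rewrite /main (big_ord_widen _ (fun k => c k * G k.+1 t0 0 i) nK) [RHS]big_mkcond/=.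
    by apply: eq_bigr => k _; rewrite /c; case: ifP => //; rewrite mul0r.
  rewrite mainE in ci.
  have h1 : `|main i| <= D + C2 * (beta * M) + C3 * beta ^+ L.+1.
    have -> : main i = Delta 0 i - tail i - (Delta 0 i - (main i + tail i)) by ring.
    apply: (le_trans (ler_normB _ _)); apply: lerD (err i).
    by apply: (le_trans (ler_normB _ _)); apply: lerD.
  have h2 : M <= f / kappa * (D + C2 * (beta * M) + C3 * beta ^+ L.+1).
    apply: (le_trans kc); rewrite -mulrA ler_pM2l// mulrC ler_pdivlMr// mulrC.
    exact: le_trans ci h1.
  (* The second entry of [beta0] is chosen for this: the higher-order terms cost at most half of [M]
     and can be absorbed. *)
  have h3 : f / kappa * (C2 * (beta * M)) <= M / 2.
    rewrite ler_pdivlMr ?mulr_gt0// in bk.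
    have h4 : beta * (f * C2) <= kappa / 2.
      apply: le_trans (_ : beta * (f * (C2 + 1)) <= _); first by rewrite !ler_pM2l// lerDl.
      by rewrite ler_pdivlMr// (le_trans _ bk)//; lra.
    rewrite (_ : _ * _ = beta * (f * C2) / kappa * M); last by ring.
    rewrite mulrC ler_wpM2l// ler_pdivrMr//; apply: (le_trans h4); lra.
  have h5 : M <= Q * (D + C3 * beta ^+ L.+1) by move: h2 h3; rewrite /Q; lra.
  apply: (le_trans h5); apply: le_trans (_ : Q * (1 + C3) * (D + beta ^+ L.+1) <= _).
    rewrite -mulrA ler_wpM2l//; have := mulr_ge0 C30 D0; have := bn L.+1; lra.
  by rewrite ler_wpM2r//; [rewrite addr_ge0// ltW|move: dC2 dC3; lra].
- move=> w w1.
  have dotE : dot w Delta = \sum_(k < n.+1) c k * dot w (G k.+1 t0)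
      + dot w (\row_i tail i) + dot w (\row_i (Delta 0 i - (main i + tail i))).
    rewrite [LHS](_ : _ = dot w (\row_i main i) + dot w (\row_i tail i) +
      dot w (\row_i (Delta 0 i - (main i + tail i)))); last first.
      rewrite /dot -!big_split/=; apply: eq_bigr => i _; rewrite !mxE; ring.
    congr (_ + _ + _); rewrite /dot; under eq_bigr do rewrite mxE mulr_sumr.
    rewrite exchange_big/=; apply: eq_bigr => k _; rewrite mulr_sumr.
    by apply: eq_bigr => i _; rewrite mulrCA.
  rewrite dotE; apply: (le_trans (ler_normD _ _)).
  apply: le_trans (lerD (ler_normD _ _) (lexx _)) _.
  have h1 : `|\sum_(k < n.+1) c k * dot w (G k.+1 t0)| <=
      (\sum_(k < n.+1) `|dot w (G k.+1 t0)|) * M.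
    apply: (le_trans (ler_norm_sum _ _ _)); rewrite mulr_suml; apply: ler_sum => k _.
    by rewrite normrM mulrC ler_wpM2l// cM.
  have h2 : `|dot w (\row_i tail i)| <= d%:R * (C2 * (beta * M)).
    by apply: norm_dot_le => // i; rewrite mxE.
  have h3 : `|dot w (\row_i (Delta 0 i - (main i + tail i)))| <= d%:R * (C3 * beta ^+ L.+1).
    by apply: norm_dot_le => // i; rewrite mxE.
  have bM : 0 <= beta * M by rewrite mulr_ge0// ltW.
  have h4 := mulr_ge0 (addr_ge0 (addr_ge0 ler01 QC) dC3) bM.
  have h5 := mulr_ge0 (addr_ge0 (addr_ge0 ler01 QC) dC2) (ltW (bn L.+1)).
  move: h1 h2 h3 h4 h5; rewrite !mulrDl !mul1r -!mulrA; lra.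
Qed.

End curve_differences.

Lemma nat_large (R : realType) (x : R) : 0 < x ->
  exists2 b0 : nat, (0 < b0)%N & forall b : nat, (b0 <= b)%N -> 0 < (b%:R : R)^-1 <= x.
Proof.
move=> x0; exists (Num.truncn x^-1).+1 => // b b0b.
have bx : x^-1 <= b%:R :> R.
  by apply: (le_trans (ltW (truncnS_gt _))); rewrite ler_nat.
have b1 : 0 < b%:R :> R by rewrite (lt_le_trans _ bx)// invr_gt0.
by rewrite invr_gt0 b1/= -[leRHS]invrK lef_pV2// posrE// invr_gt0.
Qed.

Lemma finite_argmax (R : realDomainType) (T : finType) (i0 : T) (F : T -> R) :
  exists i, forall j, F j <= F i.
Proof.
have [i _ imax] := @Order.TotalTheory.arg_maxP _ _ _ i0 predT F isT.
by exists i => j; exact: imax.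
Qed.

(** * Oscillation for pairs with a large difference *)

Section pair_kernel.
Context {R : realType} (d : nat).
Variables (G : nat -> R -> 'rV[R]_d) (K : nat) (kappa : R) (Bd : nat -> R).
Hypothesis G_derive : forall l i (t : R), 0 <= t <= 1 ->
  is_derive t 1 (fun s => G l s 0 i) (G l.+1 t 0 i).
Hypothesis G_bounded : forall l i (t : R), 0 <= t <= 1 -> `|G l t 0 i| <= Bd l.
Hypothesis kappa_gt0 : 0 < kappa.
Hypothesis G_free : forall (t : R) (c : nat -> R) j, 0 <= t <= 1 -> (j < K)%N ->
  exists i, kappa * `|c j| <= `|\sum_(l < K) c l * G l.+1 t 0 i|.

Definition tuple_difference n (t0 beta : R) (x y : nat -> R) : 'rV[R]_d :=
  \sum_(j < n.+1) (G 0 (t0 + beta * x j) - G 0 (t0 + beta * y j)).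

(** Dividing by [eps] converts the fixed threshold of the cutoff into near-orthogonality at level
    [eps]. *)
Definition frame n (eps t0 : R) (k : 'I_n.+1) : 'rV[R]_d := eps^-1 *: G k.+1 t0.

(** Divided by its largest coordinate [M0], the difference becomes a unit frequency with parameter
    [r * M0 >= b], so each integration by parts gains a factor [b]. The required bound 1/2 on its
    component along [w] splits in two quarters: one from [eps] being small, one from [b] being
    large. *)
Lemma pair_kernel n A P : (1 < d)%N -> (n < K)%N ->
  exists2 eps0 : R, 0 < eps0 & forall eps : R, 0 < eps <= eps0 ->
  exists (C : R) (b0 : nat), [/\ 0 <= C, (0 < b0)%N &
  forall (b : nat) (r t0 : R) (al : nat -> R) (l : R) (x y : nat -> R) j,
    (b0 <= b)%N -> 0 < r <= (2 * b%:R) ^+ A -> 0 <= t0 -> t0 + b%:R^-1 <= 1 ->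
    separated n al l x y ->
    let D := tuple_difference n t0 b%:R^-1 x y in
    b%:R / r <= `|D 0 j| ->
    (`|\int[lebesgue_rV R d]_z (Num.max 0 (cutoff (frame (n := n) eps t0) z) ^+ P.+3 *
       cos (r * dot (normalize z) D))%:E| <= (C / b%:R ^+ P)%:E)%E].
Proof.
move=> d1 nK; have d0 := ltnW d1.
have [C0 [beta0 [C01 beta00 HC]]] :=
  difference_bounds G_derive G_bounded kappa_gt0 G_free A d0 nK.
have C0pos : 0 < C0 := lt_le_trans ltr01 C01.
have B0 l : 0 <= Bd l.
  apply: (Bd_ge0 G_bounded (t := 0)) => //; by rewrite lexx ler01.
pose E := 1 + 2 ^+ A : R.
have E1 : 1 <= E by rewrite lerDl exprn_ge0.
have E0 : 0 < E := lt_le_trans ltr01 E1.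
exists (1 / (8 * n.+1%:R * (C0 * E))).
  by rewrite divr_gt0// !mulr_gt0.
move=> eps /andP[eps0 epsle].
have [C CP0 CP] := @sphere_oscillatory_le R d n.+1 (eps^-1 * \sum_(l < n.+2) Bd l) P d1.
pose q := 4 * (C0 ^+ 2 * E + C0 * E); have q0 : 0 < q.
  by rewrite mulr_gt0// addr_gt0// mulr_gt0// exprn_gt0.
have beta10 : 0 < Num.min beta0 (Num.min 1 q^-1) by rewrite !lt_min beta00 ltr01/= invr_gt0.
have [b0 b00 b0P] := nat_large beta10.
exists C, b0; split => // b r t0 al l x y j b0b /andP[r0 rle] t00 tb sep D Dj.
have := b0P _ b0b; set beta := b%:R^-1 in D Dj tb *; rewrite !le_min.
case/and4P => bet0 betb bet1 betq.
have b1 : 0 < b%:R :> R by rewrite -invr_gt0.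
have [j0 jmax] := finite_argmax j (fun i => `|D 0 i|).
pose M0 : R := `|D 0 j0|; have {}jmax i : `|D 0 i| <= M0 := jmax i.
have M0r : b%:R / r <= M0 by rewrite (le_trans Dj)// jmax.
have M00 : 0 < M0 by rewrite (lt_le_trans _ M0r)// divr_gt0.
have t0in : 0 <= t0 <= 1 by rewrite t00 (le_trans _ tb)// lerDl ltW.
pose D' := M0^-1 *: D.
have D'1 i : `|D' 0 i| <= 1.
  by rewrite mxE normrM ger0_norm ?invr_ge0 ?(ltW M00)// mulrC ler_pdivrMr// mul1r jmax.
have DE z : r * dot (normalize z) D = r * M0 * dot (normalize z) D' + 0.
  rewrite addr0 /dot -mulrA; congr (_ * _); rewrite mulr_sumr; apply: eq_bigr => i _.
  rewrite (_ : D' 0 i = M0^-1 * D 0 i); last by rewrite mxE.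
  by field; rewrite gt_eqF.
under eq_integral do rewrite DE.
have brM : b%:R <= r * M0 by rewrite [leRHS]mulrC -ler_pdivrMr.
have rM0 : 0 < r * M0 by rewrite mulr_gt0.
apply: (@le_trans _ _ (C / (r * M0) ^+ P)%:E); last first.
  rewrite lee_fin ler_wpM2l// lef_pV2 ?posrE ?exprn_gt0//.
  by rewrite lerXn2r// nnegrE ltW.
apply: (CP _ D' j0) => //.
- move=> k i; rewrite mxE normrM (ger0_norm (ltW _)) ?invr_gt0//.
  rewrite ler_wpM2l ?invr_ge0 ?(ltW eps0)// (le_trans (G_bounded k.+1 i t0in))//.
  rewrite (bigD1 (lift ord0 k))//= /bump/= add1n lerDl.
  by apply: sumr_ge0.
- by rewrite mxE normrM ger0_norm ?invr_ge0 ?(ltW M00)// -/M0 mulVf// gt_eqF.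
move=> w w1 wV.
have wi i : `|w 0 i| <= 1 by rewrite -w1; exact: coord_le_enorm.
have wG k : (k < n.+1)%N -> `|dot w (G k.+1 t0)| <= 2 * eps.
  move=> kn; have : dot w (frame eps t0 (Ordinal kn)) ^+ 2 <= 4.
    apply: (@le_trans _ _ (5 / 2)); last by lra.
    apply: le_trans (ltW wV); rewrite (bigD1 (Ordinal kn))//= lerDl.
    by apply: sumr_ge0 => i _; exact: sqr_ge0.
  have -> : dot w (frame eps t0 (Ordinal kn)) = eps^-1 * dot w (G k.+1 t0).
    by rewrite /dot mulr_sumr; apply: eq_bigr => i _; rewrite mxE mulrCA.
  rewrite -[4](_ : 2 ^+ 2 = _); last by ring.
  rewrite -ler_sqrt ?exprn_ge0// !sqrtr_sqr normrM ger0_norm ?invr_ge0 ?(ltW eps0)//.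
  by rewrite (ger0_norm (ler0n _ 2)) mulrC ler_pdivrMr.
have bb : 0 < beta <= beta0 by rewrite bet0.
have [M [M_0 _ MC Mw]] := HC beta t0 al l x y M0 bb t00 tb sep (jmax).
have {}Mw := Mw w wi; rewrite -/(tuple_difference n t0 beta x y) -/D in Mw.
(* The [A] additional Taylor orders serve here: [beta^A <= 2^A / r], and [1 / r = beta * (b / r)] is
   at most [beta * M0]. *)
have betL : beta ^+ (n.+1 + A).+1 <= 2 ^+ A * beta * M0.
  apply: (@le_trans _ _ (beta ^+ A)).
    by rewrite ler_wiXn2l// ?(ltW bet0)// -addSn leq_addl.
  apply: (@le_trans _ _ (2 ^+ A * beta * (b%:R / r))); last first.
    by rewrite ler_pM2l// mulr_gt0// exprn_gt0.
  rewrite (_ : _ * (_ / _) = 2 ^+ A / r); last first.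
    by rewrite /beta; field; rewrite !gt_eqF.
  rewrite ler_pdivlMr// (le_trans (ler_wpM2l _ rle))// ?exprn_ge0 ?(ltW bet0)//.
  by rewrite -exprMn mulrCA mulVf ?gt_eqF// mulr1.
have two : 0 < 2 ^+ A :> R by rewrite exprn_gt0.
have ME : M <= C0 * E * M0.
  apply: (le_trans MC); rewrite -mulrA ler_pM2l// /E mulrDl mul1r lerD2l.
  apply: (le_trans betL); rewrite -mulrA ler_pM2l// -[leRHS]mul1r.
  by rewrite ler_pM2r.
have dotD' : dot w D' = M0^-1 * dot w D.
  by rewrite /dot mulr_sumr; apply: eq_bigr => i _; rewrite mxE mulrCA.
rewrite dotD' normrM ger0_norm ?invr_ge0 ?(ltW M00)// mulrC ler_pdivrMr//.
apply: (le_trans Mw).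
have S : \sum_(k < n.+1) `|dot w (G k.+1 t0)| <= n.+1%:R * (2 * eps).
  rewrite -[n.+1 in leRHS]card_ord mulr_natl -sumr_const; apply: ler_sum => k _; exact: wG.
have h1 : (\sum_(k < n.+1) `|dot w (G k.+1 t0)| + C0 * beta) * M <=
    (n.+1%:R * (2 * eps) + C0 * beta) * (C0 * E * M0).
  apply: ler_pM => //; last by rewrite lerD2r.
  by rewrite addr_ge0 ?sumr_ge0// mulr_ge0// ltW.
have h2 : C0 * beta ^+ (n.+1 + A).+1 <= C0 * E * beta * M0.
  rewrite -2!mulrA ler_pM2l// (le_trans betL)// -mulrA ler_pM2r ?mulr_gt0//.
  by rewrite lerDr.
apply: (le_trans (lerD h1 h2)).
have h3 : n.+1%:R * (2 * eps) * (C0 * E) <= 1 / 4.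
  move: epsle; rewrite ler_pdivlMr ?mulr_gt0//; lra.
have h4 : (C0 ^+ 2 * E + C0 * E) * beta <= 1 / 4.
  move: betq; rewrite -[q^-1]mul1r ler_pdivlMr// /q; lra.
have -> : (n.+1%:R * (2 * eps) + C0 * beta) * (C0 * E * M0) + C0 * E * beta * M0 =
   (n.+1%:R * (2 * eps) * (C0 * E) + (C0 ^+ 2 * E + C0 * E) * beta) * M0 by ring.
by rewrite ler_pM2r//; lra.
Qed.

End pair_kernel.

Section grid_points.
Context {R : realType}.

(** Positions are relative to the interval [[u / b, (u + 1) / b]] rescaled to unit length: point
    number [t j] of the descendant [v * b + f j] of generation [m + 1]. *)
Definition grid_point (b N m v n : nat) (f : {ffun 'I_n.+1 -> 'I_b})
    (t : {ffun 'I_n.+1 -> 'I_(b ^ (N - m.+1))}) (j : nat) : R :=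
  ((v * b + f (inord j)) * b ^ (N - m.+1) + t (inord j))%:R / (b ^ N)%:R.

Lemma grid_point_separated b N m v n (f : {ffun 'I_n.+1 -> 'I_b}) t s k :
  (0 < b)%N -> (m < N)%N -> (v < b ^ m)%N -> spread f -> (k <= n)%N ->
  separated k (fun j => ((v * b + f (inord j)) * b ^ (N - m.+1))%:R / (b ^ N)%:R)
    ((b ^ m.+1)%:R^-1 : R) (grid_point (N := N) (m := m) v f t)
    (grid_point (N := N) (m := m) v f s).
Proof.
move=> b0 mN vb sp kn; set M := (b ^ (N - m.+1))%N.
have bN : (b ^ N = b ^ m.+1 * M)%N by rewrite -expnD subnKC.
have M0 : (0 < M)%N by rewrite expn_gt0 b0.
have bm0 : (0 < b ^ m.+1)%N by rewrite expn_gt0 b0.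
have bN0 : 0 < (b ^ N)%:R :> R by rewrite ltr0n expn_gt0 b0.
have lE : (b ^ m.+1)%:R^-1 = M%:R / (b ^ N)%:R :> R.
  by rewrite bN natrM; field; rewrite !pnatr_eq0 -!lt0n bm0 M0.
rewrite lE; split => //.
- by rewrite divr_gt0// ltr0n.
- rewrite -mulrDl ler_pdivrMr// mul1r -natrD ler_nat -mulSnr bN leq_pmul2r//.
  by have := ltn_ord (f (inord k)); move: vb; rewrite expnS; set x := (f _ : nat); nia.
- move=> i ik; rewrite mulrA -mulrDl ler_pM2r ?invr_gt0// -natrM -natrD ler_nat.
  have := implyP (forallP (forallP sp (inord i)) (inord i.+1)).
  have i1n : (i.+1 < n.+1)%N := leq_trans ik kn.
  rewrite !inordK ?(ltnW i1n)// => /(_ (leqnn _)) fi; by rewrite -mulnDl leq_pmul2r// -addnA leq_add2l fi.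
- move=> i ik; split; rewrite -mulrDl !ler_pM2r ?invr_gt0// -natrD !ler_nat leq_addr/=.
    by rewrite leq_add2l ltnW.
  by rewrite leq_add2l ltnW.
Qed.

End grid_points.

(** * Counting pairs with a small difference *)

Section near_count.
Context {R : realType} (d : nat).
Variables (G : nat -> R -> 'rV[R]_d) (K : nat) (kappa : R) (Bd : nat -> R).
Hypothesis G_derive : forall l i (t : R), 0 <= t <= 1 ->
  is_derive t 1 (fun s => G l s 0 i) (G l.+1 t 0 i).
Hypothesis G_bounded : forall l i (t : R), 0 <= t <= 1 -> `|G l t 0 i| <= Bd l.
Hypothesis kappa_gt0 : 0 < kappa.
Hypothesis G_free : forall (t : R) (c : nat -> R) j, 0 <= t <= 1 -> (j < K)%N ->
  exists i, kappa * `|c j| <= `|\sum_(l < K) c l * G l.+1 t 0 i|.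

(** Coordinates are counted from the last one down. Once those after [i] agree they drop out of the
    power differences, and the distance estimate for the first [i + 1] points costs only [l^-i]. The
    product over [i] has exponent [0 + ... + n], which is the binomial in the bound. *)
Lemma near_count n A : (0 < d)%N -> (n < K)%N ->
  exists (C : R) (b0 : nat), [/\ 0 <= C, (0 < b0)%N &
  forall (b N m v : nat) (r t0 : R) (f : {ffun 'I_n.+1 -> 'I_b})
    (t : {ffun 'I_n.+1 -> 'I_(b ^ (N - m.+1))}),
    (b0 <= b)%N -> 0 < r <= (2 * b%:R) ^+ A -> r <= (b ^ N)%:R ->
    0 <= t0 -> t0 + b%:R^-1 <= 1 ->
    (m < N)%N -> (v < b ^ m)%N -> spread f ->
    (#|[set s : {ffun 'I_n.+1 -> 'I_(b ^ (N - m.+1))} | [forall i,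
        `|tuple_difference G n t0 b%:R^-1 (grid_point v f t) (grid_point v f s) 0 i|
        < b%:R / r] ]%SET|%:R <=
     C * ((b ^ (N + n.+2))%:R / r) ^+ n.+1 * (b ^ (m.+1 * 'C(n.+1, 2)))%:R)].
Proof.
move=> d0 nK.
have [C0 [beta0 [C01 beta00 HC]]] :=
  difference_bounds G_derive G_bounded kappa_gt0 G_free A d0 nK.
have C0pos : 0 < C0 := lt_le_trans ltr01 C01.
pose C1 := C0 * (2 + 2 ^+ A).
have C11 : 1 <= C1.
  have h2 : 1 <= 2 + 2 ^+ A :> R by rewrite -[leLHS]addr0 lerD ?exprn_ge0// ler1n.
  by rewrite (le_trans C01)// -[leLHS]mulr1 ler_pM2l.
have C10 : 0 < C1 := lt_le_trans ltr01 C11.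
pose C2 : R := 2 * (4 ^+ n * n.+2%:R * C1).
have C20 : 0 <= C2 by rewrite !mulr_ge0// ltW.
have beta10 : 0 < Num.min beta0 1 by rewrite !lt_min beta00 ltr01.
have [b0 b00 b0P] := nat_large beta10.
exists (C2 ^+ n.+1), b0; split => //; first by rewrite exprn_ge0.
move=> b N m v r t0 f t b0b /andP[r0 rle] rN t00 tb mN vb sp.
have b_gt0 : (0 < b)%N := leq_trans b00 b0b.
have := b0P _ b0b; set beta := b%:R^-1 in tb *; rewrite le_min => /and3P[bet0 betb bet1].
have b1 : 0 < b%:R :> R by rewrite -invr_gt0.
set Y := [set _ | _]%SET.
have bN0 : 0 < (b ^ N)%:R :> R by rewrite ltr0n expn_gt0 b_gt0.
(* [Z i] bounds the spread of coordinate [i] in grid units. It is at least 1 because [r <= b^N], so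
   passing to the integer count [B i + 1] only costs the factor 2 in [C2]. *)
pose Z i : R := 4 ^+ n * n.+2%:R * C1 * ((b ^ (N + n.+2))%:R / r) * ((b ^ m.+1)%:R ^+ i).
pose B i := Num.truncn (Z i).
have Z1 i : 1 <= Z i.
  have h1 : 1 <= (b ^ (N + n.+2))%:R / r.
    rewrite ler_pdivlMr// mul1r (le_trans rN)// ler_nat.
    by rewrite leq_pexp2l// leq_addr.
  have h2 : 1 <= (b ^ m.+1)%:R ^+ i :> R by rewrite exprn_ege1// ler1n expn_gt0 b_gt0.
  have h3 : 1 <= 4 ^+ n :> R by rewrite exprn_ege1// ler1n.
  have h4 : 1 <= n.+2%:R :> R by rewrite ler1n.
  exact: mulr_ege1 (mulr_ege1 (mulr_ege1 (mulr_ege1 h3 h4) C11) h1) h2.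
have key : (#|Y| <= \prod_(i < n.+1) (B i).+1)%N.
  apply: (@card_triangular _ (fun i (s : {ffun 'I_n.+1 -> 'I_(b ^ (N - m.+1))}) => (s (inord i) : nat))).
    move=> y y' _ _ yy; apply/ffunP => i; apply/val_inj.
    by have := yy i (ltn_ord i); rewrite inord_val.
  move=> i y y' iN; rewrite !finset.inE => /forallP Yy /forallP Yy' agree.
  have sepn := grid_point_separated (R := R) y y' b_gt0 mN vb sp (leqnn n).
  have sepi := grid_point_separated (R := R) y y' b_gt0 mN vb sp (iN : (i <= n)%N).
  (* Two tuples near the same [t] are near each other, by the triangle inequality; power sums are
     compared between them and [t] no longer matters. *)
  have D2 k : `|tuple_difference G n t0 beta (grid_point v f y) (grid_point v f y') 0 k|
      <= 2 * (b%:R / r).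
    have -> : tuple_difference G n t0 beta (grid_point v f y) (grid_point v f y') =
       tuple_difference G n t0 beta (grid_point v f t) (grid_point v f y') -
       tuple_difference G n t0 beta (grid_point v f t) (grid_point v f y).
      rewrite /tuple_difference -sumrB; apply: eq_bigr => j _.
      by rewrite opprB [RHS]addrC addrA subrK.
    rewrite !mxE mulr_natl mulr2n; apply: (le_trans (ler_normB _ _)).
    by apply: lerD; apply: ltW.
  have bb : 0 < beta <= beta0 by rewrite bet0.
  have [M [M_0 PM MC _]] := HC beta t0 _ _ _ _ _ bb t00 tb sepn D2.
  have betL : beta ^+ (n.+1 + A).+1 <= 2 ^+ A * (b%:R / r).
    apply: (@le_trans _ _ (beta ^+ A)).
      by rewrite ler_wiXn2l// ?(ltW bet0)// -addSn leq_addl.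
    rewrite mulrA ler_pdivlMr// (le_trans (ler_wpM2l _ rle))// ?exprn_ge0 ?(ltW bet0)//.
    rewrite -exprMn mulrCA mulVf ?gt_eqF// mulr1.
    by rewrite -[leLHS]mulr1 ler_wpM2l ?exprn_ge0// ler1n.
  have MC1 : M <= C1 * (b%:R / r).
    apply: (le_trans MC); rewrite /C1 -mulrA ler_pM2l//.
    by rewrite [leRHS]mulrDl lerD2l.
  have PD k : (1 <= k <= i.+1)%N ->
      `|power_diff i (grid_point v f y) (grid_point v f y') k| <=
      C1 * (b%:R ^+ n.+2 / r).
    move=> /andP[k1 ki].
    have -> : power_diff i (grid_point v f y) (grid_point v f y') k =
        power_diff n (grid_point v f y) (grid_point v f y') k :> R.
      rewrite /power_diff (big_ord_widen _ (fun j => grid_point v f y j ^+ k -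
        grid_point v f y' j ^+ k : R) iN) big_mkcond/=.
      apply: eq_bigr => j _; case: ltnP => // ij.
      by rewrite /grid_point (agree j) ?subrr// ij ltn_ord.
    have kn : (1 <= k <= n.+1)%N by rewrite k1 (leq_trans ki).
    have := PM _ kn; rewrite -ler_pdivlMl ?exprn_gt0// => /le_trans; apply.
    rewrite -exprVn invrK.
    apply: (@le_trans _ _ (b%:R ^+ n.+1 * (C1 * (b%:R / r)))).
      apply: ler_pM => //.
      by case/andP: kn => _ kn; rewrite ler_weXn2l// ler1n.
    by rewrite le_eqVlt; apply/orP; left; apply/eqP; rewrite [b%:R ^+ n.+2]exprSr; ring.
  have := separated_dist_le sepi (leqnn i) PD.
  rewrite /grid_point -mulrBl normrM normfV normr_nat => dist.
  have {dist} : `|(((v * b + f (inord i)) * b ^ (N - m.+1) + y (inord i))%:R -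
       ((v * b + f (inord i)) * b ^ (N - m.+1) + y' (inord i))%:R : R)| <= Z i.
    have bm0 : 0 < (b ^ m.+1)%:R :> R by rewrite ltr0n expn_gt0 b_gt0.
    move: dist; rewrite -ler_pdivlMr ?exprn_gt0 ?divr_gt0 ?invr_gt0// ler_pdivrMr//.
    move/le_trans; apply.
    rewrite /Z expnD natrM (natrX _ b n.+2).
    rewrite (_ : _ / _ * _ = (2 ^+ i * 2 ^+ i) * i.+2%:R * C1 * ((b ^ N)%:R * b%:R ^+ n.+2 / r) *
       (b ^ m.+1)%:R ^+ i); last first.
      rewrite -invfM exprVn invrK exprMn; ring.
    rewrite -exprMn -natrM.
    have nn : 0 <= C1 * ((b ^ N)%:R * b%:R ^+ n.+2 / r) * (b ^ m.+1)%:R ^+ i.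
      by apply/ltW; do ?[apply: exprn_gt0|apply: divr_gt0|apply: mulr_gt0].
    have h : (2 * 2)%:R ^+ i * i.+2%:R <= 4 ^+ n * n.+2%:R :> R.
      by apply: ler_pM; rewrite ?exprn_ge0 ?ler_weXn2l ?ler1n ?ler_nat ?ltnS.
    by have := ler_wpM2r nn h; rewrite !mulrA.
  rewrite !natrD opprD addrACA subrr add0r => yy'.
  rewrite -leq_subLR truncn_ge_nat; last by rewrite (le_trans ler01)// Z1.
  have [le|lt] := leqP (y (inord i)) (y' (inord i)).
    by rewrite (eqP le) (le_trans ler01)// Z1.
  by rewrite natrB ?(ltnW lt)// (le_trans (ler_norm _)).
apply: (@le_trans _ _ (\prod_(i < n.+1) (B i).+1)%:R); first by rewrite ler_nat.
rewrite natr_prod (@le_trans _ _ (\prod_(i < n.+1) (C2 * ((b ^ (N + n.+2))%:R / r) * (b ^ m.+1)%:R ^+ i)))//.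
  apply: ler_prod => i _; rewrite ler0n/= -natr1.
  have BZ : (B i)%:R <= Z i by rewrite truncn_le// (le_trans ler01)// Z1.
  have := lerD BZ (Z1 i); rewrite -mulr2n -mulr_natl => /le_trans; apply.
  by rewrite -[leLHS]mulr_natl /Z /C2 !mulrA.
rewrite big_split/= prodr_const card_ord -exprMn; rewrite le_eqVlt; apply/orP; left; apply/eqP; congr (_ * _).
by rewrite -expr_sum -bin2_sum big_mkord -natrX -expnM.
Qed.

End near_count.

(** * Square-function bounds for products of blocks *)

Section exponential_sums.
Context {R : realType}.
Local Open Scope complex_scope.
Implicit Types (c th : R).

Lemma normc_sqr (z : R[i]) : Normc.normc z ^+ 2 = complex.Re z ^+ 2 + complex.Im z ^+ 2.
Proof. by case: z => x y /=; rewrite sqr_sqrtr// addr_ge0 ?sqr_ge0. Qed.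

Lemma normc_ge0 (z : R[i]) : 0 <= Normc.normc z.
Proof. by case: z => x y; exact: sqrtr_ge0. Qed.

Lemma normc_triangle (z t : R[i]) : Normc.normc (z + t) <= Normc.normc z + Normc.normc t.
Proof. exact: le_normcD. Qed.

Lemma normc_sum I (s : seq I) (P : pred I) (F : I -> R[i]) :
  Normc.normc (\sum_(i <- s | P i) F i) <= \sum_(i <- s | P i) Normc.normc (F i).
Proof.
elim/big_ind2: _ => //; first by rewrite /= expr0n addr0 sqrtr0.
by move=> z x t y zx ty; apply: (le_trans (normc_triangle _ _)); exact: lerD.
Qed.

Lemma Re_wave c th : complex.Re (c%:C * expi th) = c * cos th.
Proof. by rewrite /= mul0r subr0. Qed.

Lemma Im_wave c th : complex.Im (c%:C * expi th) = c * sin th.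
Proof. by rewrite /= mul0r addr0. Qed.

Lemma normc_wave c th : Normc.normc (c%:C * expi th) = `|c|.
Proof.
have : Normc.normc (c%:C * expi th) ^+ 2 = `|c| ^+ 2.
  rewrite normc_sqr Re_wave Im_wave !exprMn -mulrDr cos2Dsin2 mulr1.
  by rewrite real_normK// num_real.
by move/eqP; rewrite eqrXn2// ?normc_ge0// => /eqP.
Qed.

Lemma expiD th1 th2 : expi (th1 + th2) = expi th1 * expi th2 :> R[i].
Proof.
by rewrite /expi cosD sinD; apply/eqP; rewrite eq_complex/= eqxx/= addrC eqxx.
Qed.

Lemma expi0 : expi 0 = 1 :> R[i].
Proof. by rewrite /expi cos0 sin0. Qed.

Lemma prod_wave (I : finType) (c th : I -> R) :
  \prod_i ((c i)%:C * expi (th i)) = (\prod_i c i)%:C * expi (\sum_i th i).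
Proof.
rewrite big_split/=; congr (_ * _); first by rewrite rmorph_prod.
elim/big_ind2: _ => //; first by rewrite expi0.
by move=> x1 x2 y1 y2 -> ->; rewrite expiD.
Qed.

Lemma sqr_sum_wave (I : finType) (c th : I -> R) :
  Normc.normc (\sum_i (c i)%:C * expi (th i)) ^+ 2 =
  \sum_i \sum_j c i * c j * cos (th i - th j).
Proof.
rewrite normc_sqr !raddf_sum.
rewrite (eq_bigr _ (fun i _ => Re_wave (c i) (th i))).
rewrite [X in _ + X ^+ 2](eq_bigr _ (fun i _ => Im_wave (c i) (th i))).
rewrite !expr2 !mulr_suml -big_split/=; apply: eq_bigr => i _.
rewrite !mulr_sumr -big_split/=; apply: eq_bigr => j _.
by rewrite cosB; ring.
Qed.

End exponential_sums.

Section blocks.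
Context {R : realType} (d : nat).
Variables (G : nat -> R -> 'rV[R]_d) (chi : R -> R).
Local Open Scope complex_scope.

Definition wave_sum (r h : R) (w : 'rV[R]_d) (p q : nat) : R[i] :=
  \sum_(p <= g < q) (chi (g%:R * h))%:C * expi (- (r * dot w (G 0 (g%:R * h)))).

(* The part of the sum over the grid of step [b ^- N.+1] that lies in the
   [v]-th [b]-adic interval of generation [m] of the interval
   [u / b, (u + 1) / b], normalized by the number of its grid points at [m = 0]. *)
Definition block b N (r : R) u (w : 'rV[R]_d) m v : R :=
  Normc.normc (wave_sum r (b ^ N.+1)%:R^-1 w
    (u * b ^ N + v * b ^ (N - m)) (u * b ^ N + v.+1 * b ^ (N - m))) / (b ^ N)%:R.

Lemma block_ge0 b N r u w m v : 0 <= block b N r u w m v.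
Proof. by rewrite divr_ge0 ?normc_ge0. Qed.

Lemma wave_sum_cat r h w p q s : (p <= q)%N -> (q <= s)%N ->
  wave_sum r h w p s = wave_sum r h w p q + wave_sum r h w q s.
Proof. by move=> pq qs; rewrite /wave_sum (big_cat_nat pq qs). Qed.

Lemma wave_sum_split r h w p M b :
  wave_sum r h w p (p + b * M) = \sum_(c < b) wave_sum r h w (p + c * M) (p + c.+1 * M).
Proof.
elim: b => [|b IH]; first by rewrite big_ord0 /wave_sum mul0n addn0 big_geq.
rewrite big_ord_recr/= -IH -wave_sum_cat ?leq_addr// leq_add2l.
by rewrite leq_mul2r leqnSn orbT.
Qed.

Lemma block_le_sum b N r u w m v : (m < N)%N ->
  block b N r u w m v <= \sum_(c < b) block b N r u w m.+1 (v * b + c).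
Proof.
move=> mN; rewrite /block -mulr_suml ler_wpM2r ?invr_ge0//.
have E : (b ^ (N - m) = b * b ^ (N - m.+1))%N by rewrite -expnS subnSK.
rewrite E (_ : u * b ^ N + v.+1 * _ = u * b ^ N + v * (b * b ^ (N - m.+1)) + b * b ^ (N - m.+1))%N; last by ring.
rewrite wave_sum_split.
apply: (le_trans (normc_sum _ _ _)); apply: ler_sum => c _.
rewrite (_ : _ + _ = u * b ^ N + (v * b + c) * b ^ (N - m.+1))%N; last by ring.
by rewrite (_ : u * b ^ N + _ + _ = u * b ^ N + (v * b + c).+1 * b ^ (N - m.+1))%N; last by ring.
Qed.

Lemma wave_sum_le X r h w p q : (forall s, `|chi s| <= X) -> (p <= q)%N ->
  Normc.normc (wave_sum r h w p q) <= X * (q - p)%:R.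
Proof.
move=> chiX pq; apply: (le_trans (normc_sum _ _ _)).
rewrite (@le_trans _ _ (\sum_(p <= g < q) X))//.
  by apply: ler_sum => g _; rewrite normc_wave.
by rewrite sumr_const_nat mulr_natr.
Qed.

Lemma block_le X b N r u w m v : (0 < b)%N -> (forall s, `|chi s| <= X) -> (m <= N)%N ->
  block b N r u w m v <= X / (b ^ m)%:R.
Proof.
move=> b0 chiX mN; rewrite /block ler_pdivrMr ?ltr0n ?expn_gt0 ?b0//.
apply: (le_trans (wave_sum_le _ _ _ chiX _)).
  by rewrite leq_add2l leq_mul2r leqnSn orbT.
rewrite subnDl -mulnBl subSnn mul1n -(subnKC mN) expnD natrM subnKC//.
rewrite mulrA mulfVK// pnatr_eq0 expn_eq0; case: (b) b0 => //.
Qed.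

Definition tuple_weight n (t0 beta : R) (x : nat -> R) : R :=
  \prod_(i < n.+1) chi (t0 + beta * x i).

(** Multiplying the waves of the [n + 1] pieces adds their phases; the squared modulus of the
    resulting sum over tuples is a sum of cosines of phase differences. *)
Lemma block_prod_sqr b N r u w m v n (f : {ffun 'I_n.+1 -> 'I_b}) : (0 < b)%N -> (m < N)%N ->
  \prod_(i < n.+1) block b N r u w m.+1 (v * b + f i) ^+ 2 =
  (b ^ N)%:R ^- 2 ^+ n.+1 * \sum_(t : {ffun 'I_n.+1 -> 'I_(b ^ (N - m.+1))})
   \sum_(s : {ffun 'I_n.+1 -> 'I_(b ^ (N - m.+1))})
    tuple_weight n (u%:R / b%:R) b%:R^-1 (grid_point v f t) *
    tuple_weight n (u%:R / b%:R) b%:R^-1 (grid_point v f s) *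
    cos (r * dot w (tuple_difference G n (u%:R / b%:R) b%:R^-1
                      (grid_point v f t) (grid_point v f s))).
Proof.
move=> b0 mN; set M := (b ^ (N - m.+1))%N.
have b_neq0 : b%:R != 0 :> R by rewrite pnatr_eq0 -lt0n.
have bN_neq0 : (b ^ N)%:R != 0 :> R by rewrite pnatr_eq0 -lt0n expn_gt0 b0.
pose pt i (t : 'I_M) : R := ((v * b + f i) * M + t)%:R / (b ^ N)%:R.
pose time i t : R := u%:R / b%:R + b%:R^-1 * pt i t.
have gridE (t : {ffun 'I_n.+1 -> 'I_M}) (i : 'I_n.+1) : grid_point v f t i = pt i (t i).
  by rewrite /grid_point inord_val.
have waveE i : wave_sum r (b ^ N.+1)%:R^-1 w (u * b ^ N + (v * b + f i) * M)
    (u * b ^ N + (v * b + f i).+1 * M) =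
   \sum_(t < M) (chi (time i t))%:C * expi (- (r * dot w (G 0 (time i t)))).
  rewrite /wave_sum mulSn [X in \sum_(_ <= g < X) _]addnCA -[X in \sum_(X <= _ < _) _]add0n.
  rewrite big_addn addnK big_mkord; apply: eq_bigr => t _.
  suff -> : (t + (u * b ^ N + (v * b + f i) * M))%:R / (b ^ N.+1)%:R = time i t by [].
  rewrite /time /pt expnS !natrD !natrM; field.
  by rewrite b_neq0 bN_neq0.
under eq_bigr do rewrite /block waveE expr_div_n -exprVn.
rewrite big_split/= prodr_const card_ord mulrC; congr (_ * _); first by rewrite exprVn.
rewrite prodrXl -(big_morph _ (@ComplexField.Normc.normcM R) (@ComplexField.Normc.normc1 R)).
rewrite bigA_distr_bigA/=.
under eq_bigr do rewrite prod_wave.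
rewrite sqr_sum_wave; apply: eq_bigr => t _; apply: eq_bigr => s _.
congr (_ * _ * _).
- by rewrite /tuple_weight; apply: eq_bigr => i _; rewrite gridE.
- by rewrite /tuple_weight; apply: eq_bigr => i _; rewrite gridE.
rewrite -cosN; congr cos.
rewrite /tuple_difference.
have -> : dot w (\sum_(j < n.+1) (G 0 (u%:R / b%:R + b%:R^-1 * grid_point v f t j) -
      G 0 (u%:R / b%:R + b%:R^-1 * grid_point v f s j))) =
   \sum_(j < n.+1) (dot w (G 0 (time j (t j))) - dot w (G 0 (time j (s j)))).
  rewrite /dot; under [RHS]eq_bigr do rewrite -sumrB.
  rewrite exchange_big/=; apply: eq_bigr => i _; rewrite summxE mulr_sumr.
  by apply: eq_bigr => j _; rewrite !mxE mulrBr !gridE.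
by rewrite !sumrN -!mulr_sumr sumrB; ring.
Qed.

End blocks.

(** * Upper integrals on the sphere *)

Section dominated.
Context {R : realType} (d : nat).
Implicit Types (f g : 'rV[R]_d -> R) (Q : 'rV[R]_d -> measurableTypeR R).

Lemma boxedD Q1 Q2 C1 C2 : boxed Q1 C1 -> boxed Q2 C2 ->
  boxed (fun x => Q1 x + Q2 x : measurableTypeR R) (C1 + C2).
Proof.
move=> [m1 c1 z1] [m2 c2 z2]; split; first exact: measurable_funD.
- by move=> x; rewrite (le_trans (ler_normD _ _))// lerD.
- by move=> x xb; rewrite z1// z2// addr0.
Qed.

Lemma boxedZ c Q C : boxed Q C -> boxed (fun x => c * Q x : measurableTypeR R) (`|c| * C).
Proof.
move=> [m1 c1 z1]; split; first exact: measurable_funM.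
- by move=> x; rewrite normrM ler_wpM2l.
- by move=> x xb; rewrite z1// mulr0.
Qed.

Lemma boxed0 : boxed (fun _ : 'rV[R]_d => 0 : measurableTypeR R) (0 : R).
Proof. by split => // x; rewrite normr0. Qed.

(** An upper bound for the integral through a measurable majorant on the cone. The function [f]
    itself may be defined by cases on the direction, and such bounds add and scale freely. *)
Definition dominated f (B : R) := exists Q C,
  [/\ boxed Q C, forall x, 0 <= Q x, forall x, punctured_ball R d x -> f (normalize x) <= Q x &
      (\int[lebesgue_rV R d]_x (Q x)%:E <= B%:E)%E].

Lemma dominatedS f g B B' : (forall w, enorm w = 1 -> f w <= g w) -> B <= B' ->
  dominated g B -> dominated f B'.
Proof.
move=> fg BB [Q [C [Qb Q0 gQ QB]]]; exists Q, C; split => //.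
  move=> x xb; apply: le_trans (gQ _ xb); apply: fg; apply: enorm_normalize.
  by case/andP: xb => x0 _; rewrite gt_eqF.
by apply: (le_trans QB); rewrite lee_fin.
Qed.

Lemma dominated0 : dominated (fun=> 0) 0.
Proof.
exists (fun=> 0), 0; split => //; first exact: boxed0.
by rewrite integral0_eq.
Qed.

Lemma dominatedD f g B B' : dominated f B -> dominated g B' ->
  dominated (fun w => f w + g w) (B + B').
Proof.
move=> [Q [C [Qb Q0 fQ QB]]] [Q' [C' [Qb' Q0' gQ QB']]].
exists (fun x => Q x + Q' x), (C + C'); split.
- exact: boxedD.
- by move=> x; rewrite addr_ge0.
- by move=> x xb; apply: lerD; [exact: fQ|exact: gQ].
under eq_integral do rewrite EFinD.
rewrite integralD//; first by rewrite EFinD leeD.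
- exact: (boxed_integrable Qb).
- exact: (boxed_integrable Qb').
Qed.

Lemma dominatedZ f B c : 0 <= c -> dominated f B -> dominated (fun w => c * f w) (c * B).
Proof.
move=> c0 [Q [C [Qb Q0 fQ QB]]].
exists (fun x => c * Q x), (`|c| * C); split.
- exact: boxedZ.
- by move=> x; rewrite mulr_ge0.
- by move=> x xb; apply: ler_wpM2l => //; exact: fQ.
under eq_integral do rewrite EFinM.
rewrite integralZl//; last exact: (boxed_integrable Qb).
by rewrite EFinM lee_wpmul2l.
Qed.

Lemma dominated_sum I (s : seq I) (P : pred I) (f : I -> 'rV[R]_d -> R) (B : I -> R) :
  (forall i, P i -> dominated (f i) (B i)) ->
  dominated (fun w => \sum_(i <- s | P i) f i w) (\sum_(i <- s | P i) B i).
Proof.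
move=> fB; elim: s => [|i s IH].
  rewrite big_nil; apply: (dominatedS _ _ dominated0) => // w _.
  by rewrite big_nil.
rewrite big_cons; case: ifPn => Pi.
  apply: (dominatedS _ _ (dominatedD (fB i Pi) IH)) => // w _.
  by rewrite big_cons Pi.
by apply: (dominatedS _ _ IH) => // w _; rewrite big_cons (negbTE Pi).
Qed.

Lemma punctured_ball_box (x : 'rV[R]_d) : punctured_ball R d x -> box x.
Proof.
move=> /andP[_ x1] i; apply: (le_trans (coord_le_enorm _ _)).
by apply: (le_trans x1); rewrite ler1n.
Qed.

Lemma dominated_cst c : 0 <= c -> dominated (fun=> c) (c * 4 ^+ d).
Proof.
move=> c0; exists (fun x => c * \1_(@box R d) x), c.
have b1 : boxed (fun x => \1_(@box R d) x : measurableTypeR R) 1.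
  split.
  - exact: measurable_indic (@measurable_box R d).
  - by move=> x; rewrite indicE; case: (_ \in _); rewrite ?normr1 ?normr0.
  - by move=> x xb; rewrite indicE memNset.
have bc := boxedZ c b1; rewrite ger0_norm// mulr1 in bc; split => //.
- by move=> x; rewrite mulr_ge0.
- move=> x xb; rewrite indicE mem_set ?mulr1//; exact: punctured_ball_box.
under eq_integral do rewrite EFinM.
rewrite integralZl//; last exact: (boxed_integrable b1).
rewrite integral_indic//; last exact: measurable_box.
by rewrite setIT EFinM lee_wpmul2l// -lebesgue_box; exact: lexx.
Qed.

Lemma sphere_integral_dominated (F : 'rV[R]_d -> measurableTypeR R) B :
  measurable_fun setT F -> (forall w, 0 <= F w) -> dominated F B ->
  (\int[sphere_measure R d]_(w in sphere R d) (F w)%:E <= (d%:R * B)%:E)%E.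
Proof.
move=> mF F0 [Q [C [[mQ QC Qz] Q0 FQ QB]]].
apply: (le_trans (sphere_integral_le mF mQ F0 Q0 FQ)).
by rewrite EFinM lee_wpmul2l// lee_fin.
Qed.

Lemma norm_integral_sum_le (T : finType) (c B C : T -> R) (g : T -> 'rV[R]_d -> measurableTypeR R) :
  (forall t, boxed (g t) (C t)) ->
  (forall t, `|\int[lebesgue_rV R d]_x (g t x)%:E| <= (B t)%:E)%E ->
  (`|\int[lebesgue_rV R d]_x (\sum_t c t * g t x)%:E| <= (\sum_t `|c t| * B t)%:E)%E.
Proof.
move=> gb gB.
under eq_integral do rewrite -sumEFin.
rewrite integral_sum//; last first.
  move=> t; have := boxed_integrable (boxedZ (c t) (gb t)); exact.
rewrite -sumEFin; apply: (le_trans (lee_abs_sum _ _ _)); apply: lee_sum => t _.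
under eq_integral do rewrite EFinM.
rewrite integralZl//; last exact: (boxed_integrable (gb t)).
by rewrite abseM EFinM lee_wpmul2l.
Qed.

End dominated.

Ltac nonneg := repeat first [done | apply: addr_ge0 | apply: mulr_ge0 | apply: exprn_ge0
  | rewrite invr_ge0].

Lemma dotZr (R : realType) d (w v : 'rV[R]_d) (c : R) : dot w (c *: v) = c * dot w v.
Proof. by rewrite /dot mulr_sumr; apply: eq_bigr => i _; rewrite mxE mulrCA. Qed.

Section l2_bound.
Context {R : realType} (d : nat).
Variables (G : nat -> R -> 'rV[R]_d) (K : nat) (kappa : R) (Bd : nat -> R).
Hypothesis G_derive : forall l i (t : R), 0 <= t <= 1 ->
  is_derive t 1 (fun s => G l s 0 i) (G l.+1 t 0 i).
Hypothesis G_bounded : forall l i (t : R), 0 <= t <= 1 -> `|G l t 0 i| <= Bd l.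
Hypothesis kappa_gt0 : 0 < kappa.
Hypothesis G_free : forall (t : R) (c : nat -> R) j, 0 <= t <= 1 -> (j < K)%N ->
  exists i, kappa * `|c j| <= `|\sum_(l < K) c l * G l.+1 t 0 i|.
Variables (chi : R -> R) (X : R).
Hypothesis chi_bounded : forall s, `|chi s| <= X.

Let X_ge0 : 0 <= X. Proof. exact: le_trans (normr_ge0 _) (chi_bounded 0). Qed.

Lemma tuple_weight_le n t0 beta x : `|tuple_weight chi n t0 beta x| <= X ^+ n.+1.
Proof.
rewrite /tuple_weight normr_prod -[n.+1 in leRHS]card_ord -prodr_const.
by apply: ler_prod => i _; rewrite normr_ge0 chi_bounded.
Qed.

Lemma measurable_prod_block b N r u m v n (f : {ffun 'I_n.+1 -> 'I_b}) : (0 < b)%N -> (m < N)%N ->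
  measurable_fun setT (fun x : 'rV[R]_d =>
    \prod_(i < n.+1) block G chi b N r u (normalize x) m.+1 (v * b + f i) ^+ 2 : measurableTypeR R).
Proof.
move=> b0 mN; under eq_fun do rewrite block_prod_sqr//.
apply: measurable_funM => //; apply: measurable_sum => t; apply: measurable_sum => s.
apply: measurable_funM => //.
apply: (@measurableT_comp _ _ _ _ _ _ (cos : R -> R)).
  by apply: continuous_measurable_fun; exact: continuous_cos.
by apply: measurable_funM => //; exact: measurable_dot_normalize.
Qed.

Lemma cutoff_ge n (eps : R) (w : 'rV[R]_d) (t0 : R) x : 0 < eps -> w = normalize x ->
  punctured_ball R d x ->
  (forall k : 'I_n.+1, `|dot w (G k.+1 t0)| <= eps / (2 * n.+1%:R)) ->
  1 / 2 <= cutoff (frame G (n := n) eps t0) x.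
Proof.
move=> eps0 -> /andP[x0 x1] wG; rewrite /cutoff.
have e1 : enorm x ^+ 2 <= 1 by rewrite exprn_ile1// ltW.
have S : \sum_(k < n.+1) dot (normalize x) (frame G eps t0 k) ^+ 2 <= 1 / 2.
  apply: (@le_trans _ _ (\sum_(k < n.+1) (1 / (2 * n.+1%:R)))); last first.
    rewrite sumr_const card_ord -[leLHS]mulr_natl.
    by rewrite le_eqVlt; apply/orP; left; apply/eqP; field.
  apply: ler_sum => k _.
  have n1 : 1 <= 2 * n.+1%:R :> R.
    by rewrite -natrM ler1n.
  have h : `|dot (normalize x) (frame G eps t0 k)| <= 1 / (2 * n.+1%:R).
    rewrite /frame dotZr.
    rewrite normrM ger0_norm ?invr_ge0 ?(ltW eps0)// mulrC ler_pdivrMr//.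
    by rewrite mulrAC mul1r; exact: wG.
  rewrite -real_normK ?num_real// expr2 -[leRHS]mulr1; apply: ler_pM => //.
  by rewrite (le_trans h)// ler_pdivrMr ?mul1r ?mulr_gt0.
lra.
Qed.

(** The condition on [w] is majorized by the smooth cutoff and the squares are expanded into pairs
    of tuples. Pairs with difference at least [b / r] in some coordinate are nonstationary; the
    others are bounded trivially and counted. *)
Lemma l2_bound n A P : (1 < d)%N -> (n < K)%N ->
  exists2 eps0 : R, 0 < eps0 & forall eps : R, 0 < eps <= eps0 ->
  exists (C : R) (b0 : nat), [/\ 0 <= C, (0 < b0)%N &
  forall (b N m v u : nat) (r : R) (f : {ffun 'I_n.+1 -> 'I_b}),
    (b0 <= b)%N -> 0 < r <= (2 * b%:R) ^+ A -> r <= (b ^ N)%:R ->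
    (u < b)%N -> (m < N)%N -> (v < b ^ m)%N -> spread f ->
  dominated (fun w =>
    if [forall k : 'I_n.+1, `|dot w (G k.+1 (u%:R / b%:R))| <= eps / (2 * n.+1%:R)]
    then \prod_(i < n.+1) block G chi b N r u w m.+1 (v * b + f i) ^+ 2 else 0)
   (C * ((b ^ (m.+1 * n.+1))%:R^-1 *
      ((b ^ (n.+2 * n.+1))%:R * (b ^ (m.+1 * 'C(n.+1, 2)))%:R / r ^+ n.+1 + (b ^ P)%:R^-1)))].
Proof.
move=> d1 nK; have d0 := ltnW d1.
have [eps0 eps00 Heps] := pair_kernel G_derive G_bounded kappa_gt0 G_free A P d1 nK.
exists eps0 => // eps epsP; have [e0 _] := andP epsP.
have [C1 [b1 [C10 b10 kernel]]] := Heps eps epsP.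
have [C2 [b2 [C20 b20 count]]] := near_count G_derive G_bounded kappa_gt0 G_free A d0 nK.
(* Where the condition holds the cutoff is at least 1/2, so [E] compensates its power; as the cutoff
   is at most 2, [E] also bounds that power. *)
pose E : R := 2 ^+ P.+3.
have E0 : 0 <= E by rewrite exprn_ge0.
pose C3 : R := E * 4 ^+ d * C2 + C1.
exists (E * (X ^+ n.+1 * X ^+ n.+1 * C3)), (maxn b1 b2); split.
- by nonneg.
- by rewrite leq_max b10.
move=> b N m v u r f; rewrite geq_max => /andP[b1b b2b] rA rN ub mN vb sp.
have b_gt0 : (0 < b)%N := leq_trans b10 b1b.
have [r0 _] := andP rA.
set t0 := u%:R / b%:R; set beta : R := b%:R^-1.
have bR0 : 0 < b%:R :> R by rewrite ltr0n.
have t00 : 0 <= t0 by rewrite divr_ge0.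
have tb : t0 + beta <= 1.
  by rewrite -[beta]mul1r -mulrDl ler_pdivrMr// mul1r natr1 ler_nat.
set M := (b ^ (N - m.+1))%N.
pose T : finType := {ffun 'I_n.+1 -> 'I_M}.
pose D (t s : T) := tuple_difference G n t0 beta (grid_point v f t) (grid_point v f s).
pose F x := cutoff (frame G (n := n) eps t0) x.
pose near (t s : T) := [forall i, `|D t s 0 i| < b%:R / r].
pose B (p : T * T) : R := if near p.1 p.2 then E * 4 ^+ d else C1 / b%:R ^+ P.
pose g (p : T * T) x : measurableTypeR R := Num.max 0 (F x) ^+ P.+3 * cos (r * dot (normalize x) (D p.1 p.2)).
have gb p : boxed (g p) E.
  rewrite -[E]mulr1; apply: boxed_cutoff; last by move=> x; exact: norm_cos_le1.
  apply: (@measurableT_comp _ _ _ _ _ _ (cos : R -> R)).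
    by apply: continuous_measurable_fun; exact: continuous_cos.
  by apply: measurable_funM => //; exact: measurable_dot_normalize.
have gB p : (`|\int[lebesgue_rV R d]_x (g p x)%:E| <= (B p)%:E)%E.
  rewrite /B; case: ifPn => [_|].
    by apply: norm_integral_box_le (gb p) _ _ => // x _; have [_ + _] := gb p; exact.
  rewrite negb_forall => /existsP[j]; rewrite -leNgt => Dj.
  have sep := @grid_point_separated R b N m v n f p.1 p.2 n b_gt0 mN vb sp (leqnn n).
  exact: (kernel b r t0 _ _ _ _ j b1b rA t00 tb sep Dj).
pose kap (p : T * T) : R := tuple_weight chi n t0 beta (grid_point v f p.1) *
  tuple_weight chi n t0 beta (grid_point v f p.2).
have bN0 : 0 < (b ^ N)%:R :> R by rewrite ltr0n expn_gt0 b_gt0.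
pose Nn : R := (b ^ N)%:R ^- 2 ^+ n.+1.
have Nn0 : 0 <= Nn by rewrite exprn_ge0// invr_ge0 exprn_ge0// ltW.
have B0 p : 0 <= B p.
  by rewrite /B; case: ifP => _; nonneg; exact: ltW.
pose Y := (b ^ (n.+2 * n.+1))%:R * (b ^ (m.+1 * 'C(n.+1, 2)))%:R / r ^+ n.+1 : R.
have Y0 : 0 <= Y by nonneg; exact: ltW.
have weights : \sum_p `|Nn * kap p| * B p <=
    X ^+ n.+1 * X ^+ n.+1 * C3 * ((b ^ (m.+1 * n.+1))%:R^-1 * (Y + (b ^ P)%:R^-1)).
  have M0 : (0 < M)%N by rewrite expn_gt0 b_gt0.
  pose Mn : R := M%:R ^+ n.+1; have Mn0 : 0 < Mn by rewrite exprn_gt0// ltr0n.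
  pose l : R := (b ^ (m.+1 * n.+1))%:R; have l0 : 0 < l by rewrite ltr0n expn_gt0 b_gt0.
  have cardT : #|T|%:R = Mn by rewrite card_ffun !card_ord natrX.
  have bNn : (b ^ N)%:R ^+ n.+1 = l * Mn.
    by rewrite /l /Mn -!natrX -natrM expnM -expnMn -expnD subnKC.
  have NnE : Nn = (l * Mn) ^- 2 by rewrite /Nn exprVn -exprM mulnC exprM bNn.
  (* For a fixed [t] there are at most [C2 * l * Mn * Y] near partners. Summed over the [Mn] tuples
     [t] and divided by the normalization [(l * Mn)^2], this leaves [Y / l]. *)
  have near_sum t : \sum_(s : T) B (t, s) <= E * 4 ^+ d * (C2 * (l * Mn * Y)) + Mn * (C1 / b%:R ^+ P).
    apply: (@le_trans _ _ (\sum_(s : T) (E * 4 ^+ d * (near t s)%:R + C1 / b%:R ^+ P))).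
      apply: ler_sum => s _; rewrite /B /=; case: ifP => _.
        by rewrite mulr1 lerDl; nonneg; exact: ltW.
      by rewrite mulr0 add0r.
    rewrite big_split/= -mulr_sumr sumr_const -[#|_|]/#|T| -[X in _ + X]mulr_natl cardT.
    rewrite lerD2r; apply: ler_wpM2l; first by nonneg.
    have := count b N m v r t0 f t b2b rA rN t00 tb mN vb sp.
    rewrite -sum1dep_card natr_sum big_mkcond/= => /le_trans le.
    apply: (@le_trans _ _ (C2 * ((b ^ (N + n.+2))%:R / r) ^+ n.+1 * (b ^ (m.+1 * 'C(n.+1, 2)))%:R)).
      apply: le_trans (le _ (lexx _)); apply: ler_sum => s _.
      by rewrite /near /D; case: ifP.
    rewrite -bNn /Y expnD expr_div_n natrM exprMn -[(b ^ n.+2)%:R ^+ n.+1]natrX -expnM.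
    by rewrite le_eqVlt; apply/orP; left; apply/eqP; ring.
  apply: (@le_trans _ _ (Nn * (X ^+ n.+1 * X ^+ n.+1) * \sum_p B p)).
    rewrite mulr_sumr; apply: ler_sum => p _; apply: ler_wpM2r => //.
    rewrite normrM (ger0_norm Nn0); apply: ler_wpM2l => //.
    by rewrite /kap normrM; apply: ler_pM => //; exact: tuple_weight_le.
  have XX : 0 <= X ^+ n.+1 * X ^+ n.+1 by nonneg.
  have SB : \sum_p B p <= Mn * (E * 4 ^+ d * (C2 * (l * Mn * Y)) + Mn * (C1 / b%:R ^+ P)).
    rewrite -(pair_bigA _ (fun t s => B (t, s)))/= -[X in X * (_ + _)]cardT mulr_natl.
    by rewrite -sumr_const; apply: ler_sum => t _; exact: near_sum.
  have l1 : 1 <= l by rewrite ler1n expn_gt0 b_gt0.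
  have bP0 : 0 < (b ^ P)%:R :> R by rewrite ltr0n expn_gt0 b_gt0.
  have key : Nn * \sum_p B p <= C3 * (l^-1 * (Y + (b ^ P)%:R^-1)).
    apply: (le_trans (ler_wpM2l Nn0 SB)); rewrite NnE -(natrX _ b P).
    rewrite (_ : _ * (Mn * _) = l^-1 * (E * 4 ^+ d * C2 * Y + l^-1 * (C1 / (b ^ P)%:R))); last first.
      by field; rewrite !gt_eqF.
    rewrite [leRHS]mulrCA ler_pM2l ?invr_gt0//.
    have h1 : l^-1 * (C1 / (b ^ P)%:R) <= C1 / (b ^ P)%:R.
      by rewrite ler_piMl ?invf_le1//; nonneg; exact: ltW.
    have h2 : 0 <= E * 4 ^+ d * C2 / (b ^ P)%:R by nonneg; exact: ltW.
    have h3 : 0 <= C1 * Y by nonneg.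
    move: h1 h2 h3; rewrite /C3 mulrDl !mulrDr; lra.
  rewrite (_ : Nn * _ * _ = X ^+ n.+1 * X ^+ n.+1 * (Nn * \sum_p B p)); last by ring.
  by rewrite -[leRHS]mulrA; apply: ler_wpM2l.
have prodE w : \prod_(i < n.+1) block G chi b N r u w m.+1 (v * b + f i) ^+ 2 =
   Nn * \sum_(p : T * T) kap p * cos (r * dot w (D p.1 p.2)).
  by rewrite block_prod_sqr// pair_bigA.
have prod0 w : 0 <= \prod_(i < n.+1) block G chi b N r u w m.+1 (v * b + f i) ^+ 2.
  by apply: prodr_ge0 => i _; exact: sqr_ge0.
have prodle w : \prod_(i < n.+1) block G chi b N r u w m.+1 (v * b + f i) ^+ 2 <= (X ^+ 2) ^+ n.+1.
  rewrite -[n.+1 in leRHS]card_ord -prodr_const; apply: ler_prod => i _.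
  rewrite sqr_ge0 lerXn2r ?nnegrE ?block_ge0//.
  apply: (le_trans (block_le _ _ _ _ _ b_gt0 chi_bounded mN)).
  by rewrite ler_pdivrMr ?ltr0n ?expn_gt0 ?b_gt0// ler_peMr// ler1n expn_gt0 b_gt0.
exists (fun x => E * (Num.max 0 (F x) ^+ P.+3 *
    \prod_(i < n.+1) block G chi b N r u (normalize x) m.+1 (v * b + f i) ^+ 2)),
  (`|E| * (E * (X ^+ 2) ^+ n.+1)).
have Fb : boxed (fun x => Num.max 0 (F x) ^+ P.+3 *
    \prod_(i < n.+1) block G chi b N r u (normalize x) m.+1 (v * b + f i) ^+ 2 : measurableTypeR R)
    (E * (X ^+ 2) ^+ n.+1).
  apply: boxed_cutoff; first exact: measurable_prod_block.
  by move=> x; rewrite ger0_norm.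
have F0 x : 0 <= Num.max 0 (F x) ^+ P.+3 *
    \prod_(i < n.+1) block G chi b N r u (normalize x) m.+1 (v * b + f i) ^+ 2.
  by rewrite mulr_ge0// exprn_ge0// le_max lexx.
split.
- exact: boxedZ.
- by move=> x; rewrite mulr_ge0.
- move=> x xb; case: ifPn => [/forallP wG|_]; last by rewrite mulr_ge0.
  have F12 : 1 / 2 <= F x by apply: (cutoff_ge e0 erefl xb).
  rewrite mulrA ler_peMl// /E -exprMn exprn_ege1//.
  have : F x <= Num.max 0 (F x) by rewrite le_max lexx orbT.
  lra.
under eq_integral do rewrite EFinM.
rewrite integralZl//; last exact: (boxed_integrable Fb).
rewrite -(mulrA E) [leRHS]EFinM; apply: lee_wpmul2l => //.
have gE x : Num.max 0 (F x) ^+ P.+3 *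
    \prod_(i < n.+1) block G chi b N r u (normalize x) m.+1 (v * b + f i) ^+ 2 =
    \sum_p Nn * kap p * g p x.
  rewrite prodE mulrCA mulr_sumr mulr_sumr; apply: eq_bigr => p _.
  by rewrite /g; ring.
under eq_integral do rewrite gE.
apply: le_trans (lee_abs _) _; apply: le_trans (norm_integral_sum_le _ gb gB) _.
by rewrite lee_fin; exact: weights.
Qed.

End l2_bound.

(** * Decay of a block in a direction with a large derivative *)

Section block_decay.
Context {R : realType} (d : nat).
Variables (G : nat -> R -> 'rV[R]_d) (Bd : nat -> R).
Hypothesis G_derive : forall l i (t : R), 0 <= t <= 1 ->
  is_derive t 1 (fun s => G l s 0 i) (G l.+1 t 0 i).
Hypothesis G_bounded : forall l i (t : R), 0 <= t <= 1 -> `|G l t 0 i| <= Bd l.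
Variables (chi : R -> R) (X : R).
Hypothesis chi_bounded : forall s, `|chi s| <= X.
Hypothesis chi_lipschitz : forall s t, `|chi s - chi t| <= X * `|s - t|.

Lemma is_derive_dot (w : 'rV[R]_d) l (t : R) : 0 <= t <= 1 ->
  is_derive t 1 (fun s => dot w (G l s)) (dot w (G l.+1 t)).
Proof.
move=> t01; rewrite (_ : (fun s => _) = \sum_(i < d) (fun s => w 0 i * G l s 0 i)); last first.
  by apply/funext => s; rewrite fct_sumE.
apply: is_derive_sum => i; apply: is_deriveZ; exact: G_derive.
Qed.

(** The shift [th] turns sines into cosines, so only one kind of sum needs estimating; [a] is the
    frequency with the sign that makes the relevant derivative positive. *)
Definition directed_phase (w : 'rV[R]_d) (a th : R) (l : nat) (t : R) : R :=
  a * dot w (G l t) + (if l is 0%N then th else 0).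

Lemma phase_directed (w : 'rV[R]_d) (a th h D0 : R) : (forall i, `|w 0 i| <= 1) -> 1 <= `|a| ->
  (d%:R * Bd 1) ^+ 2 + d%:R * Bd 2 <= D0 -> 0 < h -> h * (a ^+ 2 * D0) <= 1 ->
  phase (directed_phase w a th) h (a ^+ 2 * D0).
Proof.
move=> w1 a1 D0P h0 hD; split => //.
- move=> l t t01; rewrite /directed_phase.
  have h1 := is_derive_dot w l t01.
  have h2 : is_derive t 1 (fun s => a * dot w (G l s)) (a * dot w (G l.+1 t)).
    exact: is_deriveZ.
  have h3 : is_derive t 1 (cst (if l is 0%N then th else 0) : R -> R) 0 by exact: is_derive_cst.
  exact: (is_deriveD h2 h3).
- move=> t t01; rewrite /directed_phase !addr0.
  have e1 := norm_dot_le w1 (fun i => G_bounded 1 i t01).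
  have e2 := norm_dot_le w1 (fun i => G_bounded 2 i t01).
  have a2 : `|a| <= a ^+ 2.
    by rewrite -real_normK ?num_real// expr2 ler_peMr.
  rewrite !normrM exprMn real_normK ?num_real//.
  apply: (@le_trans _ _ (a ^+ 2 * ((d%:R * Bd 1) ^+ 2) + a ^+ 2 * (d%:R * Bd 2))).
    apply: lerD; last by apply: ler_pM.
    by rewrite ler_wpM2l ?sqr_ge0// lerXn2r ?nnegrE// (le_trans _ e1).
  by rewrite -mulrDr ler_wpM2l ?sqr_ge0.
Qed.

(** The first two terms serve the first-derivative estimate, the last one the derivatives of higher
    order. *)
Definition osc_constant n (eps : R) : R :=
  8 / eps + 4 * (d%:R * Bd 2) / eps ^+ 2 + 16 * 2 ^+ n * (1 + 2 / eps).

Lemma osc_directed_le n (eps : R) (w : 'rV[R]_d) (a th h : R) p q (rho t0 D0 : R) :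
  (forall i, `|w 0 i| <= 1) -> (d%:R * Bd 1) ^+ 2 + d%:R * Bd 2 <= D0 ->
  0 < h -> h * (a ^+ 2 * D0) <= 1 -> h * `|a| <= 1 -> 0 < eps -> 1 <= rho -> rho ^+ n.+1 = `|a| ->
  0 <= t0 -> (p <= q)%N -> t0 <= p%:R * h -> q%:R * h <= 1 ->
  d%:R * Bd n.+2 * (q%:R * h - t0) <= eps / 2 ->
  eps * `|a| <= a * dot w (G n.+1 t0) ->
  `|h * \sum_(p <= m < q) chi (m%:R * h) * cos (a * dot w (G 0 (m%:R * h)) + th)| <=
    osc_constant n eps * X / rho.
Proof.
move=> w1 D0P h0 hD ha eps0 rho1 rhoa t00 pq t0p qh small aligned.
have rho0 : 0 < rho := lt_le_trans ltr01 rho1.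
have a1 : 1 <= `|a| by rewrite -rhoa exprn_ege1.
have a0 : 0 < `|a| := lt_le_trans ltr01 a1.
have X0 : 0 <= X := le_trans (normr_ge0 _) (chi_bounded 0).
have t0in : 0 <= t0 <= 1.
  by rewrite t00 (le_trans t0p)// (le_trans _ qh)// ler_pM2r// ler_nat.
have dB l : 0 <= d%:R * Bd l.
  by apply: le_trans (normr_ge0 _) (norm_dot_le w1 (fun i => G_bounded l i t0in)).
have Fph := phase_directed th w1 a1 D0P h0 hD.
have cX : amplitude (fun m => chi (m%:R * h)) h X.
  move=> m; split; first exact: chi_bounded.
  apply: (le_trans (chi_lipschitz _ _)); rewrite -mulrBl -natrB// subSnn mul1r.
  by rewrite gtr0_norm.
have oscE : h * \sum_(p <= m < q) chi (m%:R * h) * cos (a * dot w (G 0 (m%:R * h)) + th) =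
   osc (directed_phase w a th) (fun m => chi (m%:R * h)) h p q by [].
rewrite oscE.
(* The range is short enough, by [small], for the derivative to keep half of its value at [t0]. *)
have low (t : R) : t0 <= t <= q%:R * h -> `|a| * (eps / 2) <= directed_phase w a th n.+1 t.
  move=> /andP[t0t tq]; rewrite /directed_phase addr0.
  have t1 : t <= 1 := le_trans tq qh.
  have tin (s : R) : t0 <= s <= t -> 0 <= s <= 1.
    by move=> /andP[s1 s2]; rewrite (le_trans t00)//= (le_trans s2).
  have := @mean_value_le R (fun s => dot w (G n.+1 s)) (fun s => dot w (G n.+2 s)) t0 t
     (d%:R * Bd n.+2) t0t.
  move=> /(_ (fun s sin => is_derive_dot w n.+1 (tin s sin))).
  move=> /(_ (fun s sin => norm_dot_le w1 (fun i => G_bounded n.+2 i (tin s sin)))) mv.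
  have {}mv : `|dot w (G n.+1 t) - dot w (G n.+1 t0)| <= eps / 2.
    by apply: (le_trans mv); apply: le_trans small; rewrite ler_wpM2l// lerD2r.
  have : `|a * dot w (G n.+1 t) - a * dot w (G n.+1 t0)| <= `|a| * (eps / 2).
    by rewrite -mulrBr normrM ler_wpM2l.
  rewrite ler_norml => /andP[+ _]; lra.
have osc_ge0 : 0 <= 16 * 2 ^+ n * (1 + 2 / eps).
  by nonneg; exact: ltW.
have first_ge0 : 0 <= 8 / eps + 4 * (d%:R * Bd 2) / eps ^+ 2.
  by nonneg; exact: ltW.
case: n rhoa small aligned low osc_ge0 => [|j] rhoa small aligned low osc_ge0.
  (* With only a first derivative no monotonicity is at hand, so the variation of [1 / F 1] is
     estimated by the size of [F 2] over [r ^ 2]. *)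
  rewrite expr1 in rhoa.
  pose r := `|a| * (eps / 2); have r0 : 0 < r by rewrite mulr_gt0// divr_gt0.
  pose F := directed_phase w a th.
  have Fr m : (p <= m < q)%N -> r <= `|F 1%N (m%:R * h)|.
    move=> /andP[pm mq]; apply: le_trans (ler_norm _); apply: low.
    by rewrite (le_trans t0p)/= ler_pM2r// ler_nat// ltnW.
  have FV : \sum_(p <= m < q.-1) `|(F 1%N (m.+1%:R * h))^-1 - (F 1%N (m%:R * h))^-1| <=
      d%:R * Bd 2 * `|a| / r ^+ 2.
    apply: (@le_trans _ _ (\sum_(p <= m < q.-1) (d%:R * Bd 2 * `|a| / r ^+ 2 * h))).
      rewrite !big_nat; apply: ler_sum => m /andP[pm mq].
      have mq1 : (m.+1 < q)%N by move: mq; case: (q).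
      have Fm : r <= F 1%N (m%:R * h).
        by apply: low; rewrite (le_trans t0p)/= ler_pM2r// ler_nat// ltnW// ltnW.
      have FS : r <= F 1%N (m.+1%:R * h).
        by apply: low; rewrite (le_trans t0p)/= ler_pM2r// ler_nat// ltnW.
      have Fm0 := lt_le_trans r0 Fm; have FS0 := lt_le_trans r0 FS.
      rewrite (_ : _ - _ = (F 1%N (m%:R * h) - F 1%N (m.+1%:R * h)) /
         (F 1%N (m.+1%:R * h) * F 1%N (m%:R * h))); last by field; rewrite !gt_eqF.
      rewrite normrM (ger0_norm (_ : 0 <= _^-1)); last by rewrite invr_ge0 mulr_ge0// ltW.
      have [Fd _ _ _] := Fph.
      have mm : m%:R * h <= m.+1%:R * h by rewrite ler_pM2r// ler_nat.
      have := @mean_value_le R (F 1%N) (F 2%N) (m%:R * h) (m.+1%:R * h) (d%:R * Bd 2 * `|a|) mm.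
      have tin (s : R) : m%:R * h <= s <= m.+1%:R * h -> 0 <= s <= 1.
        move=> /andP[s1 s2]; rewrite (le_trans _ s1) ?mulr_ge0 ?(ltW h0)//=.
        by rewrite (le_trans s2)// (le_trans _ qh)// ler_pM2r// ler_nat ltnW.
      move=> /(_ (fun s sin => Fd 1%N s (tin s sin))) mv.
      rewrite distrC mulrAC; apply: ler_pM => //.
      - by rewrite invr_ge0 mulr_ge0// ltW.
      - have hE : m.+1%:R * h - m%:R * h = h by rewrite -mulrBl -natrB// subSnn mul1r.
        rewrite hE in mv; apply: mv => s sin; rewrite /F /directed_phase addr0 normrM mulrC ler_wpM2r//.
        exact: norm_dot_le w1 (fun i => G_bounded 2 i (tin s sin)).
      - by rewrite lef_pV2 ?posrE ?mulr_gt0 ?exprn_gt0// expr2 ler_pM// ltW.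
    rewrite sumr_const_nat -mulrnAr ler_piMr//; last first.
      rewrite -mulr_natl (le_trans _ qh)// ler_pM2r// ler_nat (leq_trans (leq_subr _ _))//.
      exact: leq_pred.
    by nonneg; rewrite ltW.
  apply: (le_trans (osc_first_derivative Fph cX qh r0 Fr FV)).
  rewrite [leRHS]mulrAC [leRHS]mulrC; apply: ler_wpM2l => //.
  rewrite /osc_constant [leRHS]mulrDl -[leLHS]addr0; apply: lerD; last first.
    by apply: mulr_ge0 => //; rewrite invr_ge0 ltW.
  rewrite rhoa le_eqVlt; apply/orP; left; apply/eqP; rewrite /r; field.
  by rewrite !gt_eqF.
(* Scaling [rho] by [e] makes [r ^ (j + 2)] at most [|a| * eps / 2]; that [e <= 1] also gives
   [r * h <= 1]. *)
pose e := Num.min 1 (eps / 2); have e0 : 0 < e by rewrite lt_min ltr01 divr_gt0.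
have [e1 e2] : e <= 1 /\ e <= eps / 2 by rewrite /e; split; rewrite ge_min lexx ?orbT.
pose r := e * rho; have r0 : 0 < r by rewrite mulr_gt0.
have rh : r * h <= 1.
  apply: le_trans ha; rewrite mulrC ler_pM2l// -rhoa.
  apply: (@le_trans _ _ (1 * rho)); first by rewrite ler_pM2r.
  by rewrite mul1r ler_eXnr.
have HF (t : R) : p%:R * h <= t <= q.-1%:R * h -> r ^+ j.+2 <= directed_phase w a th j.+2 t.
  move=> /andP[pt tq]; apply: le_trans (low t _); last first.
    rewrite (le_trans t0p)//= (le_trans tq)// ler_pM2r// ler_nat; exact: leq_pred.
  rewrite exprMn rhoa mulrC ler_pM2l//; apply: le_trans e2.
  by rewrite exprS ler_piMr ?(ltW e0)// exprn_ile1// ltW.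
apply: (le_trans (osc_van_der_corput Fph cX qh r0 rh HF)).
rewrite [leLHS]mulrAC [leRHS]mulrAC; apply: ler_wpM2r => //.
have re : r^-1 <= (1 + 2 / eps) / rho.
  rewrite /r invfM ler_pM2r ?invr_gt0// /e minEle; case: ifP => _.
    by rewrite invr1 lerDl divr_ge0// ltW.
  by rewrite invf_div lerDr.
have n1 : 0 <= (16 * 2 ^+ j - 3 : R) <= 16 * 2 ^+ j.+1.
  have : 1 <= 2 ^+ j :> R by rewrite exprn_ege1// ler1n.
  rewrite exprS => ?; apply/andP; split; lra.
case/andP: n1 => n1 n2.
apply: (@le_trans _ _ (16 * 2 ^+ j.+1 * ((1 + 2 / eps) / rho))).
  by apply: ler_pM => //; rewrite invr_ge0 ltW.
by rewrite mulrA ler_wpM2r ?invr_ge0 ?(ltW rho0)// lerDr.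
Qed.

(** Real and imaginary parts account for the 2 in the constant. The factor [b] appears because a
    block is normalized by [b^N] while the grid step is [b^-(N+1)]. *)
Lemma block_decay n A (eps : R) : 0 < eps ->
  exists (C : R) (b0 : nat), [/\ 0 <= C, (0 < b0)%N &
  forall (b N u m v : nat) (r rho : R) (w : 'rV[R]_d),
    (b0 <= b)%N -> (2 * A <= N)%N -> r <= (2 * b%:R) ^+ A -> (u < b)%N -> enorm w = 1 ->
    eps <= `|dot w (G n.+1 (u%:R / b%:R))| -> (m <= N)%N -> (v < b ^ m)%N ->
    1 <= rho -> rho ^+ n.+1 = r ->
    block G chi b N r u w m v <= C * b%:R / rho].
Proof.
move=> eps0.
have X0 : 0 <= X := le_trans (normr_ge0 _) (chi_bounded 0).
pose D0 := (d%:R * Bd 1) ^+ 2 + `|d%:R * Bd 2|.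
have D00 : 0 <= D0 by rewrite addr_ge0 ?sqr_ge0.
pose D1 := 4 ^+ A * (D0 + 1).
have D10 : 0 < D1 by rewrite mulr_gt0 ?exprn_gt0// ltr_wpDl.
pose S := `|d%:R * Bd n.+2| + 1; have S0 : 0 < S by rewrite ltr_wpDl.
have beta0 : 0 < Num.min (D1^-1) (eps / (2 * S)).
  by rewrite lt_min invr_gt0 D10 divr_gt0// mulr_gt0.
have [b0 b00 b0P] := nat_large beta0.
exists (2 * (`|osc_constant n eps| * X)), b0; split => //; first by nonneg.
move=> b N u m v r rho w b0b AN rA ub w1 low mN vb rho1 rhor.
have b_gt0 : (0 < b)%N := leq_trans b00 b0b.
have := b0P _ b0b; rewrite le_min => /and3P[bet0 betD betS].
have bR0 : 0 < b%:R :> R by rewrite ltr0n.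
have b1 : 1 <= b%:R :> R by rewrite ler1n.
have wi i : `|w 0 i| <= 1 by rewrite -w1; exact: coord_le_enorm.
have r1 : 1 <= r by rewrite -rhor exprn_ege1.
have r0 : 0 < r := lt_le_trans ltr01 r1.
have rho0 : 0 < rho := lt_le_trans ltr01 rho1.
set h : R := (b ^ N.+1)%:R^-1.
have bN1 : 0 < (b ^ N.+1)%:R :> R by rewrite ltr0n expn_gt0 b_gt0.
have h0 : 0 < h by rewrite invr_gt0.
set t0 : R := u%:R / b%:R in low *.
set p := (u * b ^ N + v * b ^ (N - m))%N; set q := (u * b ^ N + v.+1 * b ^ (N - m))%N.
have pq : (p <= q)%N by rewrite leq_add2l leq_mul2r leqnSn orbT.
have t0E : t0 = (u * b ^ N)%:R * h.
  rewrite /t0 /h expnS !natrM; field.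
  by rewrite !pnatr_eq0 -!lt0n expn_gt0 b_gt0.
have t0p : t0 <= p%:R * h by rewrite t0E ler_pM2r// ler_nat leq_addr.
have qu : (q <= u.+1 * b ^ N)%N.
  by rewrite mulSnr leq_add2l -{2}(subnKC mN) expnD leq_mul2r vb orbT.
have uE : (u.+1 * b ^ N)%:R * h = t0 + b%:R^-1.
  rewrite /t0 /h expnS !natrM -natr1; field.
  by rewrite !pnatr_eq0 -!lt0n expn_gt0 b_gt0.
have qt : q%:R * h <= t0 + b%:R^-1 by rewrite -uE ler_pM2r// ler_nat.
have tb : t0 + b%:R^-1 <= 1.
  by rewrite -[b%:R^-1]mul1r -mulrDl ler_pdivrMr// mul1r natr1 ler_nat.
(* This is where [2 * A <= N] enters: the grid step is below a constant times [1 / (b * r^2)], as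
   the discrete estimates require. *)
have rsq : r ^+ 2 <= 4 ^+ A * (b ^ N)%:R.
  apply: (@le_trans _ _ (((2 * b%:R) ^+ A) ^+ 2)).
    by rewrite lerXn2r// ?nnegrE ?exprn_ge0 ?mulr_ge0 ?(ltW r0).
  have -> : ((2 * b%:R) ^+ A) ^+ 2 = 4 ^+ A * (b ^ (2 * A))%:R :> R.
    rewrite exprAC (_ : (2 * b%:R) ^+ 2 = 4 * b%:R ^+ 2); last by ring.
    by rewrite exprMn natrX exprM.
  by rewrite ler_pM2l ?exprn_gt0// ler_nat leq_pexp2l.
have hr2 : h * (r ^+ 2 * (D0 + 1)) <= 1.
  apply: (@le_trans _ _ (h * (4 ^+ A * (b ^ N)%:R * (D0 + 1)))).
    by rewrite ler_pM2l// ler_wpM2r// addr_ge0.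
  rewrite (_ : h * _ = b%:R^-1 * D1); last first.
    rewrite /h /D1 expnS natrM; field.
    by rewrite !pnatr_eq0 -!lt0n expn_gt0 b_gt0.
  by rewrite -ler_pdivlMr// mul1r.
have hr : h * r <= 1.
  apply: le_trans hr2; rewrite ler_pM2l// expr2 -mulrA ler_peMr ?(ltW r0)//.
  by rewrite mulr_ege1// lerDr.
have small : d%:R * Bd n.+2 * (q%:R * h - t0) <= eps / 2.
  apply: (@le_trans _ _ (S * b%:R^-1)).
    apply: (@le_trans _ _ (S * (q%:R * h - t0))).
      rewrite ler_wpM2r//.
        by rewrite subr_ge0 (le_trans t0p)// ler_pM2r// ler_nat.
      by rewrite (le_trans (ler_norm _))// lerDl.
    by rewrite ler_pM2l// lerBlDl.
  by move: betS; rewrite ler_pdivlMr ?mulr_gt0//; lra.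
have D0P : (d%:R * Bd 1) ^+ 2 + d%:R * Bd 2 <= D0 + 1.
  by rewrite -addrA lerD2l (le_trans (ler_norm _))// lerDl.
pose s : R := if 0 <= dot w (G n.+1 t0) then 1 else -1.
have sn : `|s| = 1 by rewrite /s; case: ifP => _; rewrite ?normrN normr1.
have sdot : s * dot w (G n.+1 t0) = `|dot w (G n.+1 t0)|.
  rewrite /s; case: ifPn => [h1|]; first by rewrite mul1r ger0_norm.
  by rewrite -ltNge => h1; rewrite mulN1r ltr0_norm.
pose a := s * r.
have an : `|a| = r by rewrite normrM sn mul1r gtr0_norm.
have a2 : a ^+ 2 = r ^+ 2 by rewrite -[LHS]real_normK ?num_real// an.
have key th : `|h * \sum_(p <= g < q) chi (g%:R * h) * cos (a * dot w (G 0 (g%:R * h)) + th)| <=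
    `|osc_constant n eps| * X / rho.
  apply: (@le_trans _ _ (osc_constant n eps * X / rho)); last first.
    rewrite ler_wpM2r ?invr_ge0 ?(ltW rho0)// ler_wpM2r//; exact: ler_norm.
  apply: (@osc_directed_le n eps w a th h p q rho t0 (D0 + 1)) => //.
  - by rewrite a2.
  - by rewrite an.
  - by rewrite an.
  - by rewrite /t0 divr_ge0.
  - exact: le_trans tb.
  - rewrite an /a mulrC [s * r]mulrC -mulrA sdot.
    by rewrite ler_pM2l.
have ReE : complex.Re (wave_sum G chi r h w p q) =
    \sum_(p <= g < q) chi (g%:R * h) * cos (a * dot w (G 0 (g%:R * h)) + 0).
  rewrite /wave_sum raddf_sum; apply: eq_bigr => g _.
  rewrite [LHS]Re_wave addr0 cosN /a /s; case: ifP => _; rewrite ?mul1r// mulN1r mulNr cosN//.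
have ImE : complex.Im (wave_sum G chi r h w p q) =
    \sum_(p <= g < q) chi (g%:R * h) * cos (a * dot w (G 0 (g%:R * h)) + s * (pi / 2)).
  rewrite /wave_sum raddf_sum; apply: eq_bigr => g _.
  rewrite [LHS]Im_wave /a /s sinN -cosDpihalf; congr (_ * _).
  by case: ifP => _; rewrite ?mul1r// !mulN1r mulNr -opprD cosN.
have nW : h * Normc.normc (wave_sum G chi r h w p q) <= 2 * (`|osc_constant n eps| * X / rho).
  apply: (@le_trans _ _ (`|h * complex.Re (wave_sum G chi r h w p q)| +
                         `|h * complex.Im (wave_sum G chi r h w p q)|)).
    rewrite !normrM -mulrDr (gtr0_norm h0) ler_pM2l//.
    set z := wave_sum _ _ _ _ _ _ _.
    rewrite -ler_sqr ?nnegrE ?normc_ge0 ?addr_ge0// normc_sqr sqrrD !real_normK ?num_real//.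
    by rewrite -addrA lerD2l lerDr mulrn_wge0// mulr_ge0.
  by rewrite ReE ImE mulr_natl mulr2n; apply: lerD; exact: key.
rewrite /block -/h -/p -/q ler_pdivrMr ?ltr0n ?expn_gt0 ?b_gt0//.
rewrite -(ler_pM2l h0) (le_trans nW)// le_eqVlt; apply/orP; left; apply/eqP.
rewrite /h expnS natrM; field.
by rewrite !gt_eqF// ltr0n expn_gt0 b_gt0.
Qed.

End block_decay.

(** * The corner estimates *)

Section uniform_choice.
Context {R : realType}.

Lemma uniform_small k (Q : nat -> R -> Prop) :
  (forall n, (n < k)%N -> exists2 e0 : R, 0 < e0 & forall e, 0 < e <= e0 -> Q n e) ->
  exists2 e0 : R, 0 < e0 & forall n e, (n < k)%N -> 0 < e <= e0 -> Q n e.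
Proof.
elim: k => [_|k IH H]; first by exists 1.
have [n nk|e1 e10 H1] := IH; first by apply: H; exact: ltnW.
have [e2 e20 H2] := H k (leqnn _).
exists (Num.min e1 e2); first by rewrite lt_min e10.
move=> n e; rewrite ltnS leq_eqVlt le_min => /orP[/eqP->|nk] /and3P[e0 ee1 ee2].
  by apply: H2; rewrite e0.
by apply: H1 => //; rewrite e0.
Qed.

Lemma uniform_large k (Q : nat -> R -> nat -> Prop) :
  (forall n C C' b b', C <= C' -> (b <= b')%N -> Q n C b -> Q n C' b') ->
  (forall n, (n < k)%N -> exists (C : R) (b : nat), Q n C b) ->
  exists (C : R) (b : nat), [/\ 0 <= C, (0 < b)%N & forall n, (n < k)%N -> Q n C b].
Proof.
move=> mono; elim: k => [_|k IH H]; first by exists 0, 1%N.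
have [n nk|C1 [b1 [C10 b10 H1]]] := IH; first by apply: H; exact: ltnW.
have [C2 [b2 H2]] := H k (leqnn _).
exists (Num.max C1 C2), (maxn b1 b2); split.
- by rewrite le_max C10.
- by rewrite leq_max b10.
move=> n; rewrite ltnS leq_eqVlt => /orP[/eqP->|nk].
  by apply: mono H2; rewrite ?le_max ?lexx ?orbT ?leq_maxr.
by apply: mono (H1 n nk); rewrite ?le_max ?lexx ?leq_maxl.
Qed.

End uniform_choice.

(* [(k^2 + k + 2) / 2] *)
Definition critical_exponent k := 'C(k.+1, 2).+1.

Lemma critical_exponentS k : critical_exponent k.+1 = (critical_exponent k + k.+1)%N.
Proof. by rewrite /critical_exponent binS bin1 addSn addnC. Qed.

(** Each step from [j >= n] adds [j + 1 >= n + 1]. The difference counts the factors left for van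
    der Corput; worth [r^(-1/(n+1))] each, they yield [r^-(k-n)]. *)
Lemma critical_exponent_ge k n : (n <= k)%N ->
  (critical_exponent n + n.+1 * (k - n) <= critical_exponent k)%N.
Proof.
elim: k => [|k IH]; first by rewrite leqn0 => /eqP->; rewrite muln0 addn0.
rewrite leq_eqVlt => /orP[/eqP->|nk]; first by rewrite subnn muln0 addn0.
rewrite subSn// mulnS addnCA critical_exponentS addnC leq_add//; exact: IH.
Qed.

Lemma critical_exponent_ge_double k : (0 < k)%N -> (2 * k <= critical_exponent k)%N.
Proof.
elim: k => // -[|k] IH _ //; rewrite critical_exponentS.
have := IH isT; set c := critical_exponent _; lia.
Qed.

(** The balance of scales: trivial bounds and normalization on the left pay for the near pairs and,
    with the 1, for the number of intervals of a generation. *)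
Lemma critical_exponentE n : (0 < n)%N ->
  (critical_exponent n - 2 * n + n = 'C(n, 2) + 1)%N.
Proof.
move=> n0; have := critical_exponent_ge_double n0; rewrite /critical_exponent binS bin1.
lia.
Qed.

(** [T1] is the contribution of near pairs, where all powers of the scale cancel. [T2] is that of
    far pairs, where [beta^-P] outweighs the number of intervals and tuples and still leaves [r^-n],
    because [r <= beta^N]. *)
Lemma corner_term (R : realType) (beta r X Y C W : R) (n k N m P : nat) :
  1 <= beta -> 1 <= r -> r <= beta ^+ N -> (0 < n <= k)%N -> (m < N)%N ->
  0 <= X -> 0 <= C -> 0 <= W -> 0 <= Y -> (N + k + k * N <= P)%N ->
  let q := critical_exponent k in let qn := critical_exponent n in
  Y ^+ (q - qn) <= W * beta ^+ q / r ^+ (k - n) ->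
  (2 * beta) ^+ q * ((X / beta ^+ m.+1) ^+ (qn - 2 * n) * Y ^+ (q - qn)) *
   (beta ^+ m * beta ^+ n * (C * (beta ^- (m.+1 * n) *
      (beta ^+ (n.+1 * n) * beta ^+ (m.+1 * 'C(n, 2)) / r ^+ n + beta ^- P)))) <=
  2 ^+ q.+1 * X ^+ (qn - 2 * n) * W * C * beta ^+ (2 * q + k.+2 * k) / r ^+ k.
Proof.
move=> b1 r1 rN /andP[n0 nk] mN X0 C0 W0 Y0 PN q qn YW.
have b0 : 0 < beta := lt_le_trans ltr01 b1.
have r0 : 0 < r := lt_le_trans ltr01 r1.
pose a := beta ^+ m.+1; have a0 : 0 < a by rewrite exprn_gt0.
set e := (qn - 2 * n)%N.
have aE : a ^+ e * a ^+ n = a ^+ 'C(n, 2) * a.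
  by rewrite -exprD critical_exponentE// exprD expr1.
have bm : beta ^+ m <= a by rewrite ler_weXn2l.
have T1 : beta ^+ m / a ^+ e / a ^+ n * a ^+ 'C(n, 2) <= 1.
  rewrite (_ : _ * _ = beta ^+ m / a); first by rewrite ler_pdivrMr// mul1r.
  transitivity (beta ^+ m * a ^+ 'C(n, 2) / (a ^+ e * a ^+ n)).
    by rewrite invfM; ring.
  by rewrite aE; field; rewrite !gt_eqF// exprn_gt0.
have ae1 j : (a ^+ j)^-1 <= 1 by rewrite invf_le1 ?exprn_gt0// !exprn_ege1.
have T2 : beta ^+ m / a ^+ e / a ^+ n * (beta ^+ n / beta ^+ P) <= (r ^+ n)^-1.
  apply: (@le_trans _ _ (beta ^+ N * (beta ^+ n / beta ^+ P))).
    rewrite ler_pM2r ?divr_gt0 ?exprn_gt0//.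
    apply: (@le_trans _ _ (beta ^+ m * 1 * 1)); last by rewrite !mulr1 ler_weXn2l// ltnW.
    by do 2 (apply: ler_pM; rewrite ?mulr_ge0 ?invr_ge0 ?exprn_ge0 ?(ltW b0) ?(ltW a0)//).
  rewrite mulrA -exprD ler_pdivrMr ?exprn_gt0// mulrC ler_pdivlMr ?exprn_gt0//.
  apply: (@le_trans _ _ (beta ^+ (N + n) * beta ^+ (N * n))).
    by rewrite ler_pM2l ?exprn_gt0// exprM lerXn2r ?nnegrE ?(ltW r0) ?exprn_ge0// ltW.
  rewrite -exprD ler_weXn2l//; apply: leq_trans PN.
  by rewrite leq_add ?leq_add2l// mulnC leq_mul2r nk orbT.
set Yq := Y ^+ (q - qn) in YW *.
rewrite (exprM beta m.+1 n) (exprM beta m.+1 'C(n, 2)) -/a.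
set T := beta ^+ m / a ^+ e / a ^+ n in T1 T2.
have bn j : 0 < beta ^+ j by rewrite exprn_gt0.
have rn j : 0 < r ^+ j by rewrite exprn_gt0.
rewrite (_ : _ * _ = (2 ^+ q * X ^+ e * C * beta ^+ q) * (Yq *
   (T * a ^+ 'C(n, 2) * (beta ^+ (n.+2 * n) / r ^+ n) + T * (beta ^+ n / beta ^+ P)))); last first.
  rewrite /T (_ : n.+2 * n = n + n.+1 * n)%N// exprD expr_div_n exprMn; ring.
rewrite (_ : _ / r ^+ k = (2 ^+ q * X ^+ e * C * beta ^+ q) * ((W * beta ^+ q / r ^+ (k - n)) *
   (beta ^+ (k.+2 * k) / r ^+ n + beta ^+ (k.+2 * k) / r ^+ n))); last first.
  have -> : r ^+ k = r ^+ (k - n) * r ^+ n by rewrite -exprD subnK.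
  rewrite mul2n -addnn [beta ^+ (_ + _)]exprD [beta ^+ (q + q)]exprD [2 ^+ _.+1]exprS; field.
  by rewrite !gt_eqF.
apply: ler_wpM2l; first by nonneg; exact: ltW.
have T0 : 0 <= T by rewrite /T; nonneg; rewrite ltW ?exprn_gt0.
apply: ler_pM => //.
- exact: exprn_ge0.
- by apply: addr_ge0; apply: mulr_ge0; nonneg; exact: ltW.
apply: lerD.
  apply: (@le_trans _ _ (1 * (beta ^+ (n.+2 * n) / r ^+ n))).
    by rewrite ler_pM2r// divr_gt0.
  by rewrite mul1r ler_pM2r ?invr_gt0// ler_weXn2l// leq_mul.
by apply: (le_trans T2); rewrite ler_peMl ?invr_ge0 ?(ltW (rn _))// exprn_ege1.
Qed.

Section corner.
Context {R : realType} (d : nat).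
Variables (G : nat -> R -> 'rV[R]_d) (K : nat) (kappa : R) (Bd : nat -> R).
Hypothesis G_derive : forall l i (t : R), 0 <= t <= 1 ->
  is_derive t 1 (fun s => G l s 0 i) (G l.+1 t 0 i).
Hypothesis G_bounded : forall l i (t : R), 0 <= t <= 1 -> `|G l t 0 i| <= Bd l.
Hypothesis kappa_gt0 : 0 < kappa.
Hypothesis G_free : forall (t : R) (c : nat -> R) j, 0 <= t <= 1 -> (j < K)%N ->
  exists i, kappa * `|c j| <= `|\sum_(l < K) c l * G l.+1 t 0 i|.
Variables (chi : R -> R) (X : R).
Hypothesis chi_bounded : forall s, `|chi s| <= X.
Hypothesis chi_lipschitz : forall s t, `|chi s - chi t| <= X * `|s - t|.

Let X_ge0 : 0 <= X. Proof. exact: le_trans (normr_ge0 _) (chi_bounded 0). Qed.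

Definition flat n (delta : R) b u (w : 'rV[R]_d) :=
  [forall k : 'I_n, `|dot w (G k.+1 (u%:R / b%:R))| <= delta].

Definition square_products b N r u w m n : R :=
  \sum_(v < b ^ m) \sum_(f : {ffun 'I_n -> 'I_b} | spread f)
    \prod_(i < n) block G chi b N r u w m.+1 (v * b + f i) ^+ 2.

Lemma multiscale_block b N r u w n k (Y : R) : (0 < b)%N -> (0 < n <= k)%N -> 0 <= Y ->
  (forall m v, (m <= N)%N -> (v < b ^ m)%N -> block G chi b N r u w m v <= Y) ->
  block G chi b N r u w 0 0 ^+ critical_exponent k <=
  \sum_(m < N) ((4 * n)%:R ^+ critical_exponent k) ^+ m *
     ((2 * b)%:R ^+ critical_exponent k *
      ((X / (b ^ m.+1)%:R) ^+ (critical_exponent n - 2 * n) *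
       Y ^+ (critical_exponent k - critical_exponent n))) *
     square_products b N r u w m n +
  ((4 * n)%:R ^+ critical_exponent k) ^+ N * ((b ^ N)%:R * (X / (b ^ N)%:R) ^+ critical_exponent k).
Proof.
move=> b0 /andP[n0 nk] Y0 eY; set q := critical_exponent k; set qn := critical_exponent n.
have qnq : (qn <= q)%N by apply: leq_trans (critical_exponent_ge nk); rewrite leq_addr.
have nq : (2 * n <= qn)%N := critical_exponent_ge_double n0.
have e0 m v := block_ge0 G chi b N r u w m v.
have bm0 m : 0 < (b ^ m)%:R :> R by rewrite ltr0n expn_gt0 b0.
have Xb m : 0 <= X / (b ^ m)%:R by rewrite divr_ge0.
(* Both bounds are kept: the first gives decay in the scale to [qn - 2 n] of the factors, the second
   decay in [r] to the other [q - qn]. *)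
pose B m := Num.min (X / (b ^ m)%:R) Y.
have B0 m : 0 <= B m by rewrite le_min Xb.
have eB m v : (m <= N)%N -> (v < b ^ m)%N -> block G chi b N r u w m v <= B m.
  by move=> mN vb; rewrite le_min block_le// eY.
apply: le_trans (@multiscale R b n q N (block G chi b N r u w) B b0 n0 (leq_trans nq qnq) e0 _ eB) _.
  by move=> m v mN _; exact: block_le_sum.
apply: lerD.
  apply: ler_sum => m _; rewrite -/(square_products b N r u w m n); apply: ler_wpM2r.
    apply: sumr_ge0 => v _; apply: sumr_ge0 => f _; apply: prodr_ge0 => i _; exact: sqr_ge0.
  apply: ler_wpM2l; first by nonneg.
  apply: ler_wpM2l; first by nonneg.
  rewrite (_ : q - 2 * n = (qn - 2 * n) + (q - qn))%N; last first.
    by rewrite addnC addnBA// subnK.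
  rewrite exprD; apply: ler_pM; rewrite ?exprn_ge0//.
    by rewrite lerXn2r ?nnegrE// ge_min lexx.
  by rewrite lerXn2r ?nnegrE// ge_min lexx orbT.
apply: ler_wpM2l; first by nonneg.
rewrite mulr_natl -[X in _ *+ X]card_ord -sumr_const; apply: ler_sum => v _.
by rewrite lerXn2r ?nnegrE// block_le.
Qed.

(* The first derivative that is not nearly orthogonal to [w] either lies among
   the first [k], and then van der Corput applies, or all of these are. *)
Lemma flat_dichotomy k delta b u w : flat k delta b u w \/
  exists2 n, (n < k)%N & flat n delta b u w /\ delta < `|dot w (G n.+1 (u%:R / b%:R))|.
Proof.
elim: k => [|k [flatk|[n nk h]]]; first by left; apply/forallP => -[].
  have [le|lt] := leP `|dot w (G k.+1 (u%:R / b%:R))| delta; last by right; exists k.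
  left; apply/forallP => i; have := ltn_ord i; rewrite ltnS leq_eqVlt => /orP[/eqP->//|ik].
  exact: (forallP flatk (Ordinal ik)).
by right; exists n => //; exact: ltnW.
Qed.

End corner.

Lemma powR_root (R : realType) n (r : R) : 1 <= r ->
  1 <= r `^ (n.+1%:R^-1) /\ (r `^ (n.+1%:R^-1)) ^+ n.+1 = r.
Proof.
move=> r1; have r0 : 0 <= r := le_trans ler01 r1.
split.
  have := @ge0_ler_powR R n.+1%:R^-1 _ 1 r; rewrite powR1; apply => //; by rewrite nnegrE ler01.
by rewrite -powR_mulrn ?powR_ge0// -powRrM mulVf ?powRr1.
Qed.

Section block_corner.
Context {R : realType} (d : nat).
Variables (G : nat -> R -> 'rV[R]_d) (K : nat) (kappa : R) (Bd : nat -> R).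
Hypothesis G_derive : forall l i (t : R), 0 <= t <= 1 ->
  is_derive t 1 (fun s => G l s 0 i) (G l.+1 t 0 i).
Hypothesis G_bounded : forall l i (t : R), 0 <= t <= 1 -> `|G l t 0 i| <= Bd l.
Hypothesis kappa_gt0 : 0 < kappa.
Hypothesis G_free : forall (t : R) (c : nat -> R) j, 0 <= t <= 1 -> (j < K)%N ->
  exists i, kappa * `|c j| <= `|\sum_(l < K) c l * G l.+1 t 0 i|.
Variables (chi : R -> R) (X : R).
Hypothesis chi_bounded : forall s, `|chi s| <= X.
Hypothesis chi_lipschitz : forall s t, `|chi s - chi t| <= X * `|s - t|.

Let X_ge0 : 0 <= X. Proof. exact: le_trans (normr_ge0 _) (chi_bounded 0). Qed.

Lemma square_products_dominated n A N P : (1 < d)%N -> (n < K)%N ->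
  exists2 e0 : R, 0 < e0 & forall delta : R, 0 < delta <= e0 ->
  exists (C : R) (b0 : nat), 0 <= C /\
  forall (b m u : nat) (r : R), (b0 <= b)%N -> (0 < b)%N -> 0 < r <= (2 * b%:R) ^+ A ->
    r <= (b ^ N)%:R -> (u < b)%N -> (m < N)%N ->
  dominated (fun w => if flat G n.+1 delta b u w then square_products G chi b N r u w m n.+1 else 0)
   ((b%:R ^+ m * b%:R ^+ n.+1 * (C * (b%:R ^- (m.+1 * n.+1) *
      (b%:R ^+ (n.+2 * n.+1) * b%:R ^+ (m.+1 * 'C(n.+1, 2)) / r ^+ n.+1 + b%:R ^- P))))).
Proof.
move=> d1 nK.
have [e0 e00 H] := l2_bound G_derive G_bounded kappa_gt0 G_free chi_bounded A P d1 nK.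
have n2 : 0 < 2 * n.+1%:R :> R by rewrite mulr_gt0.
exists (e0 / (2 * n.+1%:R)) => [|delta /andP[del0 del1]]; first by rewrite divr_gt0.
have eps01 : 0 < delta * (2 * n.+1%:R) <= e0 by rewrite mulr_gt0//= -ler_pdivlMr.
have [C [b0 [C0 b00 L2]]] := H _ eps01.
exists C, b0; split => // b m u r b0b b_gt0 rA rN ub mN.
have [r0 _] := andP rA.
have bR0 j : 0 < b%:R ^+ j :> R by rewrite exprn_gt0// ltr0n.
set V := C * _; have V0 : 0 <= V by rewrite /V; nonneg; rewrite ltW// exprn_gt0.
apply: (dominatedS (g := fun w => \sum_(v < b ^ m) \sum_(f : {ffun 'I_n.+1 -> 'I_b} | spread f)
    if flat G n.+1 delta b u w then \prod_(i < n.+1) block G chi b N r u w m.+1 (v * b + f i) ^+ 2 else 0)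
  (B := \sum_(v < b ^ m) \sum_(f : {ffun 'I_n.+1 -> 'I_b} | spread f) V)).
- move=> w _; case: ifP => // _.
  by rewrite big1// => v _; rewrite big1.
- apply: (@le_trans _ _ (\sum_(v < b ^ m) \sum_(f : {ffun 'I_n.+1 -> 'I_b}) V)).
    by apply: ler_sum => v _; rewrite big_mkcond/=; apply: ler_sum => f _; case: ifP.
  rewrite sumr_const card_ord sumr_const card_ffun !card_ord -!mulrnA -[leLHS]mulr_natl.
  by rewrite natrM !natrX [X in X * _]mulrC.
apply: dominated_sum => v _; apply: dominated_sum => f sp.
have := L2 b N m v u r f b0b rA rN ub mN (ltn_ord v) sp.
rewrite mulfK ?gt_eqF// !natrX; apply: dominatedS => // w _.
Qed.

Lemma block_corner k A N : (1 < d)%N -> (0 < k <= K)%N -> (2 * A <= N)%N ->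
  exists (C : R) (b0 : nat), [/\ 0 <= C, (0 < b0)%N &
  forall (b u : nat) (r : R), (b0 <= b)%N -> 1 <= r -> r <= (2 * b%:R) ^+ A ->
    r <= (b ^ N)%:R -> (u < b)%N ->
  dominated (fun w => block G chi b N r u w 0 0 ^+ critical_exponent k)
    (C * b%:R ^+ (2 * critical_exponent k + k.+2 * k) / r ^+ k)].
Proof.
move=> d1 /andP[k0 kK] AN; set q := critical_exponent k.
pose P := (N + k + k * N)%N.
(* A single [delta] is fixed first, small enough for the square-function bounds of all orders; the
   van der Corput constants, which grow as it shrinks, are chosen afterwards. *)
have [delta delta0 Hdelta] := uniform_small (fun n nk => square_products_dominated A N P d1 (leq_trans nk kK)).
have {Hdelta} L2 := fun n nk => Hdelta n delta nk; rewrite delta0 lexx in L2.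
have [|C1 [b1 [C10 b10 {}L2]]] := uniform_large _ (fun n nk => L2 n nk isT).
  move=> n C C' b b' CC bb [C0 H]; split; first exact: le_trans CC.
  move=> b2 m u r bb2 b20 rA rN ub mN.
  have [r0 _] := andP rA.
  apply: dominatedS (H b2 m u r (leq_trans bb bb2) b20 rA rN ub mN) => //.
  have bR0 j : 0 < b2%:R ^+ j :> R by rewrite exprn_gt0// ltr0n.
  rewrite !ler_wpM2l ?ler_wpM2r ?mulr_ge0 ?addr_ge0 ?divr_ge0 ?mulr_ge0 ?invr_ge0 ?(ltW (bR0 _))//.
  by rewrite exprn_ge0// ltW.
have [|C2 [b2 [C20 b20 decay]]] := uniform_large _ (fun n (nk : (n < k)%N) =>
    let: ex_intro C (ex_intro b (And3 _ _ H)) :=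
      block_decay G_derive G_bounded chi_bounded chi_lipschitz n A delta0 in
    ex_intro _ C (ex_intro _ b H)).
  move=> n C C' b b' CC bb H b3 N3 u m v r rho w bb3 AN3 rA ub w1 low mN vb rho1 rhor.
  apply: (le_trans (H b3 N3 u m v r rho w (leq_trans bb bb3) AN3 rA ub w1 low mN vb rho1 rhor)).
  rewrite ler_pM2r ?invr_gt0 ?(lt_le_trans ltr01 rho1)//.
  by rewrite ler_wpM2r.
pose W := (1 + C2) ^+ q.
have W1 : 1 <= W by rewrite exprn_ege1// lerDl.
have W0 : 0 <= W := le_trans ler01 W1.
pose qn i := critical_exponent i.+1.
pose D i m : R := ((4 * i.+1)%:R ^+ q) ^+ m.
have D0 i m : 0 <= D i m by rewrite !exprn_ge0.
pose C3 := W * 4 ^+ d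
  + \sum_(i < k) \sum_(m < N) D i m * (2 ^+ q.+1 * X ^+ (qn i - 2 * i.+1) * W * C1)
  + \sum_(i < k) (D i N * X ^+ q * 4 ^+ d).
exists C3, (maxn b1 b2); split.
- apply: addr_ge0; first apply: addr_ge0; first by nonneg.
    by apply: sumr_ge0 => i _; apply: sumr_ge0 => m _; nonneg.
  by apply: sumr_ge0 => i _; nonneg.
- by rewrite leq_max b10.
move=> b u r; rewrite geq_max => /andP[b1b b2b] r1 rA rN ub.
have b_gt0 : (0 < b)%N := leq_trans b10 b1b.
have beta1 : 1 <= b%:R :> R by rewrite ler1n.
have beta0 : 0 < b%:R :> R := lt_le_trans ltr01 beta1.
have r0 : 0 < r := lt_le_trans ltr01 r1.
have rr : 0 < r <= (2 * b%:R) ^+ A by rewrite r0.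
pose rho i : R := r `^ (i.+1%:R^-1).
have rho1 i : 1 <= rho i := (powR_root i r1).1.
have rhoE i : rho i ^+ i.+1 = r := (powR_root i r1).2.
have rho0 i : 0 < rho i := lt_le_trans ltr01 (rho1 i).
(* With [k] flat derivatives the surplus exponent is zero, so the trivial bound [X] does. *)
pose Y i := if (i.+1 < k)%N then C2 * b%:R / rho i.+1 else X.
have Y0 i : 0 <= Y i.
  by rewrite /Y; case: ifP => // _; nonneg; exact: ltW.
have qk : (k < q)%N.
  by apply: leq_trans (critical_exponent_ge_double k0); rewrite mul2n -addnn -addn1 leq_add2l.
have YW i : (i < k)%N -> Y i ^+ (q - qn i) <= W * b%:R ^+ q / r ^+ (k - i.+1).
  move=> ik; rewrite /Y; case: ltnP => [ik1|ki].
    have le := critical_exponent_ge ik.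
    rewrite expr_div_n; apply: ler_pM.
    - by rewrite exprn_ge0// mulr_ge0.
    - by rewrite invr_ge0 exprn_ge0// ltW.
    - rewrite -exprMn; apply: (@le_trans _ _ (((1 + C2) * b%:R) ^+ (q - qn i))).
        by rewrite lerXn2r ?nnegrE ?mulr_ge0 ?addr_ge0// ler_pM2r// lerDr.
      rewrite ler_weXn2l ?leq_subr//.
      by rewrite mulr_ege1// lerDl.
    - rewrite lef_pV2 ?posrE ?exprn_gt0// -(rhoE i.+1) -exprM ler_weXn2l//.
      rewrite leq_subRL; first exact: le.
      by apply: leq_trans le; exact: leq_addr.
  have -> : i.+1 = k by apply/eqP; rewrite eqn_leq ik.
  rewrite /qn (_ : i.+1 = k) ?subnn; last by apply/eqP; rewrite eqn_leq ik.
  by rewrite !expr0 divr1 mulr_ege1// exprn_ege1.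
pose coef i m : R := D i m * ((2 * b)%:R ^+ q * ((X / (b ^ m.+1)%:R) ^+ (qn i - 2 * i.+1) * Y i ^+ (q - qn i))).
have coef0 i m : 0 <= coef i m.
  by rewrite mulr_ge0// mulr_ge0 ?exprn_ge0// mulr_ge0 ?exprn_ge0// divr_ge0.
pose tail i : R := D i N * ((b ^ N)%:R * (X / (b ^ N)%:R) ^+ q).
have tail0 i : 0 <= tail i.
  by rewrite mulr_ge0// mulr_ge0// exprn_ge0// divr_ge0.
pose F i m w : R := if flat G i.+1 delta b u w then square_products G chi b N r u w m i.+1 else 0.
have F0 i m w : 0 <= F i m w.
  rewrite /F; case: ifP => // _; apply: sumr_ge0 => v _; apply: sumr_ge0 => f _.
  by apply: prodr_ge0 => j _; exact: sqr_ge0.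
pose V i m : R := b%:R ^+ m * b%:R ^+ i.+1 * (C1 * (b%:R ^- (m.+1 * i.+1) *
      (b%:R ^+ (i.+2 * i.+1) * b%:R ^+ (m.+1 * 'C(i.+1, 2)) / r ^+ i.+1 + b%:R ^- P))).
have total : W * b%:R ^+ q / r ^+ k * 4 ^+ d + \sum_(i < k) \sum_(m < N) coef i m * V i m
    + (\sum_(i < k) tail i) * 4 ^+ d <= C3 * b%:R ^+ (2 * q + k.+2 * k) / r ^+ k.
  rewrite -[leRHS]mulrA; set Z := b%:R ^+ (2 * q + k.+2 * k) / r ^+ k.
  have rk0 : 0 < r ^+ k by rewrite exprn_gt0.
  have Zr : (r ^+ k)^-1 <= Z by rewrite /Z ler_peMl ?invr_ge0 ?(ltW rk0)// exprn_ege1.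
  rewrite /C3 2!mulrDl; apply: lerD; first apply: lerD.
  - rewrite -!mulrA; apply: ler_wpM2l => //.
    rewrite mulrA [leRHS]mulrC; apply: ler_wpM2r; first exact: exprn_ge0.
    by rewrite ler_pM2r ?invr_gt0// ler_weXn2l// (leq_trans _ (leq_addr _ _))// leq_pmull.
  - rewrite mulr_suml; apply: ler_sum => i _; rewrite mulr_suml; apply: ler_sum => m _.
    rewrite /coef /V -!mulrA; apply: ler_wpM2l => //.
    have ik : (0 < i.+1 <= k)%N by rewrite /= ltn_ord.
    have rN' : r <= b%:R ^+ N by rewrite -natrX.
    have := corner_term beta1 r1 rN' ik (ltn_ord m) X_ge0 C10 W0 (Y0 i) (leqnn P) (YW i (ltn_ord i)).
    by rewrite -/q -/(qn i) natrM natrX -!mulrA.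
  - rewrite mulr_suml mulr_suml; apply: ler_sum => i _.
    (* At the finest generation the [b^N] blocks of size [X / b^N] contribute
       [X^q * b^(-N (q - 1))], which [r <= b^N] and [k < q] make at most [X^q / r^k]. *)
    rewrite /tail -!mulrA; apply: ler_wpM2l => //.
    have bN0 : 0 < (b ^ N)%:R :> R := lt_le_trans r0 rN.
    rewrite expr_div_n mulrCA -mulrA; apply: ler_wpM2l; first exact: exprn_ge0.
    rewrite mulrA [leRHS]mulrC; apply: ler_wpM2r; first exact: exprn_ge0.
    apply: le_trans Zr; rewrite mulrC.
    rewrite -[q]prednK ?(leq_ltn_trans (leq0n k) qk)// exprS invfM mulrA divff ?gt_eqF// mul1r.
    rewrite lef_pV2 ?posrE ?exprn_gt0//; apply: (@le_trans _ _ (r ^+ q.-1)).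
      by rewrite ler_weXn2l// -ltnS prednK// (leq_ltn_trans (leq0n k) qk).
    by rewrite lerXn2r ?nnegrE// ltW.
apply: (dominatedS (g := fun w => W * b%:R ^+ q / r ^+ k
     + \sum_(i < k) \sum_(m < N) coef i m * F i m w + \sum_(i < k) tail i)
   (B := W * b%:R ^+ q / r ^+ k * 4 ^+ d
     + \sum_(i < k) \sum_(m < N) coef i m * V i m + (\sum_(i < k) tail i) * 4 ^+ d)).
- move=> w w1; set e := block G chi b N r u w 0 0.
  have e0 : 0 <= e by exact: block_ge0.
  have sum0 : 0 <= \sum_(i < k) \sum_(m < N) coef i m * F i m w.
    by apply: sumr_ge0 => i _; apply: sumr_ge0 => m _; rewrite mulr_ge0.
  have tails0 : 0 <= \sum_(i < k) tail i by exact: sumr_ge0.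
  have first0 : 0 <= W * b%:R ^+ q / r ^+ k.
    by nonneg; exact: ltW.
  have multi i : (i < k)%N -> flat G i.+1 delta b u w ->
      (forall m v, (m <= N)%N -> (v < b ^ m)%N -> block G chi b N r u w m v <= Y i) ->
      e ^+ q <= W * b%:R ^+ q / r ^+ k + \sum_(i < k) \sum_(m < N) coef i m * F i m w
              + \sum_(i < k) tail i.
    move=> ik fl eY; pose io := Ordinal ik.
    have ik' : (0 < i.+1 <= k)%N by [].
    apply: (le_trans (multiscale_block chi_bounded b_gt0 ik' (Y0 i) eY)).
    apply: lerD; last first.
      rewrite (bigD1 io)//= lerDl; exact: sumr_ge0.
    rewrite -[leLHS]add0r; apply: lerD => //.
    rewrite (bigD1 io)//= -[leLHS]addr0; apply: lerD; last first.
      by apply: sumr_ge0 => j _; apply: sumr_ge0 => m _; rewrite mulr_ge0.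
    by rewrite /F fl.
  have [flatk|[n nk [fl low]]] := flat_dichotomy G k delta b u w.
    have kk : k.-1.+1 = k by rewrite prednK.
    apply: (multi k.-1); rewrite ?kk// => m v mN vb.
    rewrite /Y kk ltnn; apply: (le_trans (block_le _ _ _ _ _ b_gt0 chi_bounded mN)).
    by rewrite ler_pdivrMr ?ltr0n ?expn_gt0 ?b_gt0// ler_peMr// ler1n expn_gt0 b_gt0.
  (* If the first derivative is already large, the bound [b / r] on the whole block is enough
     without any broad-narrow step, since [k < q]. *)
  case: n nk fl low => [|n] nk fl low.
    have e_le : e <= C2 * b%:R / r.
      by apply: (decay 0%N k0 b N u 0%N 0%N r r w) => //; exact: ltW.
    rewrite -addrA -[leLHS]addr0; apply: lerD; last exact: addr_ge0.
    apply: (@le_trans _ _ ((C2 * b%:R / r) ^+ q)).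
      by rewrite lerXn2r ?nnegrE// divr_ge0 ?mulr_ge0// ltW.
    rewrite expr_div_n exprMn; apply: ler_pM.
    - by rewrite mulr_ge0 ?exprn_ge0.
    - by rewrite invr_ge0 exprn_ge0// ltW.
    - by rewrite ler_wpM2r ?exprn_ge0// /W lerXn2r ?nnegrE ?addr_ge0// lerDr.
    - by rewrite lef_pV2 ?posrE ?exprn_gt0// ler_weXn2l// ltnW.
  apply: (multi n (ltnW nk) fl) => m v mN vb; rewrite /Y nk.
  by apply: (decay n.+1 nk b N u m v r (rho n.+1) w) => //; exact: ltW.
- exact: total.
apply: dominatedD; first apply: dominatedD.
- by apply: dominated_cst; nonneg; exact: ltW.
- apply: dominated_sum => i _; apply: dominated_sum => m _; apply: dominatedZ => //.
  have [_ H] := L2 i (ltn_ord i).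
  by apply: H => //; rewrite r0.
- apply: dominated_cst; exact: sumr_ge0.
Qed.

End block_corner.

(** * The sum over the whole curve *)

Section full_sum.
Context {R : realType} (d : nat).
Variables (G : nat -> R -> 'rV[R]_d) (K : nat) (kappa : R) (Bd : nat -> R).
Hypothesis G_derive : forall l i (t : R), 0 <= t <= 1 ->
  is_derive t 1 (fun s => G l s 0 i) (G l.+1 t 0 i).
Hypothesis G_bounded : forall l i (t : R), 0 <= t <= 1 -> `|G l t 0 i| <= Bd l.
Hypothesis kappa_gt0 : 0 < kappa.
Hypothesis G_free : forall (t : R) (c : nat -> R) j, 0 <= t <= 1 -> (j < K)%N ->
  exists i, kappa * `|c j| <= `|\sum_(l < K) c l * G l.+1 t 0 i|.
Variables (chi : R -> R) (X : R).
Hypothesis chi_bounded : forall s, `|chi s| <= X.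
Hypothesis chi_lipschitz : forall s t, `|chi s - chi t| <= X * `|s - t|.

Definition full b N r w : R :=
  Normc.normc (wave_sum G chi r (b ^ N.+1)%:R^-1 w 0 (b ^ N.+1)) / (b ^ N.+1)%:R.

Lemma full_ge0 b N r w : 0 <= full b N r w.
Proof. by rewrite divr_ge0 ?normc_ge0. Qed.

Lemma full_le_blocks b N r w : (0 < b)%N ->
  full b N r w <= (\sum_(u < b) block G chi b N r u w 0 0) / b%:R.
Proof.
move=> b0; rewrite /full /block -mulr_suml -mulrA -invfM -natrM [(_ * b)%N]mulnC -expnS.
rewrite ler_wpM2r ?invr_ge0// expnS -[(b * _)%N]add0n wave_sum_split.
apply: (le_trans (normc_sum _ _ _)); apply: ler_sum => u _.
by rewrite subn0 mul0n mul1n !add0n addn0 -mulSnr.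
Qed.

(** The mean is at most the largest term, whose power is one of the summands. The loss against
    convexity is at most a factor [b]. *)
Lemma mean_exp_le (b q : nat) (e : nat -> R) : (0 < b)%N -> (forall u, 0 <= e u) ->
  ((\sum_(u < b) e u) / b%:R) ^+ q <= \sum_(u < b) e u ^+ q.
Proof.
case: b => // b _ e0.
have [u umax] := finite_argmax (ord0 : 'I_b.+1) (fun u : 'I_b.+1 => e u).
apply: (@le_trans _ _ (e u ^+ q)).
  rewrite lerXn2r ?nnegrE ?divr_ge0 ?sumr_ge0// ler_pdivrMr//.
  by rewrite mulr_natr -[X in _ *+ X]card_ord -sumr_const; apply: ler_sum.
rewrite (bigD1 u)//= lerDl; apply: sumr_ge0 => v _; exact: exprn_ge0.
Qed.

Lemma full_corner k A N : (1 < d)%N -> (0 < k <= K)%N -> (2 * A <= N)%N ->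
  exists (C : R) (b0 : nat), [/\ 0 <= C, (0 < b0)%N &
  forall (b : nat) (r : R), (b0 <= b)%N -> 1 <= r -> r <= (2 * b%:R) ^+ A ->
    r <= (b ^ N)%:R ->
  dominated (fun w => full b N r w ^+ critical_exponent k)
    (C * b%:R ^+ (2 * critical_exponent k + k.+2 * k).+1 / r ^+ k)].
Proof.
move=> d1 kK AN.
have [C [b0 [C0 b00 H]]] :=
  block_corner G_derive G_bounded kappa_gt0 G_free chi_bounded chi_lipschitz d1 kK AN.
exists C, b0; split => // b r b0b r1 rA rN.
have b_gt0 : (0 < b)%N := leq_trans b00 b0b.
apply: (dominatedS (g := fun w => \sum_(u < b) block G chi b N r u w 0 0 ^+ critical_exponent k)
   (B := \sum_(u < b) (C * b%:R ^+ (2 * critical_exponent k + k.+2 * k) / r ^+ k))).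
- move=> w _; apply: le_trans (@mean_exp_le b (critical_exponent k) (fun u => block G chi b N r u w 0 0) b_gt0 _).
    rewrite lerXn2r ?nnegrE ?full_ge0 ?full_le_blocks// divr_ge0// sumr_ge0// => u _.
    exact: block_ge0.
  by move=> u; exact: block_ge0.
- by rewrite sumr_const card_ord -[leLHS]mulr_natl exprS le_eqVlt; apply/orP; left; apply/eqP; ring.
apply: dominated_sum => u _; exact: H.
Qed.

(** Expanded in the basis of derivatives, [w] has coefficients at most [1 / kappa]; then
    [1 = dot w w] forces one of the [d] inner products to be at least [kappa / d]. *)
Lemma exists_large_derivative (w : 'rV[R]_d) (t : R) : K = d -> 0 <= t <= 1 -> enorm w = 1 ->
  exists2 n, (n < d)%N & kappa / d%:R <= `|dot w (G n.+1 t)|.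
Proof.
move=> Kd t01 w1.
have d0 : (0 < d)%N.
  case: (posnP d) => // d0; move: w1; rewrite /enorm /dot; move: w; rewrite d0 => w.
  by rewrite big_ord0 sqrtr0 => /eqP; rewrite eq_sym oner_eq0.
pose A : 'M[R]_d := \matrix_(l, i) G l.+1 t 0 i.
have AE (c : 'rV[R]_d) i : (c *m A) 0 i = \sum_(l < d) c 0 l * G l.+1 t 0 i.
  by rewrite mxE; apply: eq_bigr => l _; rewrite mxE.
have lower (c : 'rV[R]_d) (j : 'I_d) : exists i, kappa * `|c 0 j| <= `|(c *m A) 0 i|.
  pose c' l : R := if insub l is Some l' then c 0 (l' : 'I_d) else 0.
  have c'E (l : 'I_d) : c' l = c 0 l by rewrite /c' valK.
  have jK : (j < K)%N by rewrite Kd.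
  have [i h] := G_free c' t01 jK; rewrite c'E in h; exists i.
  rewrite AE; apply: (le_trans h); rewrite Kd le_eqVlt; apply/orP; left; apply/eqP.
  by congr `| _ |; apply: eq_bigr => l _; rewrite c'E.
have Aunit : A \in unitmx.
  rewrite -row_free_unit; apply: inj_row_free => v vA0; apply/rowP => j; rewrite mxE.
  have [i h] := lower v j; move: h; rewrite vA0 mxE normr0 pmulr_rle0// normr_le0.
  by move/eqP.
pose c := w *m invmx A.
have cA : c *m A = w by rewrite mulmxKV.
have w_le i : `|w 0 i| <= 1 by rewrite -w1; exact: coord_le_enorm.
have c_le j : `|c 0 j| <= kappa^-1.
  have [i h] := lower c j; rewrite cA in h.
  by rewrite -[kappa^-1]mul1r ler_pdivlMr// mulrC (le_trans h).
have [n nmax] := finite_argmax (Ordinal d0) (fun l : 'I_d => `|dot w (G l.+1 t)|).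
exists (n : nat) => //.
have : 1 <= \sum_(l < d) kappa^-1 * `|dot w (G n.+1 t)|.
  have -> : 1 = \sum_(l < d) c 0 l * dot w (G l.+1 t).
    have /(congr1 (fun x => x ^+ 2)) := w1; rewrite enorm_sqr expr1n => <-.
    rewrite /dot; under [RHS]eq_bigr do rewrite mulr_sumr.
    rewrite exchange_big/=; apply: eq_bigr => i _.
    rewrite -{1}cA AE mulr_suml; apply: eq_bigr => l _; ring.
  apply: (le_trans (ler_norm _)); apply: (le_trans (ler_norm_sum _ _ _)).
  by apply: ler_sum => l _; rewrite normrM ler_pM.
rewrite sumr_const card_ord -[X in _ <= X]mulr_natl mulrCA ler_pdivlMl// mulr1 => h.
by rewrite ler_pdivrMr ?ltr0n// mulrC.
Qed.

Lemma full_sup A N : K = d -> (0 < d)%N -> (2 * A <= N)%N ->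
  exists (C : R) (b0 : nat), [/\ 0 <= C, (0 < b0)%N &
  forall (b : nat) (r : R) (w : 'rV[R]_d), (b0 <= b)%N -> 1 <= r -> r <= (2 * b%:R) ^+ A ->
    enorm w = 1 -> full b N r w <= C * b%:R / r `^ (d%:R^-1)].
Proof.
move=> Kd d0 AN.
have delta0 : 0 < kappa / d%:R by rewrite divr_gt0// ltr0n.
have [|C2 [b2 [C20 b20 decay]]] := uniform_large _ (fun n (nk : (n < d)%N) =>
    let: ex_intro C (ex_intro b (And3 _ _ H)) :=
      block_decay G_derive G_bounded chi_bounded chi_lipschitz n A delta0 in
    ex_intro _ C (ex_intro _ b H)).
  move=> n C C' b b' CC bb H b3 N3 u m v r rho w bb3 AN3 rA ub w1 low mN vb rho1 rhor.
  apply: (le_trans (H b3 N3 u m v r rho w (leq_trans bb bb3) AN3 rA ub w1 low mN vb rho1 rhor)).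
  rewrite ler_pM2r ?invr_gt0 ?(lt_le_trans ltr01 rho1)//.
  by rewrite ler_wpM2r.
exists C2, b2; split => // b r w b2b r1 rA w1.
have b_gt0 : (0 < b)%N := leq_trans b20 b2b.
apply: (le_trans (full_le_blocks _ _ _ b_gt0)); rewrite ler_pdivrMr ?ltr0n//.
rewrite [leRHS]mulr_natr -[X in _ *+ X]card_ord -sumr_const; apply: ler_sum => u _.
have t01 : 0 <= (u%:R / b%:R : R) <= 1.
  by rewrite divr_ge0//= ler_pdivrMr ?ltr0n// mul1r ler_nat ltnW.
have [n nd low] := exists_large_derivative Kd t01 w1.
have [rho1 rhoE] := powR_root n r1.
apply: (le_trans (decay n nd b N u 0%N 0%N r _ w b2b AN rA (ltn_ord u) w1 low (leq0n _) _ rho1 rhoE)) => //.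
rewrite ler_wpM2l ?mulr_ge0// lef_pV2 ?posrE ?powR_gt0 ?(lt_le_trans ltr01)//.
rewrite ler_powR// lef_pV2 ?posrE ?ltr0n// ler_nat//.
Qed.

Lemma measurable_full b N r :
  measurable_fun setT (fun w => full b N r w : measurableTypeR R).
Proof.
apply: measurable_funM => //.
have mw (th : R -> R) : continuous th -> measurable_fun setT (fun w =>
    \sum_(0 <= g < b ^ N.+1) chi (g%:R * (b ^ N.+1)%:R^-1) *
      th (- (r * dot w (G 0 (g%:R * (b ^ N.+1)%:R^-1)))) : measurableTypeR R).
  move=> cth; apply: measurable_sum => g; apply: measurable_funM => //.
  apply: (@measurableT_comp _ _ _ _ _ _ (th : R -> R)); first exact: continuous_measurable_fun.
  apply: measurableT_comp => //; apply: measurable_funM => //; exact: measurable_dot.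
rewrite (_ : (fun w => _) = (fun w => Num.sqrt (
   complex.Re (wave_sum G chi r (b ^ N.+1)%:R^-1 w 0 (b ^ N.+1)) ^+ 2 +
   complex.Im (wave_sum G chi r (b ^ N.+1)%:R^-1 w 0 (b ^ N.+1)) ^+ 2))); last first.
  by apply/funext => w; rewrite -normc_sqr sqrtr_sqr ger0_norm ?normc_ge0.
apply: (@measurableT_comp _ _ _ _ _ _ (Num.sqrt : R -> R)).
  exact: (continuous_measurable_fun (@sqrt_continuous R)).
apply: measurable_funD; apply: measurable_funX.
  rewrite (_ : (fun w => _) = (fun w => \sum_(0 <= g < b ^ N.+1) chi (g%:R * (b ^ N.+1)%:R^-1) *
      cos (- (r * dot w (G 0 (g%:R * (b ^ N.+1)%:R^-1)))))).
    by apply: mw; exact: continuous_cos.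
  by apply/funext => w; rewrite /wave_sum raddf_sum; apply: eq_bigr => g _; rewrite [LHS]Re_wave.
rewrite (_ : (fun w => _) = (fun w => \sum_(0 <= g < b ^ N.+1) chi (g%:R * (b ^ N.+1)%:R^-1) *
    sin (- (r * dot w (G 0 (g%:R * (b ^ N.+1)%:R^-1)))))).
  by apply: mw; exact: continuous_sin.
by apply/funext => w; rewrite /wave_sum raddf_sum; apply: eq_bigr => g _; rewrite [LHS]Im_wave.
Qed.

End full_sum.

(** * The Fourier transform as a limit of sums *)

Section riemann_sums.
Context {R : realType}.
Local Notation mu := (@lebesgue_measure R).

Lemma riemann_sum_le (Phi phi : R -> R) (M : R) n : (0 < n)%N ->
  (forall s : R, 0 <= s <= 1 -> is_derive s 1 Phi (phi s)) ->
  (forall s t : R, 0 <= s <= 1 -> 0 <= t <= 1 -> `|phi s - phi t| <= M * `|s - t|) ->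
  `|Phi 1 - Phi 0 - n%:R^-1 * \sum_(0 <= g < n) phi (g%:R * n%:R^-1)| <= M / n%:R.
Proof.
move=> n0 dPhi lip; have nR : 0 < n%:R :> R by rewrite ltr0n.
have M0 : 0 <= M.
  have := lip 0 1; rewrite !lexx ler01 => /(_ isT isT).
  by rewrite sub0r normrN normr1 mulr1; exact: le_trans.
have -> : Phi 1 - Phi 0 = \sum_(0 <= g < n) (Phi (g.+1%:R * n%:R^-1) - Phi (g%:R * n%:R^-1)).
  by rewrite telescope_sumr// divff ?gt_eqF// mul0r.
rewrite mulr_sumr -sumrB; apply: (le_trans (ler_norm_sum _ _ _)).
apply: (@le_trans _ _ (\sum_(0 <= g < n) (M / n%:R / n%:R))); last first.
  by rewrite sumr_const_nat subn0 -[leLHS]mulr_natr divfK// gt_eqF.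
rewrite !big_nat; apply: ler_sum => g /andP[_ gn].
set x := g%:R * n%:R^-1; set y := g.+1%:R * n%:R^-1.
have xy : x <= y by rewrite ler_pM2r ?invr_gt0// ler_nat.
have yx : y - x = n%:R^-1 by rewrite -mulrBl -natrB// subSnn mul1r.
have x0 : 0 <= x by rewrite divr_ge0.
have y1 : y <= 1 by rewrite ler_pdivrMr// mul1r ler_nat.
have tin (t : R) : x <= t <= y -> 0 <= t <= 1.
  by move=> /andP[xt ty]; rewrite (le_trans x0)//= (le_trans ty).
have [c cxy ->] := mean_value xy (fun t txy => dPhi t (tin t txy)).
rewrite yx [n%:R^-1 * _]mulrC -mulrBl normrM (ger0_norm (_ : 0 <= n%:R^-1)) ?invr_ge0//.
rewrite ler_pM2r ?invr_gt0//.
have xx : x <= x <= y by rewrite lexx.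
apply: (le_trans (lip c x (tin c cxy) (tin x xx))); rewrite ler_wpM2l//.
by case/andP: cxy => xc cy; rewrite ger0_norm ?subr_ge0// -yx lerD2r.
Qed.

Lemma riemann_integral_le (F : R -> R) (M a b a' L : R) n : (0 < n)%N ->
  0 < L -> a <= a' -> a' + L <= b ->
  (forall s t, `|F s - F t| <= M * `|s - t|) ->
  (forall s, ~~ (0 < s < 1) -> F s = 0) ->
  `|\int[mu]_(t in `[a, b]) F ((t - a') / L)
    - L * (n%:R^-1 * \sum_(0 <= g < n) F (g%:R * n%:R^-1))| <= L * M / n%:R.
Proof.
move=> n0 L0 aa' Lb lip Fout.
have M0 : 0 <= M.
  have := lip 0 1; rewrite sub0r normrN normr1 mulr1; exact: le_trans.
pose f t := F ((t - a') / L).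
have cF : continuous F.
  move=> x; apply/cvgrPdist_lt => e e0; near=> y.
  apply: (le_lt_trans (lip x y)); apply: (@le_lt_trans _ _ ((M + 1) * `|x - y|)).
    by rewrite ler_wpM2r// lerDl.
  rewrite mulrC -ltr_pdivlMr ?ltr_wpDl//; near: y.
  by exists (e / (M + 1)) => //=; rewrite divr_gt0// ltr_wpDl.
have cf : continuous f.
  move=> x; apply: (@continuous_comp _ _ _ (fun t => (t - a') / L) F); last exact: cF.
  apply: cvgM; last exact: cvg_cst.
  by apply: cvgB; [exact: cvg_id|exact: cvg_cst].
have fout t : t <= a' \/ a' + L <= t -> f t = 0.
  move=> h; apply: Fout; rewrite negb_and -!leNgt ler_pdivrMr// mul0r subr_le0.
  by rewrite ler_pdivlMr// mul1r lerBrDl; case: h => ->; rewrite ?orbT.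
(* Starting at [a' - 1] makes both [a'] and [a' + L] interior points, so [P] is differentiable in
   the two-sided sense at the ends as well. *)
pose P x := (\int[mu]_(t in `[a' - 1, x]) f t).
have Pa : P a' = 0.
  rewrite /P /Rintegral integral0_eq//= => t; rewrite in_itv/= => /andP[_ ta].
  by rewrite fout//; left.
have Pb : \int[mu]_(t in `[a, b]) f t = P (a' + L).
  rewrite /P Rintegral_mkcond [RHS]Rintegral_mkcond; congr Rintegral.
  apply/funext => t; rewrite !patchE !mem_setE !in_itv/=.
  have [ta|at_] := leP t a'; first by rewrite fout ?if_same//; left.
  have [Lt|tL] := leP (a' + L) t; first by rewrite fout ?if_same//; right.
  by rewrite (le_trans aa' (ltW at_)) (le_trans (ltW tL) Lb) (ltW tL) (le_trans _ (ltW at_))// gerBl.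
have dP (x : R) : a' <= x <= a' + L -> is_derive x 1 P (f x).
  move=> /andP[ax xL].
  have xu : x < a' + L + 1 by rewrite (le_lt_trans xL)// ltrDl.
  have fi : mu.-integrable `[a' - 1, a' + L + 1] (EFin \o f).
    apply: continuous_compact_integrable; first exact: segment_compact.
    exact: continuous_subspaceT.
  have ax1 : a' - 1 < x by lra.
  have [d1 d2] := continuous_FTC1_closed xu fi ax1 (cf x).
  apply: DeriveDef; first exact: d1.
  rewrite -derive1E; exact: d2.
have dPhi (s : R) : 0 <= s <= 1 -> is_derive s 1 (fun s => P (a' + L * s)) (L * F s).
  move=> /andP[s0 s1].
  have h1 : is_derive s 1 (fun s => a' + L * s) L.
    by apply: is_derive_eq; rewrite add0r mul1r /GRing.scale/= mulr1.
  have h2 : is_derive (a' + L * s) 1 P (f (a' + L * s)).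
    by apply: dP; rewrite lerDl mulr_ge0 ?(ltW L0)//= lerD2l ler_piMr// ltW.
  have := @is_derive1_comp _ P (fun s => a' + L * s) s _ _ h2 h1.
  have -> : f (a' + L * s) * L = L * F s.
    by rewrite /f [a' + _]addrC addrK [L * s]mulrC mulfK ?gt_eqF// mulrC.
  exact.
have := @riemann_sum_le (fun s => P (a' + L * s)) (fun s => L * F s) (L * M) n n0 dPhi.
rewrite mulr1 mulr0 addr0 Pa subr0 -mulr_sumr mulrCA Pb; apply.
by move=> s t _ _; rewrite -mulrBr normrM (gtr0_norm L0) -mulrA ler_pM2l.
Unshelve. all: by end_near.
Qed.

End riemann_sums.

Section fourier_upper_bound.
Context {R : realType} (d : nat).
Variables (G : nat -> R -> 'rV[R]_d) (Bd : nat -> R).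
Hypothesis G_derive : forall l i (t : R), 0 <= t <= 1 ->
  is_derive t 1 (fun s => G l s 0 i) (G l.+1 t 0 i).
Hypothesis G_bounded : forall l i (t : R), 0 <= t <= 1 -> `|G l t 0 i| <= Bd l.

(** Derivatives of [G] are known on [[0, 1]] only. When one of the two points lies outside, its term
    vanishes and the Lipschitz bound on [c] alone suffices. *)
Lemma lipschitz_cos_dot (X r th : R) (w : 'rV[R]_d) (c : R -> R) : 0 <= r ->
  (forall i, `|w 0 i| <= 1) -> (forall s, `|c s| <= X) ->
  (forall s t, `|c s - c t| <= X * `|s - t|) -> (forall s, ~~ (0 < s < 1) -> c s = 0) ->
  forall s t, `|c s * cos (r * dot w (G 0 s) + th) - c t * cos (r * dot w (G 0 t) + th)|
    <= X * (1 + r * (d%:R * Bd 1)) * `|s - t|.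
Proof.
move=> r0 w1 cX clip cout.
have X0 : 0 <= X := le_trans (normr_ge0 _) (cX 0).
have t01 : 0 <= (0 : R) <= 1 by rewrite lexx ler01.
have B0 : 0 <= d%:R * Bd 1.
  by apply: le_trans (normr_ge0 _) (norm_dot_le w1 (fun i => G_bounded 1 i t01)).
have rB0 : 0 <= r * (d%:R * Bd 1) by rewrite mulr_ge0.
pose ph s := r * dot w (G 0 s) + th.
have ph_le (s t : R) : s <= t -> 0 <= s -> t <= 1 ->
    `|cos (ph t) - cos (ph s)| <= r * (d%:R * Bd 1) * (t - s).
  move=> st s0 t1.
  have tin (x : R) : s <= x <= t -> 0 <= x <= 1.
    by move=> /andP[sx xt]; rewrite (le_trans s0)//= (le_trans xt).
  have dph (x : R) : s <= x <= t -> is_derive x 1 (fun y => cos (ph y)) (- sin (ph x) * (r * dot w (G 1 x))).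
    move=> sxt; have h1 := is_derive_dot G_derive w 0 (tin x sxt).
    have h2 : is_derive x 1 (fun y => r * dot w (G 0 y)) (r * dot w (G 1 x)) by exact: is_deriveZ.
    have h3 := is_deriveD h2 (is_derive_cst th x 1); rewrite addr0 in h3.
    have := @is_derive1_comp _ cos (fun y => r * dot w (G 0 y) + th) x _ _ (is_derive_cos _) h3.
    exact.
  apply: (mean_value_le st dph) => x sxt.
  rewrite normrM normrN -[leRHS]mul1r; apply: ler_pM => //.
    by rewrite ler_norml sin_geN1 sin_le1.
  rewrite normrM (ger0_norm r0) ler_wpM2l//.
  exact: norm_dot_le w1 (fun i => G_bounded 1 i (tin x sxt)).
have cph x : `|c x * cos (ph x)| <= `|c x| by rewrite normrM ler_piMr// norm_cos_le1.
have wlog_ (s t : R) : s <= t -> `|c s * cos (ph s) - c t * cos (ph t)| <=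
    X * (1 + r * (d%:R * Bd 1)) * `|s - t|.
  move=> st; have XM : X * `|s - t| <= X * (1 + r * (d%:R * Bd 1)) * `|s - t|.
    by rewrite ler_wpM2r// ler_peMr// lerDl.
  have [s0|s0] := leP s 0.
    apply: le_trans XM; have cs : c s = 0 by apply: cout; rewrite ltNge s0.
    rewrite cs mul0r sub0r normrN; apply: (le_trans (cph t)).
    by have := clip s t; rewrite cs sub0r normrN.
  have [t1|t1] := leP 1 t.
    apply: le_trans XM; have ct : c t = 0 by apply: cout; rewrite [t < 1]ltNge t1 andbF.
    rewrite ct mul0r subr0; apply: (le_trans (cph s)).
    by have := clip s t; rewrite ct subr0.
  rewrite (_ : _ - _ = (c s - c t) * cos (ph s) - c t * (cos (ph t) - cos (ph s))); last by ring.
  apply: (le_trans (ler_normB _ _)); rewrite [leRHS](_ : _ = X * `|s - t| + X * (r * (d%:R * Bd 1) * `|s - t|)); last by ring.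
  apply: lerD.
    by rewrite normrM; apply: le_trans (clip s t); rewrite ler_piMr// norm_cos_le1.
  rewrite normrM; apply: ler_pM => //.
  by rewrite [`|s - t|]distrC [`|t - s|]ger0_norm ?subr_ge0// ph_le// ltW.
move=> s t; have [st|/ltW ts] := leP s t; first exact: wlog_.
by rewrite distrC [`|s - t|]distrC; exact: wlog_.
Qed.

Variables (gamma : R -> 'rV[R]_d) (chi : R -> R[i]) (a b a' L X : R).
Hypothesis L_gt0 : 0 < L.
Hypothesis aa' : a <= a'.
Hypothesis Lb : a' + L <= b.
Hypothesis G0E : forall s, G 0 s = gamma (a' + L * s).

Let c1 (s : R) : R := complex.Re (chi (a' + L * s)).
Let c2 (s : R) : R := complex.Im (chi (a' + L * s)).

Hypothesis c1X : forall s, `|c1 s| <= X.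
Hypothesis c2X : forall s, `|c2 s| <= X.
Hypothesis c1_lip : forall s t, `|c1 s - c1 t| <= X * `|s - t|.
Hypothesis c2_lip : forall s t, `|c2 s - c2 t| <= X * `|s - t|.
Hypothesis c1_out : forall s, ~~ (0 < s < 1) -> c1 s = 0.
Hypothesis c2_out : forall s, ~~ (0 < s < 1) -> c2 s = 0.

Lemma norm_Re_le (z : R[i]) : `|complex.Re z| <= Normc.normc z.
Proof.
by rewrite -ler_sqr ?nnegrE ?normc_ge0// normc_sqr real_normK ?num_real// lerDl sqr_ge0.
Qed.

Lemma norm_Im_le (z : R[i]) : `|complex.Im z| <= Normc.normc z.
Proof.
by rewrite -ler_sqr ?nnegrE ?normc_ge0// normc_sqr real_normK ?num_real// lerDr sqr_ge0.
Qed.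

Lemma normc_le_ReIm (z : R[i]) : Normc.normc z <= `|complex.Re z| + `|complex.Im z|.
Proof.
rewrite -ler_sqr ?nnegrE ?normc_ge0 ?addr_ge0// normc_sqr sqrrD !real_normK ?num_real//.
by rewrite -addrA lerD2l lerDr mulrn_wge0// mulr_ge0.
Qed.

Lemma fourier_curve_le n (r : R) (w : 'rV[R]_d) : (0 < n)%N -> 0 <= r ->
  (forall i, `|w 0 i| <= 1) ->
  Normc.normc (fourier_curve `[a, b] gamma chi (r *: w)) <=
  2 * (L * (Normc.normc (wave_sum G c1 r n%:R^-1 w 0 n) / n%:R +
            Normc.normc (wave_sum G c2 r n%:R^-1 w 0 n) / n%:R))
  + 4 * (L * (X * (1 + r * (d%:R * Bd 1))) / n%:R).
Proof.
move=> n0 r0 w1.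
set W1 := wave_sum G c1 _ _ _ _ _; set W2 := wave_sum G c2 _ _ _ _ _.
pose ps s := r * dot w (G 0 s).
have tE t : a' + L * ((t - a') / L) = t by rewrite mulrC divfK ?gt_eqF// addrC subrK.
(* Real and imaginary parts of [exp (-i ps) (c1 + i c2)], each sine being a cosine shifted by a
   quarter turn. *)
pose F1 s := c1 s * cos (ps s + 0) + c2 s * cos (ps s + (- (pi / 2))).
pose F2 s := c2 s * cos (ps s + 0) + c1 s * cos (ps s + pi / 2).
set M := X * (1 + r * (d%:R * Bd 1)).
have lipF (c c' : R -> R) th : (forall s, `|c s| <= X) -> (forall s, `|c' s| <= X) ->
    (forall s t, `|c s - c t| <= X * `|s - t|) -> (forall s t, `|c' s - c' t| <= X * `|s - t|) ->
    (forall s, ~~ (0 < s < 1) -> c s = 0) -> (forall s, ~~ (0 < s < 1) -> c' s = 0) ->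
    forall s t, `|(c s * cos (ps s + 0) + c' s * cos (ps s + th)) -
                  (c t * cos (ps t + 0) + c' t * cos (ps t + th))| <= 2 * M * `|s - t|.
  move=> cX c'X cl c'l co c'o s t; rewrite opprD addrACA; apply: (le_trans (ler_normD _ _)).
  rewrite -mulrA mulr_natl mulr2n; apply: lerD.
    exact: (lipschitz_cos_dot 0 r0 w1 cX cl co).
  exact: (lipschitz_cos_dot th r0 w1 c'X c'l c'o).
have outF (c c' : R -> R) th : (forall s, ~~ (0 < s < 1) -> c s = 0) ->
    (forall s, ~~ (0 < s < 1) -> c' s = 0) ->
    forall s, ~~ (0 < s < 1) -> c s * cos (ps s + 0) + c' s * cos (ps s + th) = 0.
  by move=> co c'o s sN; rewrite co// c'o// !mul0r addr0.
have I1 := riemann_integral_le n0 L_gt0 aa' Lb (lipF c1 c2 (- (pi / 2)) c1X c2X c1_lip c2_lip c1_out c2_out)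
  (outF c1 c2 (- (pi / 2)) c1_out c2_out).
have I2 := riemann_integral_le n0 L_gt0 aa' Lb (lipF c2 c1 (pi / 2) c2X c1X c2_lip c1_lip c2_out c1_out)
  (outF c2 c1 (pi / 2) c2_out c1_out).
have dotE t : dot (r *: w) (gamma t) = ps ((t - a') / L).
  rewrite /ps G0E tE /dot mulr_sumr; apply: eq_bigr => i _.
  by rewrite mxE mulrA.
have ReE : complex.Re (fourier_curve `[a, b] gamma chi (r *: w)) =
    \int[lebesgue_measure]_(t in `[a, b]) F1 ((t - a') / L).
  rewrite /fourier_curve /cintegral /=; congr Rintegral.
  apply/funext => t; rewrite /F1 dotE /c1 /c2 tE /expi; case: (chi t) => x y /=.
  by rewrite addr0 cosBpihalf cosN sinN; ring.
have ImE : complex.Im (fourier_curve `[a, b] gamma chi (r *: w)) =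
    \int[lebesgue_measure]_(t in `[a, b]) F2 ((t - a') / L).
  rewrite /fourier_curve /cintegral /=; congr Rintegral.
  apply/funext => t; rewrite /F2 dotE /c1 /c2 tE /expi; case: (chi t) => x y /=.
  by rewrite addr0 cosDpihalf cosN sinN; ring.
have nR : 0 < n%:R :> R by rewrite ltr0n.
have ReW c : complex.Re (wave_sum G c r n%:R^-1 w 0 n) =
    \sum_(0 <= g < n) c (g%:R * n%:R^-1) * cos (- ps (g%:R * n%:R^-1)).
  by rewrite /wave_sum raddf_sum; apply: eq_bigr => g _; rewrite [LHS]Re_wave.
have ImW c : complex.Im (wave_sum G c r n%:R^-1 w 0 n) =
    \sum_(0 <= g < n) c (g%:R * n%:R^-1) * sin (- ps (g%:R * n%:R^-1)).
  by rewrite /wave_sum raddf_sum; apply: eq_bigr => g _; rewrite [LHS]Im_wave.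
have S1 : \sum_(0 <= g < n) F1 (g%:R * n%:R^-1) = complex.Re W1 - complex.Im W2.
  rewrite ReW ImW -sumrB; apply: eq_bigr => g _.
  by rewrite /F1 addr0 cosBpihalf cosN sinN; ring.
have S2 : \sum_(0 <= g < n) F2 (g%:R * n%:R^-1) = complex.Re W2 + complex.Im W1.
  rewrite ReW ImW -big_split/=; apply: eq_bigr => g _.
  by rewrite /F2 addr0 cosDpihalf cosN sinN; ring.
have bound (I S : R) (z z' : R[i]) : `|I - L * (n%:R^-1 * S)| <= L * (2 * M) / n%:R ->
    `|S| <= Normc.normc z + Normc.normc z' ->
    `|I| <= L * (Normc.normc z / n%:R + Normc.normc z' / n%:R) + 2 * (L * M / n%:R).
  move=> IS Sz; rewrite -[I](subrK (L * (n%:R^-1 * S))) addrC.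
  apply: (le_trans (ler_normD _ _)); apply: lerD; last by apply: (le_trans IS); lra.
  rewrite !normrM (gtr0_norm L_gt0) ler_pM2l// -mulrDl mulrC normfV normr_nat.
  by rewrite ler_pM2r ?invr_gt0.
apply: (le_trans (normc_le_ReIm _)).
have B1 : `|complex.Re (fourier_curve `[a, b] gamma chi (r *: w))| <=
    L * (Normc.normc W1 / n%:R + Normc.normc W2 / n%:R) + 2 * (L * M / n%:R).
  rewrite ReE; apply: (bound _ _ _ _ I1); rewrite S1.
  by apply: (le_trans (ler_normB _ _)); apply: lerD; [exact: norm_Re_le|exact: norm_Im_le].
have B2 : `|complex.Im (fourier_curve `[a, b] gamma chi (r *: w))| <=
    L * (Normc.normc W1 / n%:R + Normc.normc W2 / n%:R) + 2 * (L * M / n%:R).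
  rewrite ImE; apply: (bound _ _ _ _ I2); rewrite S2 addrC.
  by apply: (le_trans (ler_normD _ _)); apply: lerD; [exact: norm_Im_le|exact: norm_Re_le].
move: B1 B2; set u := L * (_ + _); set v := L * M / _; lra.
Qed.

End fourier_upper_bound.

(** * Rescaling to the unit interval and uniform independence *)

Section reduction.
Context {R : realType}.

Lemma vanishing_near (A : set R) (x : R) : ~ closure A x ->
  exists2 e : R, 0 < e & forall t, `|x - t| < e -> ~ A t.
Proof.
move=> Ax; have : (~` closure A) x by [].
have oA : open (~` closure A) by apply: closed_openC; exact: closed_closure.
move=> xA; have /nbhs_ballP[e /= e0 eA] := open_nbhs_nbhs (conj oA xA).
exists e => // t xt At; apply: (eA t xt); exact: subset_closure.
Qed.

(** Retreating strictly inside [[a, b]] turns the derivatives within the interval into ordinary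
    two-sided ones. *)
Lemma support_gap (a b : R) (chi : R -> R[i]) : a < b ->
  csupport chi `<=` interior `[a, b] ->
  exists a' L : R, [/\ a < a', 0 < L, a' + L < b &
    forall t, ~~ (a' < t < a' + L) -> chi t = 0].
Proof.
move=> ab supp.
have inab t : csupport chi t -> a <= t <= b.
  by move=> /supp /interior_subset; rewrite /= in_itv.
have bad (x y : R) : (forall e, 0 < e -> exists2 t, `|x - t| < e & ~ (a <= t <= b)) ->
    ~ csupport chi x.
  move=> H /supp; rewrite /interior /= => /nbhs_ballP[e /= e0 eA].
  have [t xt tab] := H e e0; apply: tab; have := eA t xt; by rewrite /= in_itv.
have [|e1 e10 E1] := @vanishing_near [set t | chi t != 0] a.
  apply: (bad a a) => e e0; exists (a - e / 2).
    by rewrite opprB addrC subrK ger0_norm; [lra|rewrite divr_ge0// ltW].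
  by move=> /andP[+ _]; lra.
have [|e2 e20 E2] := @vanishing_near [set t | chi t != 0] b.
  apply: (bad b b) => e e0; exists (b + e / 2).
    by rewrite opprD addrA subrr add0r normrN ger0_norm; [lra|rewrite divr_ge0// ltW].
  by move=> /andP[_ +]; lra.
pose e := Num.min e1 (Num.min e2 ((b - a) / 2)) / 2.
have m0 : 0 < Num.min e1 (Num.min e2 ((b - a) / 2)).
  by rewrite !lt_min e10 e20 divr_gt0// subr_gt0.
have [h1 h2 h3] : [/\ 2 * e <= e1, 2 * e <= e2 & 4 * e <= b - a].
  have E : 2 * e = Num.min e1 (Num.min e2 ((b - a) / 2)) by rewrite /e; field.
  have l1 : 2 * e <= e1 by rewrite E ge_min lexx.
  have l2 : 2 * e <= e2 by rewrite E !ge_min lexx orbT.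
  have l3 : 2 * e <= (b - a) / 2 by rewrite E !ge_min lexx !orbT.
  by split => //; lra.
have e0 : 0 < e by rewrite divr_gt0.
exists (a + e), (b - a - 2 * e); split; [lra|lra|lra|].
move=> t tN; apply/eqP/negPn/negP => chit.
have /andP[at_ tb] : a <= t <= b by apply: inab; exact: subset_closure.
move: tN; rewrite negb_and -!leNgt => /orP[ta|bt].
  by apply: (E1 t) => //; rewrite ltr_norml; apply/andP; split; lra.
by apply: (E2 t) => //; rewrite ltr_norml; apply/andP; split; lra.
Qed.

Lemma is_derive_quotient (g : R -> R) (t l : R) :
  (s - t)^-1 * (g s - g t) @[s --> t^'] --> l -> is_derive t 1 g l.
Proof.
move=> gl.
have sh : (fun h : R => h + t) @ 0^' --> t^'.
  move=> P /nbhs_ballP[e /= e0 eP]; apply/nbhs_ballP; exists e => //= h.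
  rewrite /ball/= sub0r normrN => he h0; apply: eP.
    by rewrite /ball/= opprD addrA addrAC subrr sub0r normrN.
  by apply: contra h0 => /eqP h0; apply/eqP; rewrite -[h](addrK t) h0 subrr.
have gl' : (h^-1 *: ((g \o shift t) (h *: 1) - g t)) @[h --> 0^'] --> l.
  have := cvg_comp _ _ sh gl; apply: cvg_trans; apply: near_eq_cvg.
  near=> h; rewrite /= addrK /shift /= /GRing.scale/= mulr1.
  by [].
apply: DeriveDef; last exact: (cvg_lim _ gl').
by apply/cvg_ex; exists l.
Unshelve. all: by end_near.
Qed.

Lemma is_derive_within d (D : set R) (f : R -> 'rV[R]_d) (t : R) i : nbhs t D ->
  derivable_within D f t -> is_derive t 1 (fun s => f s 0 i) (derive_within D f t 0 i).
Proof.
move=> Dt df; apply: is_derive_quotient.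
have ql : quotient_within f t s @[s --> t^'] --> derive_within D f t.
  apply: cvg_trans df; apply: cvg_app => P; rewrite /within /= => DP.
  by apply: filterS2 Dt DP => s Ds h st; exact: h.
have := @cvg_comp _ _ _ (quotient_within f t) (fun x : 'rV[R]_d => x 0 i) _ _ _ ql
  (@coord_continuous _ _ _ 0 i _).
apply: cvg_trans; apply: near_eq_cvg; near=> s.
by rewrite /= /quotient_within !mxE.
Unshelve. all: by end_near.
Qed.

Lemma unit_itv_bounded (g : R -> R) : (forall t : R, 0 <= t <= 1 -> {for t, continuous g}) ->
  exists B, forall t : R, 0 <= t <= 1 -> `|g t| <= B.
Proof.
move=> cg.
have wg : {within `[0, 1], continuous g}.
  apply: continuous_in_subspaceT => t; rewrite inE/= in_itv/=; exact: cg.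
have [x _ xmax] := EVT_max ler01 wg; have [y _ ymin] := EVT_min ler01 wg.
exists (`|g x| + `|g y|) => t t01.
have tin : t \in `[0, 1] by rewrite in_itv.
rewrite ler_norml; apply/andP; split.
  apply: le_trans (ymin t tin); rewrite lerNl; apply: le_trans (_ : `|g y| <= _).
    by rewrite -normrN ler_norm.
  by rewrite lerDr.
by apply: (le_trans (xmax t tin)); apply: (le_trans (ler_norm _)); rewrite lerDl.
Qed.

Lemma cvg_det n (t : R) (M : R -> 'M[R]_n) :
  (forall i j, {for t, continuous (fun s => M s i j)}) ->
  {for t, continuous (fun s => \det (M s))}.
Proof.
move=> cM; rewrite /prop_for /continuous_at /determinant.
apply: cvg_big => [|sg _]; first exact: add_continuous.
apply: cvgM; first exact: cvg_cst.
by apply: cvg_big => [|i _]; [exact: mul_continuous|exact: cM].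
Qed.

(** Cramer's rule for the Gram matrix [M = A A^T]: [c j * det M] is a combination of the coordinates
    of [c A] with coefficients bounded on [[0, 1]]. By compactness the continuous, nonvanishing
    determinant stays away from zero. *)
Lemma unit_itv_free_lower_bound d K (G : nat -> R -> 'rV[R]_d) : (0 < d)%N ->
  (forall l i (t : R), 0 <= t <= 1 -> {for t, continuous (fun s => G l s 0 i)}) ->
  (forall (t : R) (c : nat -> R), 0 <= t <= 1 ->
     (forall i, \sum_(l < K) c l * G l.+1 t 0 i = 0) -> forall j, (j < K)%N -> c j = 0) ->
  exists2 kappa : R, 0 < kappa & forall (t : R) (c : nat -> R) j, 0 <= t <= 1 -> (j < K)%N ->
    exists i, kappa * `|c j| <= `|\sum_(l < K) c l * G l.+1 t 0 i|.
Proof.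
move=> d0 cG freeG.
pose A t : 'M[R]_(K, d) := \matrix_(l, i) G l.+1 t 0 i.
pose M t := A t *m (A t)^T.
pose N t := (A t)^T *m \adj (M t).
have cA t l i : 0 <= t <= 1 -> {for t, continuous (fun s => A s l i)}.
  by move=> t01; rewrite (_ : (fun s => _) = (fun s => G l.+1 s 0 i)); [exact: cG|apply/funext => s; rewrite mxE].
have cM t i j : 0 <= t <= 1 -> {for t, continuous (fun s => M s i j)}.
  move=> t01; rewrite (_ : (fun s => _) = (fun s => \sum_k A s i k * A s j k)); last first.
    by apply/funext => s; rewrite mxE; apply: eq_bigr => k _; rewrite [(A s)^T _ _]mxE.
  rewrite /prop_for /continuous_at; apply: cvg_big => [|k _]; first exact: add_continuous.
  by apply: cvgM; exact: cA.
have cN t i j : 0 <= t <= 1 -> {for t, continuous (fun s => N s i j)}.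
  move=> t01; rewrite (_ : (fun s => _) = (fun s => \sum_k A s k i * cofactor (M s) j k)); last first.
    by apply/funext => s; rewrite mxE; apply: eq_bigr => k _; rewrite !mxE.
  rewrite /prop_for /continuous_at; apply: cvg_big => [|k _]; first exact: add_continuous.
  apply: cvgM; first exact: cA.
  rewrite /cofactor; apply: cvgM; first exact: cvg_cst.
  apply: (@cvg_det _ t (fun s => row' j (col' k (M s)))) => i' j'.
  rewrite (_ : (fun s => _) = (fun s => M s (lift j i') (lift k j'))); first exact: cM.
  by apply/funext => s; rewrite !mxE.
have det_neq0 t : 0 <= t <= 1 -> \det (M t) != 0.
  move=> t01; rewrite -unitfE -unitmxE -row_free_unit; apply: inj_row_free => v vM.
  have vA : v *m A t = 0.
    have : v *m A t *m (v *m A t)^T = 0 by rewrite trmx_mul mulmxA -[_ *m A t *m _]mulmxA vM mul0mx.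
    move=> /matrixP/(_ 0 0); rewrite mxE [RHS]mxE.
    under eq_bigr do rewrite [(_^T) _ _]mxE -expr2.
    move/eqP; rewrite psumr_eq0 => [/allP h|i _]; last exact: sqr_ge0.
    apply/rowP => i; rewrite [RHS]mxE; apply/eqP; rewrite -sqrf_eq0.
    exact: (h i (mem_index_enum _)).
  pose c l : R := if insub l is Some l' then v 0 (l' : 'I_K) else 0.
  have cE (l : 'I_K) : c l = v 0 l by rewrite /c valK.
  apply/rowP => j; rewrite [RHS]mxE -cE; apply: (freeG t c t01) => // i.
  transitivity ((v *m A t) 0 i); last by rewrite vA mxE.
  by rewrite mxE; apply: eq_bigr => l _; rewrite cE mxE.
have [H HP] : exists H, forall t i j, 0 <= t <= 1 -> `|N t i j| <= H.
  have [B BP] := choice (fun p : 'I_d * 'I_K => unit_itv_bounded (fun t t01 => cN t p.1 p.2 t01)).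
  exists (\sum_p `|B p|) => t i j t01; apply: (le_trans (BP (i, j) t t01)).
  rewrite (bigD1 (i, j))//=; apply: (le_trans (ler_norm _)); rewrite lerDl.
  exact: sumr_ge0.
have [x x01 xmin] : exists2 x : R, 0 <= x <= 1 & forall t, 0 <= t <= 1 -> \det (M x) ^+ 2 <= \det (M t) ^+ 2.
  have wg : {within `[0, 1], continuous (fun t => \det (M t) ^+ 2)}.
    apply: continuous_in_subspaceT => t; rewrite inE/= in_itv/= => t01.
    apply: (@continuous_comp _ _ _ (fun t => \det (M t)) (fun x => x ^+ 2)).
      by apply: cvg_det => i j; exact: cM.
    exact: exprn_continuous.
  have [x x01 xmin] := EVT_min ler01 wg; exists x; first by rewrite in_itv in x01.
  by move=> t t01; apply: xmin; rewrite in_itv.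
pose e := `|\det (M x)|; have e0 : 0 < e by rewrite normr_gt0 det_neq0.
have eP t : 0 <= t <= 1 -> e <= `|\det (M t)|.
  by move=> t01; rewrite /e -ler_sqr ?nnegrE// !real_normK ?num_real// xmin.
pose S := d%:R * `|H| + 1; have S0 : 0 < S by rewrite ltr_wpDl// mulr_ge0.
exists (e / S); first by rewrite divr_gt0.
move=> t c j t01 jK.
pose v : 'rV[R]_K := \row_l c l.
have vA i : (v *m A t) 0 i = \sum_(l < K) c l * G l.+1 t 0 i.
  by rewrite mxE; apply: eq_bigr => l _; rewrite !mxE.
have key : c j * \det (M t) = \sum_i (v *m A t) 0 i * N t i (Ordinal jK).
  have : v *m A t *m N t = \det (M t) *: v.
    by rewrite /N mulmxA -(mulmxA v) -/(M t) -mulmxA mul_mx_adj mul_mx_scalar.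
  by move=> /rowP/(_ (Ordinal jK)); rewrite !mxE mulrC => <-.
have [i imax] := finite_argmax (Ordinal d0) (fun i => `|(v *m A t) 0 i|).
exists i; rewrite -vA mulrAC ler_pdivrMr//.
apply: (@le_trans _ _ (`|c j * \det (M t)|)).
  by rewrite normrM mulrC ler_wpM2l// eP.
rewrite key; apply: (le_trans (ler_norm_sum _ _ _)).
apply: (@le_trans _ _ (\sum_(k < d) `|(v *m A t) 0 i| * `|H|)).
  apply: ler_sum => k _; rewrite normrM; apply: ler_pM; rewrite ?normr_ge0//.
  by apply: (le_trans (HP t k _ t01)); exact: ler_norm.
rewrite sumr_const card_ord -[leLHS]mulr_natl /S mulrDr mulr1 mulrCA mulrA lerDl.
exact: normr_ge0.
Qed.

Lemma smooth_vanishing_lipschitz (f : R -> R) (a' L : R) : 0 < L -> smooth f ->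
  (forall t, ~~ (a' < t < a' + L) -> f t = 0) ->
  exists X : R, (forall s, `|f (a' + L * s)| <= X) /\
    (forall s t, `|f (a' + L * s) - f (a' + L * t)| <= X * `|s - t|).
Proof.
move=> L0 sf fout; pose c s := f (a' + L * s); pose c' s := derive1 f (a' + L * s) * L.
have dlin (s : R) : is_derive s 1 (fun s => a' + L * s) L.
  by apply: is_derive_eq; rewrite add0r mul1r /GRing.scale/= mulr1.
have dc (s : R) : is_derive s 1 c (c' s).
  apply: (@is_derive1_comp _ f (fun s => a' + L * s) s _ _ _ (dlin s)).
  by rewrite derive1E; apply/derivableP; have := sf 0%N (a' + L * s); exact.
have dc' (s : R) : {for s, continuous c'}.
  have h : is_derive (a' + L * s) 1 (derive1 f) (derive1 (derive1 f) (a' + L * s)).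
    by rewrite derive1E; apply/derivableP; have := sf 1%N (a' + L * s); exact.
  have := @is_derive1_comp _ (derive1 f) (fun s => a' + L * s) s _ _ h (dlin s).
  move=> /is_derive_continuous cc; apply: cvgM; [exact: cc|exact: cvg_cst].
have [B BP] := unit_itv_bounded (fun t _ => is_derive_continuous (dc t)).
have [B' BP'] := unit_itv_bounded (fun t _ => dc' t).
have B0 : 0 <= B by apply: le_trans (normr_ge0 _) (BP 0 _); rewrite lexx ler01.
have B'0 : 0 <= B' by apply: le_trans (normr_ge0 _) (BP' 0 _); rewrite lexx ler01.
have cout s : ~~ (0 < s < 1) -> c s = 0.
  move=> sN; apply: fout; apply: contra sN.
  rewrite ltrDl pmulr_rgt0// ltrD2l => /andP[-> h] /=.
  by rewrite -(ltr_pM2l L0) mulr1.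
exists (B + B'); split=> [s|].
  have [s01|sN] := boolP (0 < s < 1); last by rewrite -/(c s) cout// normr0 addr_ge0.
  apply: (@le_trans _ _ B); last by rewrite lerDl.
  by apply: BP; case/andP: s01 => /ltW-> /ltW->.
(* Since [c] vanishes at and beyond both ends, clamping does not change it, and it brings every pair
   of points into the interval where the derivative is bounded. *)
pose clamp (s : R) := Num.max 0 (Num.min 1 s).
have clampE s : c s = c (clamp s).
  rewrite /clamp; have [s1|s1] := leP 1 s.
    by rewrite max_r ?ler01// [LHS]cout ?cout// ?ltxx ?andbF// [s < 1]ltNge s1 andbF.
  have [s0|s0] := leP s 0; last by [].
  by rewrite [LHS]cout ?cout// ?ltxx// ltNge s0.
have clamp01 s : 0 <= clamp s <= 1.
  by rewrite /clamp le_max lexx/= ge_max ler01 ge_min lexx.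
have wl (s t : R) : s <= t -> `|c t - c s| <= B' * (t - s).
  move=> st; rewrite clampE (clampE s).
  have cst : clamp s <= clamp t.
    by rewrite /clamp; move: st; rewrite /Num.max /Num.min; do ![case: ifP => //]; lra.
  have ctin (x : R) : clamp s <= x <= clamp t -> 0 <= x <= 1.
    have /andP[s0 _] := clamp01 s; have /andP[_ t1] := clamp01 t.
    by move=> /andP[sx xt]; rewrite (le_trans s0)//= (le_trans xt).
  apply: (le_trans (mean_value_le cst (fun x _ => dc x) (fun x xin => BP' x (ctin x xin)))).
  rewrite ler_wpM2l//.
  by rewrite /clamp; move: st; rewrite /Num.max /Num.min; do ![case: ifP => //]; lra.
move=> s t; rewrite -/(c s) -/(c t).
have [st|/ltW ts] := leP s t.
  rewrite distrC [`|s - t|]distrC [`|t - s|]ger0_norm ?subr_ge0//.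
  by apply: (le_trans (wl s t st)); rewrite ler_wpM2r ?subr_ge0// lerDr.
rewrite [`|s - t|]ger0_norm ?subr_ge0//.
by apply: (le_trans (wl t s ts)); rewrite ler_wpM2r ?subr_ge0// lerDr.
Qed.

End reduction.

(** * Majorants of the Fourier transform *)

Section upper_bound.
Context {R : realType} (d : nat).
Variables (G : nat -> R -> 'rV[R]_d) (K : nat) (kappa : R) (Bd : nat -> R).
Hypothesis G_derive : forall l i (t : R), 0 <= t <= 1 ->
  is_derive t 1 (fun s => G l s 0 i) (G l.+1 t 0 i).
Hypothesis G_bounded : forall l i (t : R), 0 <= t <= 1 -> `|G l t 0 i| <= Bd l.
Hypothesis kappa_gt0 : 0 < kappa.
Hypothesis G_free : forall (t : R) (c : nat -> R) j, 0 <= t <= 1 -> (j < K)%N ->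
  exists i, kappa * `|c j| <= `|\sum_(l < K) c l * G l.+1 t 0 i|.
Variables (c1 c2 : R -> R) (X L : R).
Hypothesis c1X : forall s, `|c1 s| <= X.
Hypothesis c2X : forall s, `|c2 s| <= X.
Hypothesis c1_lip : forall s t, `|c1 s - c1 t| <= X * `|s - t|.
Hypothesis c2_lip : forall s t, `|c2 s - c2 t| <= X * `|s - t|.
Hypothesis L_gt0 : 0 < L.
Hypothesis d_gt1 : (1 < d)%N.

Let X_ge0 : 0 <= X. Proof. exact: le_trans (normr_ge0 _) (c1X 0). Qed.
Let dB_ge0 : 0 <= d%:R * Bd 1.
Proof.
have t01 : 0 <= (0 : R) <= 1 by rewrite lexx ler01.
by rewrite mulr_ge0//; exact: (Bd_ge0 G_bounded 1 (ltnW d_gt1) t01).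
Qed.

Definition upper b N r w : R := 2 * (L * (full G c1 b N r w + full G c2 b N r w))
  + 4 * (L * (X * (1 + r * (d%:R * Bd 1))) / (b ^ N.+1)%:R).

Lemma upper_ge0 b N r w : 0 <= r -> 0 <= upper b N r w.
Proof.
move=> r0; rewrite /upper; have := full_ge0 G c1 b N r w; have := full_ge0 G c2 b N r w => f2 f1.
by nonneg; rewrite ?mulr_ge0 ?(ltW L_gt0).
Qed.

Lemma measurable_upper b N r :
  measurable_fun setT (fun w => upper b N r w : measurableTypeR R).
Proof.
apply: measurable_funD => //; apply: measurable_funM => //; apply: measurable_funM => //.
by apply: measurable_funD; exact: measurable_full.
Qed.

(** For [b >= 2] one has [r <= (2 b)^A <= b^(2 A)], hence [r^(K+1) <= b^level]. The error of the
    Riemann sum, of order [r / b^level], is then at most a constant times [r^-K]. *)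
Definition level A := (2 * A * K.+1)%N.

Lemma error_le A : exists2 C : R, 0 <= C & forall (b : nat) (r : R),
  (2 <= b)%N -> 1 <= r -> r <= (2 * b%:R) ^+ A ->
  r <= (b ^ level A)%:R /\
  4 * (L * (X * (1 + r * (d%:R * Bd 1))) / (b ^ (level A).+1)%:R) <= C / r ^+ K.
Proof.
exists (4 * (L * (X * (1 + d%:R * Bd 1)))); first by nonneg; exact: ltW.
move=> b r b2 r1 rA.
have b0 : (0 < b)%N := ltnW b2.
have r0 : 0 < r := lt_le_trans ltr01 r1.
have rb : r <= b%:R ^+ (2 * A).
  apply: (le_trans rA); rewrite exprM lerXn2r ?nnegrE ?mulr_ge0 ?exprn_ge0//.
  by rewrite expr2 ler_wpM2r// ler_nat.
have rK : r ^+ K.+1 <= (b ^ level A)%:R.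
  by rewrite natrX /level exprM lerXn2r// nnegrE ?exprn_ge0// ltW.
split; first by apply: le_trans rK; rewrite ler_eXnr.
rewrite -!mulrA; apply: ler_wpM2l => //; apply: ler_wpM2l; first exact: ltW.
apply: ler_wpM2l => //.
have bN0 : 0 < (b ^ (level A).+1)%:R :> R by rewrite ltr0n expn_gt0 b0.
rewrite ler_pdivrMr//; apply: (@le_trans _ _ ((1 + d%:R * Bd 1) * r)).
  by rewrite mulrDl mul1r [X in _ <= _ + X]mulrC lerD2r.
rewrite -mulrA; apply: ler_wpM2l; first by rewrite addr_ge0.
rewrite mulrC ler_pdivlMr ?exprn_gt0// -exprS (le_trans rK)// ler_nat.
by rewrite leq_pexp2l.
Qed.

Lemma sum3_exp_le (x y z : R) q : 0 <= x -> 0 <= y -> 0 <= z ->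
  (x + y + z) ^+ q <= 3 ^+ q * (x ^+ q + y ^+ q + z ^+ q).
Proof.
move=> x0 y0 z0; pose e u : R := if u is 0%N then x else if u is 1%N then y else z.
have e0 u : 0 <= e u by case: u => [|[|u]].
have := @mean_exp_le R 3 q e isT e0.
by rewrite 3!big_ord_recr 3!big_ord_recr !big_ord0/= !add0r expr_div_n ler_pdivrMr ?exprn_gt0// mulrC.
Qed.

Lemma upper_corner k A : (0 < k <= K)%N ->
  exists (C : R) (b0 : nat), 0 <= C /\
  forall (b : nat) (r : R), (b0 <= b)%N -> 1 <= r -> r <= (2 * b%:R) ^+ A ->
  dominated (fun w => upper b (level A) r w ^+ critical_exponent k)
    (C * b%:R ^+ (2 * critical_exponent k + k.+2 * k).+1 / r ^+ k).
Proof.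
move=> kK; set q := critical_exponent k; set c0 := (2 * q + k.+2 * k).+1.
have AN : (2 * A <= level A)%N by rewrite leq_pmulr.
have [C1 [b1 [C10 b10 H1]]] := full_corner G_derive G_bounded kappa_gt0 G_free c1X c1_lip d_gt1 kK AN.
have [C2 [b2 [C20 b20 H2]]] := full_corner G_derive G_bounded kappa_gt0 G_free c2X c2_lip d_gt1 kK AN.
have [E E0 HE] := error_le A.
exists (3 ^+ q * ((2 * L) ^+ q * C1 + (2 * L) ^+ q * C2 + E ^+ q * 4 ^+ d)), (maxn 2 (maxn b1 b2)).
have L2 : 0 <= 2 * L by rewrite mulr_ge0// ltW.
split; first by nonneg.
move=> b r; rewrite !geq_max => /and3P[b2' b1b b2b] r1 rA.
have [rN err] := HE b r b2' r1 rA.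
have r0 : 0 < r := lt_le_trans ltr01 r1.
have b0 : 1 <= b%:R :> R by rewrite ler1n ltnW.
have [k0 _] := andP kK.
have D1 := dominatedZ (exprn_ge0 q L2) (H1 b r b1b r1 rA rN).
have D2 := dominatedZ (exprn_ge0 q L2) (H2 b r b2b r1 rA rN).
have D3 := dominated_cst d (divr_ge0 (exprn_ge0 q E0) (exprn_ge0 k (ltW r0))).
have D := dominatedZ (exprn_ge0 q (ler0n R 3)) (dominatedD (dominatedD D1 D2) D3).
apply: dominatedS D => [w _|].
  have f1 := full_ge0 G c1 b (level A) r w; have f2 := full_ge0 G c2 b (level A) r w.
  set e := 4 * _ in err.
  have e0 : 0 <= e by rewrite /e; nonneg; exact: ltW.
  rewrite /upper -/e; clearbody e; rewrite mulrDr mulrDr ![2 * (L * _)]mulrA.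
  apply: (le_trans (sum3_exp_le q _ _ e0)); [exact: mulr_ge0|exact: mulr_ge0|].
  apply: ler_wpM2l; first exact: exprn_ge0.
  rewrite !exprMn lerD2l; apply: (@le_trans _ _ ((E / r ^+ K) ^+ q)).
    by rewrite lerXn2r// nnegrE ?divr_ge0 ?exprn_ge0// ltW.
  rewrite expr_div_n; apply: ler_wpM2l; first exact: exprn_ge0.
  rewrite lef_pV2 ?posrE ?exprn_gt0// -exprM ler_weXn2l//.
  by case/andP: kK => _ kK'; rewrite (leq_trans kK')// leq_pmulr.
rewrite -/c0; have : 1 <= b%:R ^+ c0 :> R by exact: exprn_ege1.
move: (b%:R ^+ c0) => B B1; rewrite -!mulrA; apply: ler_wpM2l; first exact: exprn_ge0.
have ZE : (r ^+ k)^-1 <= B / r ^+ k by rewrite ler_peMl// invr_ge0 exprn_ge0// ltW.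
rewrite !mulrDl -!mulrA lerD2l; apply: ler_wpM2l; first exact: exprn_ge0.
by rewrite mulrC; apply: ler_wpM2l => //; exact: exprn_ge0.
Qed.

Lemma upper_sup A : K = d ->
  exists (C : R) (b0 : nat), 0 <= C /\
  forall (b : nat) (r : R) (w : 'rV[R]_d), (b0 <= b)%N -> 1 <= r -> r <= (2 * b%:R) ^+ A ->
  enorm w = 1 -> upper b (level A) r w <= C * b%:R / r `^ (d%:R^-1).
Proof.
move=> Kd; have d0 := ltnW d_gt1.
have AN : (2 * A <= level A)%N by rewrite leq_pmulr.
have [C1 [b1 [C10 b10 H1]]] := full_sup G_derive G_bounded kappa_gt0 G_free c1X c1_lip Kd d0 AN.
have [C2 [b2 [C20 b20 H2]]] := full_sup G_derive G_bounded kappa_gt0 G_free c2X c2_lip Kd d0 AN.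
have [E E0 HE] := error_le A.
exists (2 * (L * (C1 + C2)) + E), (maxn 2 (maxn b1 b2)).
split; first by nonneg; exact: ltW.
move=> b r w; rewrite !geq_max => /and3P[b2' b1b b2b] r1 rA w1.
have [_ err] := HE b r b2' r1 rA.
have r0 : 0 < r := lt_le_trans ltr01 r1.
have b0 : 1 <= b%:R :> R by rewrite ler1n ltnW.
have rho0 : 0 < r `^ (d%:R^-1) by rewrite powR_gt0.
have h1 := H1 b r w b1b r1 rA w1; have h2 := H2 b r w b2b r1 rA w1.
rewrite -mulrA mulrDl /upper; apply: lerD.
  rewrite -2!mulrA ler_pM2l// ler_pM2l// mulrDl; apply: lerD.
    by rewrite mulrA.
  by rewrite mulrA.
apply: (le_trans err); apply: ler_wpM2l => //.
apply: (@le_trans _ _ (r `^ (d%:R^-1))^-1); last by rewrite ler_peMl// invr_ge0 ltW.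
rewrite lef_pV2 ?posrE ?exprn_gt0// -powR_mulrn ?(ltW r0)// ler_powR//.
rewrite Kd (@le_trans _ _ 1) ?ler1n// invf_le1 ?ltr0n// ler1n//.
Qed.

End upper_bound.

(** * Interpolation between the corners *)

Section interpolation.
Context {R : realType}.

Lemma critical_exponentR k : 2 * (critical_exponent k)%:R = k%:R ^+ 2 + k%:R + 2 :> R.
Proof.
elim: k => [|k IH]; first by rewrite /critical_exponent bin_small//; ring.
by rewrite critical_exponentS natrD mulrDr IH -natr1; ring.
Qed.

(** Interpolation is done pointwise at a level [l]: a higher corner controls the values above it,
    and the values below are left to a lower corner or to the trivial bound. *)
Lemma powR_le_split (y l p : R) q : 0 <= y -> 0 < l -> p <= q%:R ->
  y `^ p <= (if y <= l then y `^ p else 0) + l `^ (p - q%:R) * y ^+ q.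
Proof.
move=> y0 l0 pq; case: ifPn => [_|]; first by rewrite lerDl mulr_ge0 ?powR_ge0 ?exprn_ge0.
rewrite -ltNge add0r => ly; have y_gt0 : 0 < y := lt_trans l0 ly.
rewrite -powR_mulrn// -[p in leLHS](subrK q%:R) [leLHS]powRD; last by rewrite (gt_eqF y_gt0) implybT.
apply: ler_wpM2r; first exact: powR_ge0.
rewrite -[p - _]opprK !(powRN _ (- _)) lef_pV2 ?posrE ?powR_gt0//.
by rewrite ge0_ler_powR ?nnegrE ?(ltW l0)// ?opprB ?subr_ge0// ltW.
Qed.

Lemma powR_le_lower (y l p : R) q : 0 <= y <= l -> 0 < l -> q%:R <= p ->
  y `^ p <= l `^ (p - q%:R) * y ^+ q.
Proof.
move=> /andP[y0 yl] l0 qp; have [->|y1] := eqVneq y 0.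
  have [p0|p0] := eqVneq p 0.
    have q0 : q = 0%N by apply/eqP; rewrite -(lern0 R) -p0.
    by rewrite p0 q0 subr0 !powRr0 expr0 mulr1.
  by rewrite powR0// mulr_ge0 ?powR_ge0 ?exprn_ge0.
have y_gt0 : 0 < y by rewrite lt_neqAle eq_sym y1.
rewrite -powR_mulrn// -[p in leLHS](subrK q%:R) [leLHS]powRD; last by rewrite (gt_eqF y_gt0) implybT.
apply: ler_wpM2r; first exact: powR_ge0.
by rewrite ge0_ler_powR ?nnegrE ?(ltW l0)// subr_ge0.
Qed.

Lemma big_min_le (s : seq nat) (F : nat -> R) x k : k \in s ->
  \big[Num.min/x]_(i <- s) F i <= F k.
Proof.
elim: s => // j s IH; rewrite inE big_cons => /orP[/eqP->|/IH h]; first by rewrite ge_min lexx.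
by rewrite ge_min h orbT.
Qed.

Lemma sigma_crit_le (d K k : nat) (q : \bar R) : (2 <= k <= K)%N ->
  sigma_crit d K q <= sigma_term k q.
Proof.
move=> /andP[k2 kK]; rewrite /sigma_crit /sigma_min.
case: eqP => [<-|_]; last (rewrite ge_min; apply/orP; right).
  by apply: (@big_min_le _ (fun k => sigma_term k q)); rewrite mem_index_iota k2 ltnS.
by apply: (@big_min_le _ (fun k => sigma_term k q)); rewrite mem_index_iota k2 ltnS.
Qed.

Lemma critical_interval (K : nat) (p : R) : (2 <= K)%N ->
  [\/ p <= 4, (critical_exponent K)%:R <= p |
   exists2 k, (2 <= k < K)%N & (critical_exponent k)%:R <= p <= (critical_exponent k.+1)%:R].
Proof.
elim: K => // K IH; rewrite ltnS leq_eqVlt => /orP[/eqP<-|K2].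
  have [p4|/ltW p4] := leP p 4; [by constructor 1|constructor 2].
  by rewrite /critical_exponent.
have [p4|qp|[k /andP[k2 kK] qp]] := IH K2; first by constructor 1.
  have [pq|/ltW pq] := leP p (critical_exponent K.+1)%:R; last by constructor 2.
  by constructor 3; exists K; [rewrite K2/=|rewrite qp].
by constructor 3; exists k => //; rewrite k2 ltnW.
Qed.

(** The integral of a nonnegative function is a supremum over simple functions below it, so
    comparison is immediate. The Fourier transform enters the final estimate only through such a
    comparison with a measurable majorant. *)
Lemma ge0_integral_mono (dd : measure_display) (T : measurableType dd)
    (mu : {measure set T -> \bar R}) (D : set T) (f g : T -> \bar R) :
  (forall x, D x -> 0 <= f x)%E -> (forall x, D x -> f x <= g x)%E ->
  (\int[mu]_(x in D) f x <= \int[mu]_(x in D) g x)%E.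
Proof.
move=> f0 fg; have g0 x : D x -> (0 <= g x)%E by move=> Dx; apply: le_trans (f0 x Dx) (fg x Dx).
rewrite !ge0_integralE//; apply: le_ereal_sup => _ [h hf <-]; exists h => // x.
apply: (le_trans (hf x)); rewrite !patchE; case: ifPn => // xD; apply: fg.
by rewrite inE in xD.
Qed.

End interpolation.

Section power_means.
Context {R : realType} (d K : nat).
(* [U A b r] bounds the Fourier transform at frequency [r] between
   [b ^ A] and [(2 b) ^ A]. *)
Variables (U : nat -> nat -> R -> 'rV[R]_d -> R) (loss : nat -> nat).
Hypothesis d_gt0 : (0 < d)%N.
Hypothesis K_ge2 : (2 <= K)%N.
Hypothesis U_ge0 : forall A b r w, 0 <= r -> 0 <= U A b r w.
Hypothesis U_corner : forall k A, (0 < k <= K)%N -> exists (C : R) (b0 : nat), 0 <= C /\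
  forall (b : nat) (r : R), (b0 <= b)%N -> 1 <= r -> r <= (2 * b%:R) ^+ A ->
  dominated (fun w => U A b r w ^+ critical_exponent k) (C * b%:R ^+ loss k / r ^+ k).
Hypothesis U_sup : forall A, K = d -> exists (C : R) (b0 : nat), 0 <= C /\
  forall (b : nat) (r : R) (w : 'rV[R]_d), (b0 <= b)%N -> 1 <= r -> r <= (2 * b%:R) ^+ A ->
  enorm w = 1 -> U A b r w <= C * b%:R / r `^ (d%:R^-1).
Hypothesis U_bounded : forall A, exists2 C : R, 0 < C &
  forall (b : nat) (r : R) (w : 'rV[R]_d), (2 <= b)%N -> 1 <= r -> r <= (2 * b%:R) ^+ A ->
  U A b r w <= C.

(** The loss [c] is fixed before [A]: the final choice of [A] in terms of [c] makes [b^c] a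
    negligible power of [r]. *)
Definition power_bound (p e : R) (c : nat) := forall A, exists (C : R) (b0 : nat), 0 <= C /\
  forall (b : nat) (r : R), (b0 <= b)%N -> 1 <= r -> r <= (2 * b%:R) ^+ A ->
  dominated (fun w => U A b r w `^ p) (C * b%:R ^+ c * r `^ (- e)).

Let powr_pow (r x : R) n : 0 < r -> r `^ x / r ^+ n = r `^ (x - n%:R).
Proof. by move=> r0; rewrite powRD ?(gt_eqF r0) ?implybT// powRN powR_mulrn// ltW. Qed.

(** The first corner is [critical_exponent 2 = 4]. At the level [r^(-1/2)] its bound and the trivial
    one below the level both give [r^(-p/2)]. *)
Lemma power_bound_small p : 1 <= p <= 4 -> power_bound p (p / 2) (loss 2).
Proof.
move=> /andP[p1 p4] A; have [|C [b0 [C0 H]]] := @U_corner 2 A; first by rewrite K_ge2.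
exists (4 ^+ d + C), (maxn 1 b0); split; first by rewrite addr_ge0// exprn_ge0.
move=> b r; rewrite geq_max => /andP[b1 b0b] r1 rA.
have r0 : 0 < r := lt_le_trans ltr01 r1.
pose l := r `^ (- (1 / 2)); have l0 : 0 < l by rewrite powR_gt0.
have lp x : l `^ x = r `^ (- (x / 2)) by rewrite /l -powRrM; congr powR; ring.
have D := dominatedD (dominated_cst d (powR_ge0 l p))
  (dominatedZ (powR_ge0 l (p - 4)) (H b r b0b r1 rA)).
apply: dominatedS D => [w w1|].
  have y0 := U_ge0 A b w (ltW r0).
  have p4' : p <= 4%:R by [].
  apply: (le_trans (@powR_le_split _ _ l p 4 y0 l0 p4')); apply: lerD => //.
  case: ifP => [yl|_]; last exact: powR_ge0.
  by rewrite ge0_ler_powR ?nnegrE ?(ltW l0)// (le_trans ler01 p1).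
rewrite !mulrDl; apply: lerD.
  rewrite lp mulrC -mulrA; apply: ler_wpM2l; first exact: exprn_ge0.
  by rewrite ler_peMl ?powR_ge0// exprn_ege1// ler1n.
rewrite lp mulrC -!mulrA; apply: ler_wpM2l => //; apply: ler_wpM2l; first exact: exprn_ge0.
rewrite mulrC powr_pow// le_eqVlt; apply/orP; left; apply/eqP; congr powR; by field.
Qed.

(** Consecutive corners differ by [k + 1], so the level [l = r^(-1/(k+1))] equalizes the two
    contributions: [l^(p - q_k) r^-k = l^(p - q_(k+1)) r^-(k+1)]. *)
Lemma power_bound_middle p k : (2 <= k < K)%N ->
  (critical_exponent k)%:R <= p <= (critical_exponent k.+1)%:R ->
  power_bound p ((p + (critical_exponent k)%:R - 2) / k.+1%:R) (loss k + loss k.+1).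
Proof.
move=> /andP[k2 kK] /andP[kp pk] A.
have [|C1 [b1 [C10 H1]]] := @U_corner k A; first by rewrite (ltnW k2) ltnW.
have [|C2 [b2 [C20 H2]]] := @U_corner k.+1 A; first by rewrite kK.
exists (C1 + C2), (maxn 1 (maxn b1 b2)); split; first by rewrite addr_ge0.
move=> b r; rewrite !geq_max => /and3P[b0 b1b b2b] r1 rA.
have r0 : 0 < r := lt_le_trans ltr01 r1.
have b_ge1 : 1 <= b%:R :> R by rewrite ler1n.
have k0 : k.+1%:R != 0 :> R by rewrite pnatr_eq0.
pose l := r `^ (- k.+1%:R^-1); have l0 : 0 < l by rewrite powR_gt0.
have lp x : l `^ x = r `^ (- (x / k.+1%:R)) by rewrite /l -powRrM; congr powR; ring.
set e := _ / k.+1%:R.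
have q1 := critical_exponentR k; have q2 := critical_exponentR k.+1.
have D := dominatedD (dominatedZ (powR_ge0 l (p - (critical_exponent k)%:R)) (H1 b r b1b r1 rA))
  (dominatedZ (powR_ge0 l (p - (critical_exponent k.+1)%:R)) (H2 b r b2b r1 rA)).
apply: dominatedS D => [w w1|].
  have y0 := U_ge0 A b w (ltW r0).
  apply: (le_trans (powR_le_split y0 l0 pk)); rewrite lerD2r.
  case: ifP => [yl|_]; last by rewrite mulr_ge0 ?powR_ge0 ?exprn_ge0.
  by apply: powR_le_lower; rewrite ?y0.
have term (C : R) j m : 0 <= C -> (loss j <= m)%N ->
    (p - (critical_exponent j)%:R) / k.+1%:R + j%:R = e ->
    l `^ (p - (critical_exponent j)%:R) * (C * b%:R ^+ loss j / r ^+ j) <=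
    C * b%:R ^+ m * r `^ (- e).
  move=> C0 jm je; rewrite lp.
  rewrite (_ : _ * _ = C * b%:R ^+ loss j *
    (r `^ (- ((p - (critical_exponent j)%:R) / k.+1%:R)) / r ^+ j)); last by ring.
  rewrite powr_pow//.
  rewrite (_ : - _ - _ = - e); last by rewrite -je opprD.
  apply: ler_wpM2r; first exact: powR_ge0.
  by rewrite ler_wpM2l// ler_weXn2l.
have kE : k.+1%:R = k%:R + 1 :> R by rewrite natr1.
rewrite !mulrDl; apply: lerD; apply: term => //.
- exact: leq_addr.
- have qE : (critical_exponent k)%:R = (k%:R ^+ 2 + k%:R + 2) / 2 :> R by rewrite -q1; field.
  by rewrite /e qE; field; rewrite addrC natr1.
- exact: leq_addl.
- have qE : (critical_exponent k)%:R = (k%:R ^+ 2 + k%:R + 2) / 2 :> R by rewrite -q1; field.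
  have qE' : (critical_exponent k.+1)%:R = (k.+1%:R ^+ 2 + k.+1%:R + 2) / 2 :> R by rewrite -q2; field.
  by rewrite /e qE qE'; field; rewrite addrC natr1.
Qed.

(** Beyond the last corner each surplus power is paid by the uniform bound [b * r^(-1/d)]. Its
    factor [b] is the reason for the additional loss. *)
Lemma power_bound_large p : K = d -> (critical_exponent d)%:R <= p ->
  power_bound p (d%:R + (p - (critical_exponent d)%:R) / d%:R) (loss d + (Num.truncn p).+1).
Proof.
move=> Kd dp A; have [|C1 [b1 [C10 H1]]] := @U_corner d A; first by rewrite d_gt0 Kd leqnn.
have [C2 [b2 [C20 H2]]] := U_sup A Kd.
set q := critical_exponent d in dp *.
have pq0 : 0 <= p - q%:R by rewrite subr_ge0.
exists ((C2 + 1) `^ (p - q%:R) * C1), (maxn 1 (maxn b1 b2)); split.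
  by rewrite mulr_ge0// powR_ge0.
move=> b r; rewrite !geq_max => /and3P[b0 b1b b2b] r1 rA.
have r0 : 0 < r := lt_le_trans ltr01 r1.
have b_ge1 : 1 <= b%:R :> R by rewrite ler1n.
have b_gt0 : 0 < b%:R :> R := lt_le_trans ltr01 b_ge1.
pose l := (C2 + 1) * b%:R / r `^ (d%:R^-1).
have C2p : 0 < C2 + 1 by rewrite ltr_wpDl.
have l0 : 0 < l by rewrite divr_gt0 ?mulr_gt0// powR_gt0.
have D := dominatedZ (powR_ge0 l (p - q%:R)) (H1 b r b1b r1 rA).
apply: dominatedS D => [w w1|].
  apply: powR_le_lower => //; rewrite U_ge0 ?(ltW r0)//=.
  apply: (le_trans (H2 b r w b2b r1 rA w1)).
  by rewrite ler_pM2r ?invr_gt0 ?powR_gt0// ler_pM2r// lerDl.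
have lp : l `^ (p - q%:R) = (C2 + 1) `^ (p - q%:R) * b%:R `^ (p - q%:R) * r `^ (- ((p - q%:R) / d%:R)).
  rewrite /l -powRN -(powRM _ (ltW C2p) (ltW b_gt0)) powRM ?powR_ge0 ?mulr_ge0 ?(ltW C2p)//.
  by rewrite -powRrM; congr (_ * powR _ _); ring.
rewrite lp -!mulrA; apply: ler_wpM2l; first exact: powR_ge0.
rewrite (_ : - (d%:R + _) = - ((p - q%:R) / d%:R) - d%:R); last by ring.
rewrite (_ : r `^ _ * (C1 * (b%:R ^+ loss d / r ^+ d)) =
  C1 * b%:R ^+ loss d * (r `^ (- ((p - q%:R) / d%:R)) / r ^+ d)); last by ring.
rewrite powr_pow// addnC exprD.
rewrite (_ : b%:R `^ _ * _ = C1 * (b%:R `^ (p - q%:R) * b%:R ^+ loss d * r `^ (- ((p - q%:R) / d%:R) - d%:R))); last by ring.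
apply: ler_wpM2l => //; rewrite -!mulrA; apply: ler_pM; rewrite ?powR_ge0//.
  by rewrite mulr_ge0 ?powR_ge0 ?exprn_ge0.
rewrite -powR_mulrn// ler_powR//.
have p0 : 0 <= p by apply: le_trans dp.
by rewrite (le_trans _ (ltW (truncnS_gt p)))// gerBl ler0n.
Qed.

(** For [K < d] a direction may be orthogonal to all [K] derivatives, so surplus powers are only
    bounded by a constant. This is the source of the term [K / q] in the exponent. *)
Lemma power_bound_flat p : (critical_exponent K)%:R <= p -> power_bound p K%:R (loss K).
Proof.
move=> Kp A; have [|C1 [b1 [C10 H1]]] := @U_corner K A; first by rewrite (ltnW K_ge2) leqnn.
have [T T0 HT] := U_bounded A.
exists (T `^ (p - (critical_exponent K)%:R) * C1), (maxn 2 b1); split.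
  by rewrite mulr_ge0// powR_ge0.
move=> b r; rewrite geq_max => /andP[b2 b1b] r1 rA.
have r0 : 0 < r := lt_le_trans ltr01 r1.
have D := dominatedZ (powR_ge0 T (p - (critical_exponent K)%:R)) (H1 b r b1b r1 rA).
apply: dominatedS D => [w w1|].
  by apply: powR_le_lower => //; rewrite U_ge0 ?(ltW r0)//= HT.
by rewrite powRN powR_mulrn ?(ltW r0)// !mulrA.
Qed.

Lemma power_bound_crit p : (K <= d)%N -> 1 <= p ->
  exists e c, p * sigma_crit d K p%:E <= e /\ power_bound p e c.
Proof.
move=> Kd p1; have p0 : 0 < p := lt_le_trans ltr01 p1.
have term k : (2 <= k <= K)%N -> p * sigma_crit d K p%:E <=
    (p + (critical_exponent k)%:R - k%:R - 2) / k%:R.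
  move=> kK; have k0 : k%:R != 0 :> R.
    by rewrite pnatr_eq0 -lt0n; case/andP: kK => k2 _; exact: ltnW.
  apply: (@le_trans _ _ (p * sigma_term k p%:E)).
    by rewrite ler_pM2l// sigma_crit_le.
  have qE : (critical_exponent k)%:R = (k%:R ^+ 2 + k%:R + 2) / 2 :> R.
    by rewrite -critical_exponentR; field.
  rewrite /sigma_term /recip qE le_eqVlt; apply/orP; left; apply/eqP; field.
  by rewrite k0 gt_eqF.
have [p4|qp|[k kK qp]] := critical_interval p K_ge2.
- exists (p / 2), (loss 2); split; last by apply: power_bound_small; rewrite p1.
  have := term 2%N; rewrite K_ge2 => /(_ isT)/le_trans; apply.
  by rewrite (_ : critical_exponent 2 = 4%N)// le_eqVlt; apply/orP; left; apply/eqP; field.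
- have [KdE|KdN] := eqVneq K d.
    eexists; eexists; split; last by apply: (power_bound_large KdE); rewrite -KdE.
    have := term K; rewrite K_ge2 leqnn => /(_ isT)/le_trans; apply; rewrite -KdE.
    have k0 : K%:R != 0 :> R by rewrite pnatr_eq0 -lt0n ltnW.
    have qE : (critical_exponent K)%:R = (K%:R ^+ 2 + K%:R + 2) / 2 :> R.
      by rewrite -critical_exponentR; field.
    by rewrite qE le_eqVlt; apply/orP; left; apply/eqP; field.
  exists K%:R, (loss K); split; last exact: power_bound_flat.
  apply: (@le_trans _ _ (p * (K%:R / p))); last by rewrite mulrC divfK// gt_eqF.
  by rewrite ler_pM2l// /sigma_crit (negbTE KdN) ge_min lexx.
eexists; eexists; split; last exact: power_bound_middle kK qp.
have kK' : (2 <= k.+1 <= K)%N by case/andP: kK => k2 ->; rewrite ltnW.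
apply: (le_trans (term _ kK')); rewrite critical_exponentS natrD.
by rewrite le_eqVlt; apply/orP; left; apply/eqP; congr (_ / _); ring.
Qed.

Variable y : R -> 'rV[R]_d -> R.
Hypothesis y_ge0 : forall r w, 0 <= y r w.
Hypothesis y_le_upper : forall A b r w, (2 <= b)%N -> 1 <= r -> enorm w = 1 -> y r w <= U A b r w.
Variable T : R.
Hypothesis y_bounded : forall r w, 1 <= r -> enorm w = 1 -> y r w <= T.
Hypothesis measurable_U : forall A b r, measurable_fun setT (U A b r : 'rV[R]_d -> measurableTypeR R).

Lemma scale_of (A : nat) (r : R) : (0 < A)%N -> 1 <= r ->
  let b := Num.truncn (r `^ A%:R^-1) in
  [/\ (0 < b)%N, b%:R ^+ A <= r, r <= (2 * b%:R) ^+ A & b%:R <= r `^ A%:R^-1].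
Proof.
case: A => // A _ r1 b; have r0 : 0 < r := lt_le_trans ltr01 r1.
have [rho1 rhoE] := powR_root A r1; rewrite -/b in rho1.
have rho0 : 0 <= r `^ A.+1%:R^-1 := le_trans ler01 rho1.
have b_le : b%:R <= r `^ A.+1%:R^-1 by rewrite truncn_le.
have b0 : (0 < b)%N by rewrite truncn_ge_nat.
split => //.
  by rewrite -[leRHS]rhoE lerXn2r// nnegrE.
rewrite -{1}rhoE lerXn2r ?nnegrE ?mulr_ge0//.
apply: (le_trans (ltW (truncnS_gt _))); rewrite -/b mulr_natl mulr2n -natr1 lerD2l.
by rewrite ler1n.
Qed.

(** If [b] is below its threshold, [r] is bounded, and a constant times [r^-sigma] exceeds 1
    whatever the sign of [sigma]. *)
Lemma small_scale_le (A b0 : nat) (r sigma : R) : (0 < A)%N -> 1 <= r ->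
  (Num.truncn (r `^ A%:R^-1) < b0)%N -> 1 <= ((2 * b0%:R) ^+ A) `^ `|sigma| * r `^ (- sigma).
Proof.
move=> A0 r1 bb; have [b1 _ rA _] := scale_of A0 r1.
set b := Num.truncn _ in bb b1 rA.
have r0 : 0 < r := lt_le_trans ltr01 r1.
have rB : r <= (2 * b0%:R) ^+ A.
  by apply: (le_trans rA); rewrite lerXn2r ?nnegrE ?mulr_ge0// ler_pM2l// ler_nat ltnW.
apply: (@le_trans _ _ (r `^ `|sigma| * r `^ (- sigma))).
  rewrite -powRD ?(gt_eqF r0) ?implybT// -(powRr0 r) ler_powR//.
  by have := ler_norm sigma; lra.
apply: ler_wpM2r; first exact: powR_ge0.
by rewrite ge0_ler_powR ?nnegrE ?exprn_ge0 ?mulr_ge0// ltW.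
Qed.

Lemma sphere_mean_le (p sigma : R) : (K <= d)%N -> 1 <= p -> sigma < sigma_crit d K p%:E ->
  exists C : R, forall r : R, 2 <= r ->
  ((\int[sphere_measure R d]_(w in sphere R d) ((y r w)%:E `^ p)) `^ p^-1 <=
    (C * r `^ (- sigma))%:E)%E.
Proof.
move=> Kd p1 sig; have p0 : 0 < p := lt_le_trans ltr01 p1.
have [e [c [crit bound]]] := power_bound_crit Kd p1.
pose slack := e - p * sigma.
have slack0 : 0 < slack by rewrite subr_gt0 (lt_le_trans _ crit)// ltr_pM2l.
(* With this [A] the loss satisfies [b^c <= r^(c/A) <= r^slack], which the strict inequality on
   [sigma] can afford. *)
pose A := (Num.truncn (c%:R / slack)).+1.
have A0 : (0 < A)%N by [].
have cA : c%:R / A%:R <= slack.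
  by rewrite ler_pdivrMr// mulrC -ler_pdivrMr// ltW// truncnS_gt.
have [C [b0 [C0 H]]] := bound A.
have dR0 : 0 <= d%:R :> R by [].
have root (r B : R) : 0 <= B -> (\int[sphere_measure R d]_(w in sphere R d) ((y r w)%:E `^ p) <= B%:E)%E ->
    ((\int[sphere_measure R d]_(w in sphere R d) ((y r w)%:E `^ p)) `^ p^-1 <= (B `^ p^-1)%:E)%E.
  move=> B0 IB; rewrite -poweR_EFin; apply: gt0_ler_poweR => //.
  - by rewrite invr_ge0 ltW.
  - rewrite in_itv/= leey andbT; apply: integral_ge0 => w _; by rewrite lee_fin powR_ge0.
  - by rewrite in_itv/= lee_fin B0 leey.
have T0 : 0 <= `|T| by [].
pose T' := (d%:R * (`|T| `^ p * 4 ^+ d)) `^ p^-1.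
exists ((d%:R * C) `^ p^-1 + T' * ((2 * (maxn 2 b0)%:R) ^+ A) `^ `|sigma|) => r r2.
have r1 : 1 <= r by apply: le_trans r2; rewrite ler1n.
have r0 : 0 < r := lt_le_trans ltr01 r1.
have [b1 bA rA b_le] := scale_of A0 r1.
have [small|big] := ltnP (Num.truncn (r `^ A%:R^-1)) (maxn 2 b0).
  apply: (@le_trans _ _ T'%:E).
    apply: root; first by rewrite mulr_ge0// mulr_ge0 ?powR_ge0 ?exprn_ge0.
    apply: (@le_trans _ _ (\int[sphere_measure R d]_(w in sphere R d) (`|T| `^ p)%:E)%E).
      apply: ge0_integral_mono => w w1; first by rewrite lee_fin powR_ge0.
      rewrite poweR_EFin lee_fin ge0_ler_powR ?nnegrE ?(ltW p0)//.
      by apply: (le_trans (y_bounded r1 w1)); exact: ler_norm.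
    have := @sphere_integral_dominated R d (fun=> `|T| `^ p) _ _ _ (dominated_cst d (powR_ge0 `|T| p)).
    by apply => // w; exact: powR_ge0.
  rewrite lee_fin mulrDl -[leLHS]add0r; apply: lerD; first by rewrite mulr_ge0 ?powR_ge0.
  by rewrite -mulrA ler_peMr ?powR_ge0// small_scale_le.
move: big; rewrite geq_max => /andP[b2 b0b].
set b := Num.truncn _ in b1 bA rA b_le b2 b0b.
have D := H b r b0b r1 rA.
have mU : measurable_fun setT (fun w => U A b r w `^ p : measurableTypeR R).
  exact: (measurableT_comp (measurable_powR p) (measurable_U A b r)).
have IU := sphere_integral_dominated mU (fun w => powR_ge0 _ _) D.
apply: (@le_trans _ _ ((d%:R * (C * r `^ (- (p * sigma)))) `^ p^-1)%:E).
  apply: root; first by rewrite mulr_ge0// mulr_ge0 ?powR_ge0.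
  apply: (@le_trans _ _ (d%:R * (C * b%:R ^+ c * r `^ (- e)))%:E).
    apply: le_trans IU; apply: ge0_integral_mono => w w1; first by rewrite lee_fin powR_ge0.
    rewrite poweR_EFin lee_fin ge0_ler_powR ?nnegrE ?(ltW p0) ?y_ge0//.
      by rewrite U_ge0// ltW.
    exact: y_le_upper.
  rewrite lee_fin ler_wpM2l// -mulrA ler_wpM2l//.
  apply: (@le_trans _ _ (r `^ slack * r `^ (- e))).
    apply: ler_wpM2r; first exact: powR_ge0.
    apply: (@le_trans _ _ ((r `^ A%:R^-1) ^+ c)); first by rewrite lerXn2r ?nnegrE ?powR_ge0.
    by rewrite -powR_mulrn ?powR_ge0// -powRrM ler_powR// mulrC.
  rewrite -powRD ?(gt_eqF r0) ?implybT// le_eqVlt; apply/orP; left; apply/eqP.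
  by congr powR; rewrite /slack; ring.
rewrite lee_fin mulrA powRM ?mulr_ge0 ?powR_ge0// -powRrM.
rewrite (_ : - (p * sigma) / p = - sigma); last by field; rewrite gt_eqF.
by rewrite ler_wpM2r ?powR_ge0// lerDl mulr_ge0 ?powR_ge0.
Qed.

Lemma sphere_sup_le (sigma : R) : sigma < sigma_crit d K +oo%E ->
  exists C : R, forall r : R, 2 <= r ->
  (ereal_sup [set (y r w)%:E | w in sphere R d] <= (C * r `^ (- sigma))%:E)%E.
Proof.
move=> sig.
have dsig (C s r : R) : (forall w, enorm w = 1 -> y r w <= C * s) ->
    (ereal_sup [set (y r w)%:E | w in sphere R d] <= (C * s)%:E)%E.
  by move=> h; apply: ge_ereal_sup => _ [w w1 <-]; rewrite lee_fin h.
have [KdE|KdN] := eqVneq K d; last first.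
  (* For [K < d] and [q = +oo] the critical exponent is at most [K * 0 = 0], so [sigma] is negative
     and boundedness suffices. *)
  exists `|T| => r r2; apply: dsig => w w1.
  have r1 : 1 <= r by apply: le_trans r2; rewrite ler1n.
  apply: (le_trans (y_bounded r1 w1)); apply: (le_trans (ler_norm _)).
  rewrite ler_peMr// -(powRr0 r) ler_powR// oppr_ge0 ltW// (lt_le_trans sig)//.
  by rewrite /sigma_crit (negbTE KdN) ge_min mulr0 lexx.
have sig' : sigma < d%:R^-1.
  apply: (lt_le_trans sig); apply: (@le_trans _ _ (sigma_term d +oo%E)).
    by apply: sigma_crit_le; rewrite -KdE K_ge2 leqnn.
  by rewrite /sigma_term mulr0 addr0.
pose slack := d%:R^-1 - sigma; have slack0 : 0 < slack by rewrite subr_gt0.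
pose A := (Num.truncn (1 / slack)).+1.
have A0 : (0 < A)%N by [].
have cA : 1 / A%:R <= slack.
  by rewrite ler_pdivrMr// mulrC -ler_pdivrMr// ltW// truncnS_gt.
have [C [b0 [C0 H]]] := U_sup A KdE.
exists (C + `|T| * ((2 * (maxn 2 b0)%:R) ^+ A) `^ `|sigma|) => r r2.
have r1 : 1 <= r by apply: le_trans r2; rewrite ler1n.
have r0 : 0 < r := lt_le_trans ltr01 r1.
have [b1 bA rA b_le] := scale_of A0 r1.
apply: dsig => w w1; rewrite mulrDl.
have [small|big] := ltnP (Num.truncn (r `^ A%:R^-1)) (maxn 2 b0).
  rewrite -[leLHS]add0r; apply: lerD; first by rewrite mulr_ge0 ?powR_ge0.
  apply: (le_trans (y_bounded r1 w1)); apply: (le_trans (ler_norm _)).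
  by rewrite -mulrA ler_peMr// small_scale_le.
move: big; rewrite geq_max => /andP[b2 b0b].
rewrite -[leLHS]addr0; apply: lerD; last by rewrite !mulr_ge0 ?powR_ge0.
apply: (le_trans (y_le_upper A b2 r1 w1)); apply: (le_trans (H _ _ _ b0b r1 rA w1)).
rewrite -mulrA ler_wpM2l// -powRN.
apply: (@le_trans _ _ (r `^ slack * r `^ (- d%:R^-1))).
  apply: ler_wpM2r; first exact: powR_ge0.
  by apply: (le_trans b_le); rewrite ler_powR// -[A%:R^-1]mul1r.
rewrite -powRD ?(gt_eqF r0) ?implybT// le_eqVlt; apply/orP; left; apply/eqP.
by congr powR; rewrite /slack; ring.
Qed.

End power_means.

Section trivial_bounds.
Context {R : realType} (d : nat).
Variables (G : nat -> R -> 'rV[R]_d) (c : R -> R) (X : R).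
Hypothesis cX : forall s, `|c s| <= X.

Lemma mean_wave_sum_le r h w n : (0 < n)%N ->
  Normc.normc (wave_sum G c r h w 0 n) / n%:R <= X.
Proof.
move=> n0; rewrite ler_pdivrMr ?ltr0n//.
by apply: (le_trans (wave_sum_le _ _ _ _ cX (leq0n n))); rewrite subn0.
Qed.

Lemma full_le b N r w : (0 < b)%N -> full G c b N r w <= X.
Proof. by move=> b0; apply: mean_wave_sum_le; rewrite expn_gt0 b0. Qed.

End trivial_bounds.

(** * Application to the given curve *)

Section main.
Context {R : realType}.

Lemma free_combination d K (D : set R) (gamma : R -> 'rV[R]_d) t (c : nat -> R) :
  free [seq derive_within_n D k gamma t | k <- iota 1 K] ->
  (forall i, \sum_(l < K) c l * derive_within_n D l.+1 gamma t 0 i = 0) ->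
  forall j, (j < K)%N -> c j = 0.
Proof.
move=> fr c0 j jK.
have /freeP H : free (map_tuple (fun k => derive_within_n D k gamma t) (iota_tuple K 1)) := fr.
apply: (H (fun i : 'I_K => c i) _ (Ordinal jK)); apply/rowP => i; rewrite summxE [RHS]mxE -[RHS](c0 i).
apply: eq_bigr => l _; rewrite mxE (nth_map 0%N) ?size_iota// nth_iota//.
Qed.

Lemma smooth_within_rescaled d (a b a' L : R) (gamma : R -> 'rV[R]_d) :
  a < a' -> 0 < L -> a' + L < b -> smooth_within `[a, b] gamma ->
  forall l i (t : R), 0 <= t <= 1 ->
  is_derive t 1 (fun s => (L ^+ l *: derive_within_n `[a, b] l gamma (a' + L * s)) 0 i)
    ((L ^+ l.+1 *: derive_within_n `[a, b] l.+1 gamma (a' + L * t)) 0 i).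
Proof.
move=> aa' L0 Lb sg l i t /andP[t0 t1].
have low : a' <= a' + L * t by rewrite lerDl mulr_ge0// ltW.
have high : a' + L * t <= a' + L by rewrite lerD2l ler_piMr// ltW.
have tin : nbhs (a' + L * t) [set` `[a, b]].
  apply: filterS (@near_in_itvoo _ a b _ _) => [x|]; last first.
    by rewrite in_itv/= (lt_le_trans aa' low) (le_lt_trans high Lb).
  by rewrite /= !in_itv/= => /andP[/ltW-> /ltW->].
have ab : [set` `[a, b]] (a' + L * t).
  by rewrite /= in_itv/= (le_trans (ltW aa') low) (le_trans high (ltW Lb)).
have h1 := is_derive_within i tin (sg l _ ab).
have h2 : is_derive t 1 (fun s => a' + L * s) L.
  by apply: is_derive_eq; rewrite add0r mul1r /GRing.scale/= mulr1.
have h3 := @is_derive1_comp _ (fun s => derive_within_n `[a, b] l gamma s 0 i) (fun s => a' + L * s) t _ _ h1 h2.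
have h4 : is_derive t 1 (fun s => L ^+ l * derive_within_n `[a, b] l gamma (a' + L * s) 0 i)
    (L ^+ l * (derive_within_n `[a, b] l.+1 gamma (a' + L * t) 0 i * L)).
  by apply: is_deriveZ; exact: h3.
rewrite (_ : (fun s => _) = (fun s => L ^+ l * derive_within_n `[a, b] l gamma (a' + L * s) 0 i)); last first.
  by apply/funext => s; rewrite mxE.
by apply: (is_derive_eq h4); rewrite [RHS]mxE exprSr; ring.
Qed.

End main.

Theorem theorem1p2 (R : realType) (d K : nat) (a b : R)
    (gamma : R -> 'rV[R]_d) (chi : R -> R[i]) (q : \bar R)
    (d3 : (3 <= d)%N) (K2 : (2 <= K)%N) (Kd : (K <= d)%N) (ab : a < b)
    (gamma_smooth : smooth_within `[a, b] gamma)
    (chi_smooth : csmooth chi)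
    (chi_supp : csupport chi `<=` interior `[a, b])
    (gamma_free : forall t, t \in `[a, b] ->
       free [seq derive_within_n `[a, b] k gamma t | k <- iota 1 K])
    (q1 : (1 <= q)%E) :
  forall sigma : R, sigma < sigma_crit d K q ->
  exists C : R, forall r : R, 2 <= r ->
    (sphere_average `[a, b] gamma chi q r <= (C * r `^ (- sigma))%:E)%E.
Proof.
have d1 : (1 < d)%N := ltnW d3.
have d0 : (0 < d)%N := ltnW d1.
have [a' [L [aa' L0 Lb chi_out]]] := support_gap ab chi_supp.
(* The factor [L ^ l] is that of the chain rule, so [G l.+1] is the derivative of [G l] in the
   rescaled variable. *)
pose G l s : 'rV[R]_d := L ^+ l *: derive_within_n `[a, b] l gamma (a' + L * s).
have G_derive : forall l i (t : R), 0 <= t <= 1 ->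
    is_derive t 1 (fun s => G l s 0 i) (G l.+1 t 0 i) by exact: smooth_within_rescaled.
have G_cont l i t : 0 <= t <= 1 -> {for t, continuous (fun s => G l s 0 i)}.
  by move=> t01; exact: is_derive_continuous (G_derive l i t t01).
have [Bd G_bounded] : exists Bd : nat -> R, forall l i (t : R), 0 <= t <= 1 -> `|G l t 0 i| <= Bd l.
  have [B BP] := choice (fun p : nat * 'I_d => unit_itv_bounded (fun t t01 => G_cont p.1 p.2 t t01)).
  exists (fun l => \sum_i `|B (l, i)|) => l i t t01; apply: (le_trans (BP (l, i) t t01)).
  by rewrite (bigD1 i)//=; apply: (le_trans (ler_norm _)); rewrite lerDl sumr_ge0.
have [|kappa kappa0 G_free] := unit_itv_free_lower_bound (K := K) d0 G_cont.
  move=> t c /andP[t0 t1] c0 j jK.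
  have tab : a' + L * t \in `[a, b].
    rewrite in_itv/= (le_trans (ltW aa')) ?lerDl ?mulr_ge0 ?(ltW L0)//=.
    by apply: le_trans (ltW Lb); rewrite lerD2l ler_piMr// ltW.
  have cL0 : c j * L ^+ j.+1 = 0.
    apply: (free_combination (c := fun l => c l * L ^+ l.+1) (gamma_free _ tab) _ jK) => i.
    by rewrite -[RHS](c0 i); apply: eq_bigr => l _; rewrite [G _ _ _ _]mxE mulrA.
  by move/eqP: cL0; rewrite mulf_eq0 expf_eq0 (gt_eqF L0) orbF => /eqP.
pose c1 s := complex.Re (chi (a' + L * s)); pose c2 s := complex.Im (chi (a' + L * s)).
have [X1 [c1X1 c1_lip1]] : exists X, (forall s, `|c1 s| <= X) /\
    (forall s t, `|c1 s - c1 t| <= X * `|s - t|).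
  apply: (smooth_vanishing_lipschitz L0 chi_smooth.1) => t tN.
  by rewrite chi_out.
have [X2 [c2X2 c2_lip2]] : exists X, (forall s, `|c2 s| <= X) /\
    (forall s t, `|c2 s - c2 t| <= X * `|s - t|).
  apply: (smooth_vanishing_lipschitz L0 chi_smooth.2) => t tN.
  by rewrite chi_out.
pose X := Num.max X1 X2.
have c1X s : `|c1 s| <= X by rewrite le_max c1X1.
have c2X s : `|c2 s| <= X by rewrite le_max c2X2 orbT.
have c1_lip s t : `|c1 s - c1 t| <= X * `|s - t|.
  by apply: (le_trans (c1_lip1 s t)); rewrite ler_wpM2r// le_max lexx.
have c2_lip s t : `|c2 s - c2 t| <= X * `|s - t|.
  by apply: (le_trans (c2_lip2 s t)); rewrite ler_wpM2r// le_max lexx orbT.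
have in01 s : ~~ (0 < s < 1) -> chi (a' + L * s) = 0.
  move=> sN; apply: chi_out; apply: contra sN.
  rewrite ltrDl pmulr_rgt0// ltrD2l => /andP[-> h] /=.
  by rewrite -(ltr_pM2l L0) mulr1.
have c1_out s : ~~ (0 < s < 1) -> c1 s = 0 by move=> sN; rewrite /c1 in01.
have c2_out s : ~~ (0 < s < 1) -> c2 s = 0 by move=> sN; rewrite /c2 in01.
have G0E s : G 0%N s = gamma (a' + L * s) by rewrite /G expr0 scale1r.
have fourier n (r : R) (w : 'rV[R]_d) (n0 : (0 < n)%N) (r0 : 0 <= r) (w1 : enorm w = 1) :=
  fourier_curve_le G_derive G_bounded L0 (ltW aa') (ltW Lb) G0E c1X c2X c1_lip c2_lip
    c1_out c2_out n0 r0 (fun i => eq_ind _ (fun x => `|w 0 i| <= x) (coord_le_enorm w i) _ w1).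
have X0 : 0 <= X := le_trans (normr_ge0 _) (c1X 0).
have dB0 : 0 <= d%:R * Bd 1%N.
  by rewrite mulr_ge0// (Bd_ge0 G_bounded (t := 0))// lexx ler01.
pose U A b r w := upper G Bd c1 c2 X L b (level K A) r w.
pose y r w := Normc.normc (fourier_curve `[a, b] gamma chi (r *: w)).
pose T := 2 * (L * (X + X)) + 4 * (L * (X * (1 + d%:R * Bd 1%N))).
have U0 A b' r w : 0 <= r -> 0 <= U A b' r w by exact: upper_ge0.
have y0 r w : 0 <= y r w by exact: normc_ge0.
have yU A b' r w : (2 <= b')%N -> 1 <= r -> enorm w = 1 -> y r w <= U A b' r w.
  move=> b2 r1 w1; apply: fourier => //; first by rewrite expn_gt0 ltnW.
  exact: le_trans ler01 r1.
have yT r w : 1 <= r -> enorm w = 1 -> y r w <= T.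
  move=> r1 w1; have r0 : 0 <= r := le_trans ler01 r1.
  (* A grid of about [r] points already keeps the discretization error bounded, which gives a bound
     uniform in [r]. *)
  set n := (Num.truncn r).+1; have n0 : (0 < n)%N by [].
  have rn : r <= n%:R := ltW (truncnS_gt r).
  apply: (le_trans (fourier n r w n0 r0 w1)); apply: lerD.
    by rewrite ler_pM2l// ler_pM2l// lerD// mean_wave_sum_le.
  rewrite ler_pM2l// ler_pdivrMr ?ltr0n// -!mulrA ler_pM2l// ler_wpM2l//.
  have n1 : 1 <= n%:R :> R by rewrite ler1n.
  by rewrite mulrDl mul1r lerD// mulrC ler_wpM2l.
have UB A : exists2 C : R, 0 < C & forall (b' : nat) (r : R) (w : 'rV[R]_d),
    (2 <= b')%N -> 1 <= r -> r <= (2 * b'%:R) ^+ A -> U A b' r w <= C.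
  have [E E0 HE] := error_le K G_bounded c1X L0 d1 A.
  exists (2 * (L * (X + X)) + E + 1).
    by rewrite ltr_wpDl// addr_ge0// !mulr_ge0 ?addr_ge0// ltW.
  move=> b' r w b2 r1 rA; have [_ err] := HE b' r b2 r1 rA.
  rewrite -[leLHS]addr0; apply: lerD => //; apply: lerD.
    by rewrite ler_pM2l// ler_pM2l// lerD// full_le// ltnW.
  apply: (le_trans err); rewrite ler_pdivrMr ?exprn_gt0 ?(lt_le_trans ltr01 r1)//.
  by rewrite ler_peMr// exprn_ege1.
have Ucorner k A := upper_corner G_derive G_bounded kappa0 G_free c1X c2X c1_lip c2_lip L0 d1 (k := k) A.
have Usup A := upper_sup G_derive G_bounded kappa0 G_free c1X c2X c1_lip c2_lip L0 d1 A.
have mU A b' r := measurable_upper G Bd c1 c2 X L b' (level K A) r.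
move=> sigma; case: q q1 => [p||] q1 sig.
- exact: (sphere_mean_le (U := U) d0 K2 U0 Ucorner Usup UB y0 yU yT mU Kd q1 sig).
- exact: (sphere_sup_le (U := U) K2 Usup yU yT sig).
- by [].
Qed.
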